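(* Let $n\ge 1$ be a fixed integer and let $\mathcal X,\mathcal Y$ be fixed finite alphabets. Then the set $$S^{FB}_{Stability}(\text{impossible})=\{(A,W)\in \mathcal M_c^{n\times n}\times \mathcal{CH}_c(\mathcal X,\mathcal Y): C_0^{FB}(W)<\eta(A)\}$$ is semi-decidable (as a subset of $\mathcal M_c^{n\times n}\times \mathcal{CH}_c(\mathcal X,\mathcal Y)$).
   Context: Computability. A sequence of rationals $(r_k)_{k\in\mathbb N}$ is computable if $r_k=(-1)^{s(k)}a(k)/b(k)$ for recursive functions $a,b,s:\mathbb N\to\mathbb N$ with $b(k)\neq 0$ for all $k$. A real $x$ is computable if there is a computable sequence of rationals $(r_k)$ with $|x-r_k|<2^{-k}$ for all $k$; $\mathbb R_c$ is the set of computable reals. A computable real is given as input to a Turing machine by a description (a program) of such a sequence; computable matrices and computable channels are given by descriptions of all their entries. A subset $M$ of a set $D$ of such objects is semi-decidable if there is a Turing machine (with the single output state ''stop'') that, for every input in $D$, halts if the input lies in $M$ and computes forever if it does not. Plants. $\mathcal M_c^{n\times n}$ is the set of $n\times n$ matrices $A$ with entries in $\mathbb R_c$ that are unstable, i.e. have at least one eigenvalue $\lambda$ with $|\lambda|\ge 1$. With $\lambda_1(A),\dots,\lambda_n(A)$ the (complex) eigenvalues of $A$ repeated according to algebraic multiplicity, $\eta(A)=\sum_{j:|\lambda_j(A)|\ge 1}\log_2|\lambda_j(A)|$. Channels. $\mathcal{CH}_c(\mathcal X,\mathcal Y)$ is the set of computable channels, i.e. families $W=(W(y|x))_{x\in\mathcal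 X,y\in\mathcal Y}$ such that for each $x$, $W(\cdot|x)$ is a probability distribution on $\mathcal Y$ with all values in $\mathbb R_c$. For $x^m\in\mathcal X^m$, $y^m\in\mathcal Y^m$ let $W^m(y^m|x^m)=\prod_{j=1}^m W(y_j|x_j)$. Let $M(W,m)$ be the maximum cardinality of a set of words $x^m\in\mathcal X^m$ whose vectors $W^m(\cdot|x^m)$ are pairwise orthogonal (have pairwise disjoint supports). The zero-error capacity is $C_0(W)=\liminf_{m\to\infty}\frac1m\log_2 M(W,m)$. The zero-error capacity with feedback is given by (Shannon) $C_0^{FB}(W)=0$ if $C_0(W)=0$, and otherwise $$C_0^{FB}(W)=\max_{P}\min_{y\in\mathcal Y}\log_2\frac{1}{\sum_{x:W(y|x)>0}P(x)},$$ where $P$ ranges over all probability distributions on $\mathcal X$ (with $\log_2(1/0)=+\infty$). *)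

(* Defs.v *)
From HB Require Import structures.
From mathcomp Require Import all_boot all_order all_algebra.
From mathcomp Require Import all_classical all_reals all_analysis.
From mathcomp Require Import complex.

Set Implicit Arguments.
Unset Strict Implicit.
Unset Printing Implicit Defensive.

Import Order.TTheory GRing.Theory Num.Theory.
Import numFieldNormedType.Exports.

Local Open Scope classical_set_scope.
Local Open Scope ring_scope.

(** * Partial recursive functions and their programs *)

(** Programs carry no arity; an argument missing from the list is read as 0. *)
Inductive recf : Type :=
| RZero
| RSucc
| RProj of nat
| RComp of recf & seq recf
| RPrec of recf & recf
| RMu of recf.

(** [reval f v y]: the partial function with program [f] is defined at the
    arguments [v], with value [y].  Recursion and minimization act on the first
    argument.  In the [RPrec] case [s] is the list of the successive values; in
    the [RMu] case [f] must be defined, and nonzero, below the value found. *)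
Fixpoint reval (f : recf) (v : seq nat) (y : nat) {struct f} : Prop :=
  match f with
  | RZero => y = 0%N
  | RSucc => y = (head 0%N v).+1
  | RProj i => y = nth 0%N v i
  | RComp g hs =>
      exists2 ws : seq nat,
        (fix revals (hs : seq recf) (ws : seq nat) {struct hs} : Prop :=
           match hs, ws with
           | [::], [::] => True
           | h :: hs', w :: ws' => reval h v w /\ revals hs' ws'
           | _, _ => False
           end) hs ws
        & reval g ws y
  | RPrec g h =>
      exists s : seq nat,
        [/\ reval g (behead v) (nth 0%N s 0),
            forall i, (i < head 0%N v)%N ->
              reval h [:: i, nth 0%N s i & behead v] (nth 0%N s i.+1)
          & y = nth 0%N s (head 0%N v)]
  | RMu g =>
      reval g (y :: v) 0%N /\
      forall i, (i < y)%N -> exists k, reval g (i :: v) k.+1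
  end.

Definition computes (p : recf) (f : nat -> nat) : Prop :=
  forall k, reval p [:: k] (f k).

(** Cantor's pairing function. *)
Definition cpair (a b : nat) : nat := ('C((a + b).+1, 2) + b)%N.

(** Goedel numbers of programs. *)
Fixpoint rcode (f : recf) : nat :=
  match f with
  | RZero => cpair 0 0
  | RSucc => cpair 1 0
  | RProj i => cpair 2 i
  | RComp g hs =>
      cpair 3 (cpair (rcode g)
        ((fix rcodes (hs : seq recf) : nat :=
            if hs is h :: hs' then (cpair (rcode h) (rcodes hs')).+1
            else 0%N) hs))
  | RPrec g h => cpair 4 (cpair (rcode g) (rcode h))
  | RMu g => cpair 5 (rcode g)
  end.

(** * Turing machines *)

Inductive move := MoveL | MoveN | MoveR.

(** A tape cell is blank ([None]), or holds an input letter ([inl]) or an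
    auxiliary letter ([inr]). *)
Definition tm_symbol (aux : finType) := option (bool + aux).

Record turing_machine := TuringMachine {
  tm_state : finType;
  tm_aux : finType;
  tm_start : tm_state;
  tm_stop : tm_state;
  tm_delta : tm_state -> tm_symbol tm_aux ->
    tm_state * tm_symbol tm_aux * move }.

Record tm_config (T : turing_machine) := TMConfig {
  cf_state : tm_state T;
  cf_tape : int -> tm_symbol (tm_aux T);
  cf_head : int }.

Definition move_head (d : move) (i : int) : int :=
  match d with MoveL => i - 1 | MoveN => i | MoveR => i + 1 end.

Definition tm_step (T : turing_machine) (c : tm_config T) : tm_config T :=
  let: (q, a, d) := tm_delta (cf_state c) (cf_tape c (cf_head c)) in
  TMConfig q (fun i => if i == cf_head c then a else cf_tape c i)
    (move_head d (cf_head c)).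

Definition tm_init (T : turing_machine) (w : seq bool) : tm_config T :=
  TMConfig (tm_start T)
    (fun i => if i is Posz k then nth None [seq Some (inl b) | b <- w] k
              else None)
    0.

Definition tm_halts (T : turing_machine) (w : seq bool) : Prop :=
  exists t : nat, cf_state (iter t (@tm_step T) (tm_init T w)) = tm_stop T.

(** [repr w x]: the word [w] is a description of the object [x]; an object may
    have many descriptions, and the machine has to be right on all of them. *)
Definition semidecidable (Obj : Type) (repr : seq bool -> Obj -> Prop)
    (D M : set Obj) : Prop :=
  M `<=` D /\
  exists T : turing_machine,
    forall (x : Obj) (w : seq bool), D x -> repr w x -> (tm_halts T w <-> M x).

(** * Computable real numbers *)

(** Programs for the numerators, denominators and signs of a sequence of
    rationals. *)
Record real_desc := RealDesc {
  rd_num : recf;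
  rd_den : recf;
  rd_sgn : recf }.

Definition describes (R : realType) (d : real_desc) (x : R) : Prop :=
  exists a b s : nat -> nat,
    [/\ computes (rd_num d) a, computes (rd_den d) b, computes (rd_sgn d) s,
        forall k, b k != 0%N
      & forall k,
          `|x - (-1) ^+ s k * ((a k)%:R / (b k)%:R)| < 2 ^- k].

Definition computable_real (R : realType) (x : R) : Prop :=
  exists d, describes d x.

Definition log2 (R : realType) (x : R) : R := ln x / ln 2.

(** * Plants *)

Definition cplx_mx (R : realType) (n : nat) (A : 'M[R]_n) : 'M[R[i]]_n :=
  map_mx (fun x : R => x%:C%C) A.

Definition modulus (R : realType) (z : R[i]) : R := complex.Re `|z|.

(** The complex eigenvalues with algebraic multiplicity, in some order. *)
Definition eigenvalues (R : realType) (n : nat) (A : 'M[R]_n) : seq R[i] :=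
  sval (closed_field_poly_normal (char_poly (cplx_mx A))).

Definition eta (R : realType) (n : nat) (A : 'M[R]_n) : R :=
  \sum_(z <- eigenvalues A | 1 <= modulus z) log2 (modulus z).

Definition plants (R : realType) (n : nat) : set 'M[R]_n :=
  [set A : 'M[R]_n | (forall i j, computable_real (A i j)) /\
           exists2 z : R[i], eigenvalue (cplx_mx A) z & 1 <= modulus z].

(** * Channels *)

Definition is_pmf (R : realType) (T : finType) (p : T -> R) : Prop :=
  (forall t, 0 <= p t) /\ \sum_t p t = 1.

(** [W x y] stands for W(y|x). *)
Definition channels (R : realType) (X Y : finType) : set (X -> Y -> R) :=
  [set W : X -> Y -> R | forall x, is_pmf (W x) /\ forall y, computable_real (W x y)].

Definition chan_ext (R : realType) (X Y : finType) (W : X -> Y -> R) (m : nat)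
    (x : m.-tuple X) (y : m.-tuple Y) : R :=
  \prod_(j < m) W (tnth x j) (tnth y j).

Definition orthogonal_words (R : realType) (X Y : finType) (W : X -> Y -> R)
    (m : nat) (C : {set m.-tuple X}) : bool :=
  [forall x in C, forall x' in C, (x != x') ==>
    (\sum_(y : m.-tuple Y) chan_ext W x y * chan_ext W x' y == 0)].

Definition max_code (R : realType) (X Y : finType) (W : X -> Y -> R)
    (m : nat) : nat :=
  \max_(C : {set m.-tuple X} | orthogonal_words W C) #|C|.

Definition C0 (R : realType) (X Y : finType) (W : X -> Y -> R) : \bar R :=
  limn_einf (fun m : nat => (log2 (max_code W m)%:R / m%:R)%:E).

Definition elog2_inv (R : realType) (s : R) : \bar R :=
  if s == 0 then +oo%E else (log2 s^-1)%:E.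

Definition C0FB (R : realType) (X Y : finType) (W : X -> Y -> R) : \bar R :=
  if C0 W == 0%E then 0%E
  else ereal_sup
    [set \big[Order.min/+oo%E]_(y : Y) elog2_inv (\sum_(x | 0 < W x y) P x)
       | P in [set P : X -> R | is_pmf P]].

(** * Descriptions of (plant, channel) pairs *)

(** A list of numbers is written on the tape as a list of unary blocks. *)
Definition unary_word (s : seq nat) : seq bool :=
  flatten [seq rcons (nseq g true) false | g <- s].

Definition desc_codes (d : real_desc) : seq nat :=
  [:: rcode (rd_num d); rcode (rd_den d); rcode (rd_sgn d)].

Definition pair_repr (R : realType) (n : nat) (X Y : finType)
    (w : seq bool) (AW : 'M[R]_n * (X -> Y -> R)) : Prop :=
  exists (dA : 'I_n -> 'I_n -> real_desc) (dW : X -> Y -> real_desc),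
    [/\ forall i j, describes (dA i j) (AW.1 i j),
        forall x y, describes (dW x y) (AW.2 x y)
      & w = unary_word (flatten
              ([seq desc_codes (dA i j) | i <- enum 'I_n, j <- enum 'I_n] ++
               [seq desc_codes (dW x y) | x <- enum X, y <- enum Y]))].

Definition S_FB_impossible (R : realType) (n : nat) (X Y : finType) :
    set ('M[R]_n * (X -> Y -> R)) :=
  [set AW : 'M[R]_n * (X -> Y -> R) | (@plants R n `*` @channels R X Y) AW /\
            (C0FB AW.2 < (eta AW.1)%:E)%E].

(* Main.v *)
Require Import Defs.
From mathcomp Require Import all_boot all_order all_algebra.
From mathcomp Require Import all_classical all_reals all_analysis.
From mathcomp Require Import complex perm spectral.
From mathcomp Require Import zify ring lra.

Set Implicit Arguments.
Unset Strict Implicit.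
Unset Printing Implicit Defensive.

Import Order.TTheory GRing.Theory Num.Theory.

(** Call mu(A) the product of the moduli of the eigenvalues of A outside the open unit disc, so
    that eta(A) = log2 mu(A). The feedback capacity of W depends on W only through the set of
    pairs (x, y) with W(y|x) > 0, and it decreases when this support grows. For each of the
    finitely many supports S it is log2 c with c rational: c = 1 if no two rows of S are disjoint,
    since then the zero-error capacity vanishes ([C0_eq0P]), and otherwise c is the inverse of the
    value of a matrix game with 0-1 payoffs, which is rational because Fourier-Motzkin elimination
    describes the achievable payoffs by rational inequalities ([game_value_rational],
    [C0FB_base]). These constants are built into the machine. By monotonicity
    ([capacity_base_mono]), C0FB(W) < eta(A) holds exactly when some S satisfies W(y|x) > 0 on S
    and mu(A) > c_S: a proved part S of the support is enough, and the full support works when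
    the inequality is true.

    Both conditions are semi-decidable from approximations. For mu(A) > c this is not evident,
    because eigenvalues are not rational functions of A. The characteristic polynomial of the
    power A^k has the roots lambda^k. Each of its coefficients is at most 2^n mu(A)^k in modulus,
    and the coefficient that sees the product of the large eigenvalues is at least mu(A)^k / 2 for
    large k, because every other term contains a factor lambda^k with |lambda| < 1. Hence
    mu(A) > c if and only if some coefficient for some k exceeds 2^n c^k
    ([mahler_gt_char_poly]), and each of these strict inequalities between polynomials in the
    entries of A is confirmed by rational interval arithmetic.

    To obtain a Turing machine, the condition is written as a formula of arithmetic built from
    comparisons of z with x * y + u and from the letters of the input word, with conjunction,
    disjunction, existential quantifiers and bounded universal quantifiers. Such a positive
    formula is true if and only if it is true with all its witnesses below some t, which a
    register machine tests for t = 0, 1, 2 and so on; a Turing machine keeps the registers in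
    unary on the tracks of its tape ([form_semidecidable]). The relations defined by formulas are
    closed under inductive definitions with finitely many premises ([re_derives]), a derivation
    being a finite set of numbers, coded by divisibility. This yields the evaluation of Goedel
    numbers of programs ([evaluatesP]) and the intervals for the entries of the powers of a matrix
    ([nnre_pow]). *)

(** * Register machines on the tape of a Turing machine *)
Definition regs := nat -> nat.

Definition upd (r : regs) (i v : nat) : regs := fun j => if j == i then v else r j.

Lemma upd_eq r i v : upd r i v i = v.
Proof. by rewrite /upd eqxx. Qed.

Lemma upd_neq r i v j : j != i -> upd r i v j = r j.
Proof. by rewrite /upd => /negbTE ->. Qed.

Inductive regop := Keep | Incr | Decr.

Definition app_op (o : regop) (i : nat) (r : regs) : regs :=
  match o with
  | Keep => r
  | Incr => upd r i (r i).+1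
  | Decr => upd r i (r i).-1
  end.

(** One shape of instruction serves for tests, updates and reading: the next label may depend on
    whether the register is zero and on the letter of the input word at the position that the
    register holds. *)
Record instr (L : Type) := Instr {
  ireg : nat;
  iop : regop;
  inext : option bool -> bool -> L }.

(** The labels form a finite type, so that programs can be combined by sums of types; leaving with
    a boolean serves as the value of a test. *)
Record machine := Machine {
  mstate : finType;
  mstart : mstate;
  mcode : mstate -> instr (mstate + bool) }.

Definition letter (w : seq bool) (k : nat) : option bool :=
  nth None [seq Some b | b <- w] k.

Definition mconfig (M : machine) := ((mstate M + bool) * regs)%type.

Definition mstep (M : machine) (w : seq bool) (c : mconfig M) : mconfig M :=
  if c.1 is inl q then
    let I := mcode q in let v := c.2 (ireg I) in
    (inext I (letter w v) (v == 0), app_op (iop I) (ireg I) c.2)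
  else c.

Definition mhalts (M : machine) (w : seq bool) (r : regs) : Prop :=
  exists N b, (iter N (@mstep M w) (inl (mstart M), r)).1 = inr b.

Arguments move_head : simpl never.

Section Simulation.
Variable M : machine.

Let K := \max_(q : mstate M) ireg (mcode q).

(** A cell holds its input letter, a mark of the origin, and for each register [i] the bit that the
    register exceeds the position of the cell. *)
Definition sim_cell : finType := (option bool * bool * {ffun 'I_K.+1 -> bool})%type.

Definition sim_state : finType :=
  option (option (mstate M * option (option 'I_K.+1))).

Definition st_stop : sim_state := None.
Definition st_init : sim_state := Some None.
Definition st_go (q : mstate M) : sim_state := Some (Some (q, None)).
Definition st_back (q : mstate M) : sim_state := Some (Some (q, Some None)).
Definition st_clear (q : mstate M) (i : 'I_K.+1) : sim_state :=
  Some (Some (q, Some (Some i))).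

Definition sim_read (s : tm_symbol sim_cell) : sim_cell :=
  match s with
  | None => (None, false, [ffun => false])
  | Some (inl b) => (Some b, false, [ffun => false])
  | Some (inr c) => c
  end.

Definition setbit (f : {ffun 'I_K.+1 -> bool}) i b : {ffun 'I_K.+1 -> bool} :=
  [ffun j => if j == i then b else f j].

(** An instruction on register [i] is a sweep from the origin to the first cell whose bit [i] is
    off: its position is the value of the register, so that the letter, the test for zero and the
    cell to be rewritten are all found there. *)
Definition sim_rule (s : sim_state) (c : sim_cell) : sim_state * sim_cell * move :=
  let: (l, o, f) := c in
  match s with
  | None => (st_stop, c, MoveN)
  | Some None => (st_go (mstart M), (l, true, f), MoveN)
  | Some (Some (q, None)) =>
      let I := mcode q in let i := inord (ireg I) in
      if f i then (st_go q, c, MoveR) else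
      match inext I l o with
      | inr _ => (st_stop, c, MoveN)
      | inl q' =>
          match iop I with
          | Keep => (st_back q', c, MoveN)
          | Incr => (st_back q', (l, o, setbit f i true), MoveN)
          | Decr => if o then (st_back q', c, MoveN) else (st_clear q' i, c, MoveL)
          end
      end
  | Some (Some (q, Some None)) =>
      if o then (st_go q, c, MoveN) else (st_back q, c, MoveL)
  | Some (Some (q, Some (Some i))) => (st_back q, (l, o, setbit f i false), MoveN)
  end.

Definition sim_tm : turing_machine :=
  @TuringMachine sim_state sim_cell st_init st_stop
    (fun s x => let: (s', c, d) := sim_rule s (sim_read x) in (s', Some (inr c), d)).

Variable w : seq bool.

Definition tape_ok (tp : int -> tm_symbol sim_cell) (r : regs) : Prop :=
  forall j : int, sim_read (tp j) =
    (if j is Posz k then letter w k else None, j == 0,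
     [ffun i : 'I_K.+1 => if j is Posz k then k < r i else false]).

Local Notation tm_run n := (iter n (@tm_step sim_tm)).
Local Notation cfg := (@TMConfig sim_tm).

Lemma tape_ok_at tp r (k : nat) : tape_ok tp r ->
  sim_read (tp (Posz k)) = (letter w k, k == 0, [ffun i : 'I_K.+1 => k < r i]).
Proof. by move=> ->. Qed.

Lemma tape_ok_write tp r (k : nat) i v c : tape_ok tp r -> (i <= K)%N ->
  (forall j, j != k -> (j < r i) = (j < v)) ->
  c = (letter w k, k == 0, setbit [ffun j : 'I_K.+1 => k < r j] (inord i) (k < v)) ->
  tape_ok (fun j => if j == Posz k then Some (inr c) else tp j) (upd r i v).
Proof.
move=> ok leiK Hv -> j; case: eqP => [->|/eqP nejk] /=.
  congr (_, _, _); apply/ffunP => l; rewrite !ffunE /upd.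
  by rewrite -[l == _]val_eqE /= inordK //; case: eqP => // ->.
rewrite ok; congr (_, _, _); apply/ffunP => l; rewrite !ffunE /upd.
by case: eqP => // ->; case: j nejk => // j nejk; rewrite Hv.
Qed.

Lemma upd_id r i : upd r i (r i) = r.
Proof. by apply/funext => j; rewrite /upd; case: eqP => // ->. Qed.

Lemma tape_ok_keep tp r (k : nat) : tape_ok tp r ->
  tape_ok (fun j => if j == Posz k then Some (inr (sim_read (tp (Posz k)))) else tp j) r.
Proof. by move=> ok j; case: eqP => [->|_] /=; exact: ok. Qed.

Lemma sim_step s tp h :
  @tm_step sim_tm (cfg s tp h) =
  let: (s', c, d) := sim_rule s (sim_read (tp h)) in
  cfg s' (fun i => if i == h then Some (inr c) else tp i) (move_head d h).
Proof.
by rewrite /tm_step /=; case: (sim_rule _ _) => [[s' c] d].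
Qed.

Lemma ireg_le (q : mstate M) : (ireg (mcode q) <= K)%N.
Proof. exact: (leq_bigmax q). Qed.

Lemma sim_sweep q r (d k : nat) tp : tape_ok tp r ->
  (k + d = r (ireg (mcode q)))%N ->
  exists n tp', tm_run n (cfg (st_go q) tp (Posz k)) =
                cfg (st_go q) tp' (Posz (r (ireg (mcode q)))) /\ tape_ok tp' r.
Proof.
elim: d k tp => [|d IH] k tp ok Hk.
  by exists 0, tp; rewrite -Hk addn0.
have ok' := tape_ok_keep k ok.
have [n [tp' [E ok'']]] := IH k.+1 _ ok' ltac:(lia).
exists n.+1, tp'; split=> //; rewrite iterSr sim_step.
rewrite (tape_ok_at k ok) /= ffunE inordK ?ltnS ?ireg_le //.
have -> : k < r (ireg (mcode q)) by lia.
have -> : move_head MoveR (Posz k) = Posz k.+1 by rewrite /move_head; lia.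
by rewrite -(tape_ok_at k ok) -E.
Qed.

Lemma sim_back q r (k : nat) tp : tape_ok tp r ->
  exists n tp', tm_run n (cfg (st_back q) tp (Posz k)) = cfg (st_go q) tp' 0
    /\ tape_ok tp' r.
Proof.
elim: k tp => [|k IH] tp ok.
  have ok' := tape_ok_keep 0 ok.
  exists 1; eexists; split; last exact: ok'.
  by rewrite iterSr sim_step (tape_ok_at 0 ok).
have ok' := tape_ok_keep k.+1 ok.
have [n [tp' [E ok'']]] := IH _ ok'.
exists n.+1, tp'; split=> //; rewrite iterSr sim_step.
rewrite (tape_ok_at _ ok) /= -(tape_ok_at _ ok) -E.
have -> // : move_head MoveL (Posz k.+1) = Posz k by rewrite /move_head; lia.
Qed.

(** The count [n.+1] excludes an idle simulation; [sim_halts] needs this to carry over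
    divergence. *)
Lemma sim_mstep q r tp : tape_ok tp r ->
  let c := mstep w (inl q, r) in
  match c.1 with
  | inl q' => exists n tp', tm_run n.+1 (cfg (st_go q) tp 0) = cfg (st_go q') tp' 0
                /\ tape_ok tp' c.2
  | inr _ => exists n, cf_state (tm_run n (cfg (st_go q) tp 0)) = st_stop
  end.
Proof.
move=> ok; rewrite /mstep /=.
set I := mcode q; set i := ireg I; set v := r i.
have [n [tp1 [E ok1]]] := @sim_sweep q r v 0 tp ok (add0n _).
have leiK : (i <= K)%N by exact: ireg_le.
have Ebit : [ffun j : 'I_K.+1 => v < r j] (inord i) = false.
  by rewrite ffunE inordK ?ltnS // ltnn.
have step1 : @tm_step sim_tm (tm_run n (cfg (st_go q) tp 0)) =
    let: (s', c, d) := (match inext I (letter w v) (v == 0) with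
      | inr _ => (st_stop, sim_read (tp1 (Posz v)), MoveN)
      | inl q' =>
          match iop I with
          | Keep => (st_back q', sim_read (tp1 (Posz v)), MoveN)
          | Incr => (st_back q', (letter w v, v == 0,
                 setbit [ffun j : 'I_K.+1 => v < r j] (inord i) true), MoveN)
          | Decr => if v == 0 then (st_back q', sim_read (tp1 (Posz v)), MoveN)
                    else (st_clear q' (inord i), sim_read (tp1 (Posz v)), MoveL)
          end
      end) in
    cfg s' (fun j => if j == Posz v then Some (inr c) else tp1 j) (move_head d (Posz v)).
  rewrite E sim_step -/i -/v (tape_ok_at _ ok1) /=.
  by rewrite -/I -/i Ebit.
case El : (inext I (letter w v) (v == 0)) step1 => [q'|b] step1; last first.
  by exists n.+1; rewrite iterS step1.
have keep := tape_ok_keep v ok1.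
case Eo : (iop I) step1 => step1 /=.
- have [m [tp2 [E2 ok2]]] := sim_back q' v keep.
  by exists (m + n)%N, tp2; split=> //; rewrite -iterS -addnS iterD iterS step1.
- have okw := @tape_ok_write tp1 r v i v.+1 _ ok1 leiK _ erefl.
  have {}okw := okw ltac:(by move=> j; rewrite -/v; lia).
  rewrite ltnSn in okw.
  have [m [tp2 [E2 ok2]]] := sim_back q' v okw.
  by exists (m + n)%N, tp2; split=> //; rewrite -iterS -addnS iterD iterS step1.
- have [v0|vp] := eqVneq v 0%N.
    rewrite v0 /= in step1 keep *.
    have [m [tp2 [E2 ok2]]] := sim_back q' 0 keep.
    exists (m + n)%N, tp2; split=> //; first by rewrite -iterS -addnS iterD iterS step1.
    have -> : r i = 0 by [].
    by rewrite -[X in upd _ _ X]v0 /v upd_id.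
  rewrite (negbTE vp) in step1.
  set tp2 := (fun j => _) in step1.
  have okw := @tape_ok_write tp2 r v.-1 i v.-1 _ keep leiK _ erefl.
  have {}okw := okw ltac:(by move=> j; rewrite -/v; lia).
  rewrite ltnn in okw.
  have [m [tp3 [E3 ok3]]] := sim_back q' v.-1 okw.
  exists (m + n.+1)%N, tp3; split=> //; rewrite -iterS -addnS iterD !iterS step1.
  have -> : move_head MoveL (Posz v) = Posz v.-1 by rewrite /move_head; lia.
  by rewrite sim_step (tape_ok_at _ keep).
Qed.

Lemma sim_stop_absorbing n m (c : tm_config sim_tm) : (n <= m)%N ->
  cf_state (tm_run n c) = st_stop -> cf_state (tm_run m c) = st_stop.
Proof.
move=> lenm; rewrite -(subnK lenm) iterD; move: (iter n _ c) => {}c.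
elim: (m - n)%N => //= k IH Hc; have := IH Hc.
case: (iter k _ c) => s tp h /= ->; rewrite sim_step.
by case: (sim_read (tp h)) => [[]].
Qed.

(** The state is never the final one while the register machine runs, and it stays final
    afterwards; so if the register machine diverges, the simulation passes through non-final
    states at arbitrarily late times. *)
Lemma sim_halts : tm_halts sim_tm w <-> mhalts M w (fun _ => 0).
Proof.
set r0 : regs := fun _ => 0.
have [tp0 [E0 ok0]] : exists tp0, tm_run 1 (tm_init sim_tm w) = cfg (st_go (mstart M)) tp0 0
    /\ tape_ok tp0 r0.
  have Hread (k : nat) : sim_read (nth None [seq Some (inl b) | b <- w] k) =
      (letter w k, false, [ffun => false]).
    by rewrite /letter; elim: w k => [|b w' IH] [|k] /=; rewrite ?nth_nil.
  eexists; split.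
    rewrite /= /tm_init sim_step /= Hread; reflexivity.
  move=> j; case: eqP => [-> /=|/eqP j0].
    by congr (_, _, _); apply/ffunP => i; rewrite !ffunE /= ltn0.
  case: j j0 => [k|k] /= j0; last by congr (_, _, _); apply/ffunP => i; rewrite !ffunE.
  rewrite Hread; apply: f_equal.
  by apply/ffunP => i; rewrite !ffunE.
have sync N : (exists b, (iter N (@mstep M w) (inl (mstart M), r0)).1 = inr b /\
     exists n, cf_state (tm_run n (tm_init sim_tm w)) = st_stop) \/
   exists q r n tp, [/\ iter N (@mstep M w) (inl (mstart M), r0) = (inl q, r),
     tm_run n (tm_init sim_tm w) = cfg (st_go q) tp 0, tape_ok tp r & (N <= n)%N].
  elim: N => [|N [[b [Hb Hn]]|[q [r [n [tp [EN En okn leNn]]]]]]].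
  - by right; exists (mstart M), r0, 1%N, tp0.
  - left; exists b; split=> //=; move: Hb; case: (iter N _ _) => l r /= ->.
    by [].
  - have := sim_mstep q okn; rewrite iterS EN.
    case Es : (mstep w (inl q, r)) => [[q'|b] r'] /= => [[m [tp' [Em ok']]]|[m Hm]].
      right; exists q', r', (m.+1 + n)%N, tp'; split=> //; last by lia.
      by rewrite iterD En.
    by left; exists b; split=> //; exists (m + n)%N; rewrite iterD En.
split=> [[t Ht]|[N [b Hb]]].
  case: (sync t) => [[b [Hb _]]|[q [r [n [tp [_ En _ letn]]]]]]; first by exists t, b.
  by have := sim_stop_absorbing letn Ht; rewrite En.
case: (sync N) => [[_ [_ [n Hn]]]|[q [r [n [tp [EN _ _ _]]]]]]; first by exists n.
by rewrite EN in Hb.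
Qed.

End Simulation.

(** * Structured register programs *)
Definition goes (M : machine) (w : seq bool) (c c' : mconfig M) : Prop :=
  exists N, iter N (@mstep M w) c = c'.

Definition runs (M : machine) (w : seq bool) (r : regs) (b : bool) (r' : regs) : Prop :=
  goes w (inl (mstart M), r) (inr b, r').

Lemma goes_refl (M : machine) w (c : mconfig M) : goes w c c.
Proof. by exists 0. Qed.

Lemma goes_trans (M : machine) w (c2 c1 c3 : mconfig M) :
  goes w c1 c2 -> goes w c2 c3 -> goes w c1 c3.
Proof. by move=> [n <-] [m <-]; exists (m + n)%N; rewrite iterD. Qed.

Lemma goes_step (M : machine) w (c c' : mconfig M) :
  goes w (mstep w c) c' -> goes w c c'.
Proof. by move=> [n <-]; exists n.+1; rewrite iterSr. Qed.

Definition map_next (L L' : Type) (g : L -> L') (I : instr L) : instr L' :=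
  Instr (ireg I) (iop I) (fun l z => g (inext I l z)).

Section Embed.
Variables (M M' : machine) (w : seq bool).
Variables (inj : mstate M -> mstate M') (ex : bool -> mstate M' + bool).

Definition relabel (l : mstate M + bool) : mstate M' + bool :=
  match l with inl q => inl (inj q) | inr b => ex b end.

Hypothesis code_inj : forall q, mcode (inj q) = map_next relabel (mcode q).

(** A program that is a part of a larger one runs there in the same way and then takes the exit
    prescribed by the context. All the combinators below are instances. *)
Lemma embed_goes q r b r' : goes w ((inl q, r) : mconfig M) (inr b, r') ->
  exists N, iter N.+1 (@mstep M' w) (inl (inj q), r) = (ex b, r').
Proof.
move=> [N]; elim: N q r => [|N IH] q r //.
rewrite iterSr /mstep /=.
case E : (inext (mcode q) _ _) => [q'|b'].
  move=> /IH [N' HN']; exists N'.+1; rewrite iterSr -{}HN' /mstep /=.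
  by rewrite code_inj /= E.
move=> H; exists 0; rewrite /= /mstep /= code_inj /= E /=.
have Hfix : iter N (@mstep M w) (inr b', app_op (iop (mcode q)) (ireg (mcode q)) r) =
  (inr b', app_op (iop (mcode q)) (ireg (mcode q)) r) by elim: (N) => //= n ->.
by move: H; rewrite -[iter _ _ _]/(iter N (@mstep M w) _) Hfix => -[-> ->].
Qed.

End Embed.

Definition basic (i : nat) (o : regop) (f : option bool -> bool -> bool) : machine :=
  @Machine unit tt (fun _ => Instr i o (fun l z => inr (f l z))).

Lemma runs_basic i o f w r : runs (basic i o f) w r (f (letter w (r i)) (r i == 0)) (app_op o i r).
Proof. by exists 1. Qed.

Section If.
Variables (M A B : machine).

Definition if_state : finType := (mstate M + (mstate A + mstate B))%type.

Definition if_exit (b : bool) : if_state + bool :=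
  inl (inr (if b then inl (mstart A) else inr (mstart B))).

Definition ifm : machine := @Machine if_state (inl (mstart M)) (fun q =>
  match q with
  | inl q => map_next (fun l : mstate M + bool =>
       match l with inl q => inl (inl q) | inr b => if_exit b end) (mcode q)
  | inr (inl q) => map_next (fun l : mstate A + bool =>
       match l with inl q => inl (inr (inl q)) | inr b => inr b end) (mcode q)
  | inr (inr q) => map_next (fun l : mstate B + bool =>
       match l with inl q => inl (inr (inr q)) | inr b => inr b end) (mcode q)
  end).

Lemma runs_if w r b r1 c r2 : runs M w r b r1 ->
  (if b then runs A w r1 c r2 else runs B w r1 c r2) -> runs ifm w r c r2.
Proof.
move=> HM H.
have [N HN] := @embed_goes M ifm w (fun q => inl q) if_exit (fun q => erefl) _ _ _ _ HM.
apply: (@goes_trans ifm w (if_exit b, r1)); first by exists N.+1.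
case: b H {HM HN} => H.
  have [N' HN'] := @embed_goes A ifm w (fun q => inr (inl q)) inr (fun q => erefl) _ _ _ _ H.
  by exists N'.+1.
have [N' HN'] := @embed_goes B ifm w (fun q => inr (inr q)) inr (fun q => erefl) _ _ _ _ H.
by exists N'.+1.
Qed.

End If.

Definition ret (b : bool) : machine := basic 0 Keep (fun _ _ => b).
Definition inc (i : nat) : machine := basic i Incr (fun _ _ => true).
Definition dec (i : nat) : machine := basic i Decr (fun _ _ => true).
Definition seqm (A B : machine) : machine := ifm A B (ret false).
Definition negm (A : machine) : machine := ifm A (ret false) (ret true).

Lemma runs_ret b w r : runs (ret b) w r b r.
Proof. exact: runs_basic. Qed.

Lemma runs_inc i w r : runs (inc i) w r true (upd r i (r i).+1).
Proof. exact: runs_basic. Qed.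

Lemma runs_dec i w r : runs (dec i) w r true (upd r i (r i).-1).
Proof. exact: runs_basic. Qed.

Lemma runs_seq A B w r r1 b r2 :
  runs A w r true r1 -> runs B w r1 b r2 -> runs (seqm A B) w r b r2.
Proof. by move=> HA HB; apply: runs_if HA _. Qed.

Lemma runs_neg A w r b r1 : runs A w r b r1 -> runs (negm A) w r (~~ b) r1.
Proof. by move=> HA; apply: runs_if HA _; case: b; apply: runs_ret. Qed.

Section Scan.
Variables (d : nat) (M : machine).

Definition scan_exit (b : bool) : option (mstate M) + bool :=
  if b then inl None else inr false.

(** [scan d M] counts register [d] down and runs [M] for each value, until [M] answers false. It is
    at once the bounded quantifier and the only bounded loop from which the arithmetic is made. *)
Definition scan : machine := @Machine (option (mstate M)) None (fun q =>
  match q with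
  | None => Instr d Decr (fun _ z => if z then inr true else inl (Some (mstart M)))
  | Some q => map_next (fun l : mstate M + bool =>
       match l with inl q => inl (Some q) | inr b => scan_exit b end) (mcode q)
  end).

Lemma runs_scan w (b : nat -> bool) (I : nat -> regs -> Prop) :
  (forall k r, I k r -> r d = k) ->
  (forall k r, I k.+1 r -> exists r', runs M w (upd r d k) (b k) r' /\ I k r') ->
  forall k r, I k r -> exists k' r', [/\ runs scan w r (all b (iota 0 k)) r', I k' r'
     & all b (iota 0 k) -> k' = 0].
Proof.
move=> Id step; elim=> [|k IH] r Ir.
  exists 0, r; split=> //; apply: goes_step; rewrite /mstep /= (Id _ _ Ir) /=.
  have -> : upd r d 0 = r; last exact: goes_refl.
  by apply/funext => j; rewrite /upd; case: eqP => // ->; rewrite (Id _ _ Ir).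
have [r1 [H1 I1]] := step _ _ Ir.
have [N HN] := @embed_goes M scan w Some scan_exit (fun q => erefl) _ _ _ _ H1.
have Hhead : goes w ((inl None, r) : mconfig scan) (scan_exit (b k), r1).
  apply: goes_step; rewrite /mstep /= (Id _ _ Ir) /=.
  by exists N.+1.
have -> : all b (iota 0 k.+1) = b k && all b (iota 0 k).
  by rewrite -addn1 iotaD all_cat /= andbT andbC.
case: (b k) Hhead => Hhead /=; last by exists k, r1.
have [k' [r' [H' I' z']]] := IH _ I1.
by exists k', r'; split=> //; apply: goes_trans Hhead _.
Qed.

Lemma runs_for w (I : nat -> regs -> Prop) :
  (forall k r, I k r -> r d = k) ->
  (forall k r, I k.+1 r -> exists r', runs M w (upd r d k) true r' /\ I k r') ->
  forall k r, I k r -> exists r', runs scan w r true r' /\ I 0 r'.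
Proof.
move=> Id step k r Ir.
have [k' [r' [H' I' z']]] := @runs_scan w xpredT I Id step k r Ir.
rewrite all_predT in H' z'; exists r'; split=> //; by rewrite -(z' isT).
Qed.

End Scan.

Section Forever.
Variable M : machine.

Definition forever_exit (b : bool) : mstate M + bool :=
  if b then inr true else inl (mstart M).

Definition forever : machine := @Machine (mstate M) (mstart M) (fun q =>
  map_next (fun l : mstate M + bool =>
       match l with inl q => inl q | inr b => forever_exit b end) (mcode q)).

(** Every round of the loop takes at least one step, hence a halting computation contains only
    finitely many failing rounds before one that succeeds. *)
Lemma forever_halts w (b : nat -> bool) (I : nat -> regs -> Prop) :
  (forall t r, I t r -> exists r', runs M w r (b t) r' /\ (~~ b t -> I t.+1 r')) ->
  forall r, I 0 r -> (mhalts forever w r <-> exists t, b t).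
Proof.
move=> step r I0.
have step1 t s : I t s -> exists N s', iter N.+1 (@mstep forever w) (inl (mstart M), s) =
     (forever_exit (b t), s') /\ (~~ b t -> I t.+1 s').
  move=> /step [s' [H Hs']].
  have [N HN] := @embed_goes M forever w id forever_exit (fun q => erefl) _ _ _ _ H.
  by exists N, s'.
split=> [[N [c HN]]|[t0 bt0]].
  have {I0} [t It] : exists t, I t r by exists 0.
  elim/ltn_ind: N t r It HN => N IH t r It HN.
  have [bt|nbt] := boolP (b t); first by exists t.
  have [N1 [s' [E /(_ nbt) Is']]] := step1 _ _ It.
  rewrite /forever_exit (negbTE nbt) in E.
  have [ltN|leN] := ltnP N1 N.
    apply: (IH (N - N1.+1)%N _ t.+1 s' Is'); first by lia.
    by rewrite -E -iterD subnK.
  have Hfix m : (N <= m)%N -> (iter m (@mstep forever w) (inl (mstart M), r)).1 = inr c.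
    move=> lem; rewrite -(subnK lem) iterD; elim: (m - N)%N => //= k.
    by case: (iter k _ _) => l s /= ->.
  by have := Hfix N1.+1 (leqW leN); rewrite E.
have {I0} [t [It letn]] : exists t, I t r /\ (t <= t0)%N by exists 0.
have [n En] : exists n, (t0 - t)%N = n by eexists.
elim: n t r It letn En => [|n IH] t r It let0 En;
  have [N1 [s' [E Hs']]] := step1 _ _ It; have [bt|nbt] := boolP (b t).
- by exists N1.+1, true; rewrite E /= /forever_exit bt.
- by have Ett : t = t0 by [lia]; rewrite Ett bt0 in nbt.
- by exists N1.+1, true; rewrite E /= /forever_exit bt.
have ltt : (t < t0)%N by lia.
have [N [c HN]] := IH t.+1 s' (Hs' nbt) ltt ltac:(lia).
by exists (N + N1.+1)%N, c; rewrite iterD E /forever_exit (negbTE nbt).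
Qed.

End Forever.

Definition zero_reg (y : nat) : machine := scan y (ret true).

Lemma runs_zero w y r : runs (zero_reg y) w r true (upd r y 0).
Proof.
have [] := @runs_for y (ret true) w (fun k s => s = upd r y k) _ _ (r y) r.
- by move=> k s ->; rewrite upd_eq.
- move=> k s ->; exists (upd r y k); split=> //.
  have -> : upd (upd r y k.+1) y k = upd r y k; last exact: runs_ret.
  by apply/funext => j; rewrite /upd; case: eqP.
- by apply/funext => j; rewrite /upd; case: eqP => // ->.
by move=> s [H Es]; rewrite Es in H.
Qed.

(** Registers can be read only by counting them down, hence the copy to [e] from which [x] is
    restored. *)
Definition copy_reg (x y e : nat) : machine :=
  seqm (zero_reg y) (seqm (zero_reg e)
    (seqm (scan x (seqm (inc y) (inc e))) (scan e (inc x)))).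

Lemma runs_copy w (x y e : nat) r : x != y -> x != e -> y != e ->
  exists r', [/\ runs (copy_reg x y e) w r true r', r' y = r x
    & forall j : nat, j != y -> j != e -> r' j = r j].
Proof.
move=> xy xe ye.
set r1 := upd (upd r y 0) e 0.
have [] := @runs_for x (seqm (inc y) (inc e)) w (fun k s =>
  [/\ s x = k, (s y + k = r x)%N, (s e + k = r x)%N 
     & forall j : nat, j != x -> j != y -> j != e -> s j = r j]) _ _ (r x) r1.
- by move=> k s [].
- move=> k s [sx sy se so].
  set s1 := upd s x k; set s2 := upd s1 y (s1 y).+1; exists (upd s2 e (s2 e).+1).
  split; first exact: (runs_seq (runs_inc _ _ _) (runs_inc _ _ _)).
  rewrite /s2 /s1 /upd !eqxx (eq_sym y x) (eq_sym e x) (eq_sym e y).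
  rewrite (negbTE xy) (negbTE xe) (negbTE ye).
  split=> //; [lia|lia|move=> j jx jy je].
  by rewrite (negbTE je) (negbTE jy) (negbTE jx) so.
- rewrite /r1 /upd eqxx (negbTE xy) (negbTE xe) (negbTE ye) eqxx; split=> //.
  by move=> j _ jy je; rewrite (negbTE je) (negbTE jy).
move=> s [Hs [sx sy se so]].
have [] := @runs_for e (inc x) w (fun k t =>
  [/\ t e = k, (t x + k = r x)%N & forall j : nat, j != x -> j != e -> t j = s j]) _ _ (r x) s.
- by move=> k t [].
- move=> k t [te tx tj]; eexists; split; first exact: runs_inc.
  rewrite /upd eqxx (eq_sym e x) (negbTE xe) eqxx; split=> //; first by lia.
  by move=> j jx je; rewrite (negbTE jx) (negbTE je) tj.
- by split=> //; lia.
move=> t [Ht [te tx tj]]; exists t; split.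
- apply: runs_seq (runs_zero _ _ _) (runs_seq (runs_zero _ _ _) (runs_seq Hs Ht)).
- by rewrite tj 1?eq_sym //; lia.
- move=> j jy je; have [->|jx] := eqVneq j x; first by lia.
  by rewrite tj // so.
Qed.

Lemma runs_sub w (x : nat) r : x != 1%N ->
  exists r', [/\ runs (scan x (dec 1)) w r true r', r' 1%N = (r 1%N - r x)%N
    & forall j : nat, j != 1%N -> j != x -> r' j = r j].
Proof.
move=> x1.
have [] := @runs_for x (dec 1) w (fun k s =>
  [/\ s x = k, s 1%N = (r 1%N - (r x - k))%N, (k <= r x)%N
     & forall j : nat, j != 1%N -> j != x -> s j = r j]) _ _ (r x) r.
- by move=> k s [].
- move=> k s [sx s1 lek sj]; eexists; split; first exact: runs_dec.
  have x1' : (1%N == x) = false by rewrite eq_sym (negbTE x1).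
  rewrite /upd !eqxx (negbTE x1) x1'; split=> //; [lia|lia|].
  by move=> j /negbTE j1 /negbTE jx; rewrite j1 jx sj ?j1 ?jx.
- by split=> //; lia.
move=> s [Hs [sx s1 _ sj]]; exists s; split=> //; lia.
Qed.

(** Register 1 starts at [z] and is decremented [x * y + u] times; truncation at zero makes the
    final test for zero a comparison. *)
Definition cmp_prog (b : bool) (x y u z : nat) : machine :=
  seqm (copy_reg z 1 3) (seqm (copy_reg u 2 3) (seqm (scan 2 (dec 1))
   (seqm (copy_reg x 2 3) (seqm (scan 2 (seqm (copy_reg y 4 3) (scan 4 (dec 1))))
     (basic 1 Keep (fun _ v => v == b)))))).

Lemma runs_cmp w b x y u z r : [/\ 4 < x, 4 < y, 4 < u & 4 < z]%N ->
  exists r', runs (cmp_prog b x y u z) w r ((r z <= r x * r y + r u)%N == b) r' /\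
    forall j, j = 0%N \/ (4 < j)%N -> r' j = r j.
Proof.
move=> [x4 y4 u4 z4].
have [r1 [H1 r11 k1]] := @runs_copy w z 1 3 r ltac:(lia) ltac:(lia) ltac:(lia).
have [r2 [H2 r22 k2]] := @runs_copy w u 2 3 r1 ltac:(lia) ltac:(lia) ltac:(lia).
have [r3 [H3 r31 k3]] := @runs_sub w 2 r2 ltac:(lia).
have [r4 [H4 r42 k4]] := @runs_copy w x 2 3 r3 ltac:(lia) ltac:(lia) ltac:(lia).
have [] := @runs_for 2 (seqm (copy_reg y 4 3) (scan 4 (dec 1))) w (fun k s =>
  [/\ s 2%N = k, s 1%N = (r4 1%N - (r x - k) * r y)%N, (k <= r x)%N
     & forall j, (j = 0%N \/ (4 < j)%N) -> s j = r j])
  _ _ (r x) r4.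
- by move=> k s [].
- move=> k s [s2 s1 lek sj].
  have [t1 [T1 t14 kt1]] := @runs_copy w y 4 3 (upd s 2 k) ltac:(lia) ltac:(lia) ltac:(lia).
  have [t2 [T2 t21 kt2]] := @runs_sub w 4 t1 ltac:(lia).
  exists t2; split; first exact: runs_seq T1 T2.
  split=> //.
  + by rewrite kt2 // kt1 // upd_eq.
  + rewrite t21 t14 kt1 // /upd /= s1 ifN ?sj; [|lia|lia].
    have -> : (r x - k = (r x - k.+1).+1)%N by lia.
    by rewrite mulSn; lia.
  + lia.
  + move=> j Hj; rewrite kt2 ?kt1 /upd ?ifN ?sj //; lia.
- split=> //.
  + by rewrite r42 k3 ?k2 ?k1 //; lia.
  + by rewrite subnn mul0n subn0.
  + move=> j Hj; rewrite k4 ?k3 ?k2 ?k1 //; lia.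
move=> r5 [H5 [_ r51 _ k5]]; exists r5; split=> //.
have -> : (r z <= r x * r y + r u)%N = (r5 1%N == 0%N).
  rewrite r51 subn0 k4 // r31 r22 k2 // r11 k1; [|lia|lia].
  by rewrite -subnDA addnC subn_eq0.
apply: runs_seq H1 (runs_seq H2 (runs_seq H3 (runs_seq H4 (runs_seq H5 _)))).
exact: runs_basic.
Qed.

(** * Positive formulas of bounded arithmetic *)
(** Negation is absent, so that enlarging the range of the existential quantifiers preserves truth;
    the boolean in the atoms supplies the negations that are harmless. *)
Inductive form :=
| FCmp of bool & nat & nat & nat & nat
| FBit of bool & nat
| FAnd of form & form
| FOr of form & form
| FEx of form
| FAll of nat & form.

Definition env := nat -> nat.

Definition scons (y : nat) (e : env) : env := fun i => if i is j.+1 then e j else y.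

Definition lift (e : env) : env := fun i => e i.+1.

Fixpoint sat (w : seq bool) (f : form) (e : env) {struct f} : Prop :=
  match f with
  | FCmp b x y u z => (e z <= e x * e y + e u)%N = b
  | FBit b x => letter w (e x) = Some b
  | FAnd f g => sat w f e /\ sat w g e
  | FOr f g => sat w f e \/ sat w g e
  | FEx f => exists y, sat w f (scons y e)
  | FAll x f => forall y, (y < e x)%N -> sat w f (scons y e)
  end.

Fixpoint bsat (w : seq bool) (t : nat) (f : form) (e : env) {struct f} : bool :=
  match f with
  | FCmp b x y u z => (e z <= e x * e y + e u)%N == b
  | FBit b x => letter w (e x) == Some b
  | FAnd f g => bsat w t f e && bsat w t g e
  | FOr f g => bsat w t f e || bsat w t g e
  | FEx f => has (fun y => bsat w t f (scons y e)) (iota 0 t)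
  | FAll x f => all (fun y => bsat w t f (scons y e)) (iota 0 (e x))
  end.

Lemma bsat_mono w f t t' e : (t <= t')%N -> bsat w t f e -> bsat w t' f e.
Proof.
move=> letn; elim: f e => //=.
- by move=> f IHf g IHg e /andP[/IHf -> /IHg ->].
- by move=> f IHf g IHg e /orP[/IHf -> | /IHg ->]; rewrite ?orbT.
- move=> f IHf e /hasP[y]; rewrite mem_iota => Hy Hf; apply/hasP; exists y; last exact: IHf.
  by rewrite mem_iota; lia.
- by move=> x f IHf e /allP H; apply/allP => y /H; apply: IHf.
Qed.

(** A true formula needs finitely many witnesses, since its universal quantifiers are bounded; a
    bound for all of them exists by monotonicity. *)
Lemma sat_bsat w f e : sat w f e <-> exists t, bsat w t f e.
Proof.
elim: f e => /=.
- by move=> b x y u z e; split=> [->|[_ /eqP //]]; exists 0.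
- by move=> b x e; split=> [->|[_ /eqP //]]; exists 0.
- move=> f IHf g IHg e; rewrite IHf IHg; split=> [[[t Ht] [s Hs]]|[t /andP[Hf Hg]]].
    exists (maxn t s); apply/andP.
    by split; [apply: bsat_mono Ht|apply: bsat_mono Hs]; lia.
  by split; exists t.
- move=> f IHf g IHg e; rewrite IHf IHg; split=> [[[t Ht]|[t Ht]]|[t /orP[Ht|Ht]]].
  + by exists t; rewrite Ht.
  + by exists t; rewrite Ht orbT.
  + by left; exists t.
  + by right; exists t.
- move=> f IHf e; split=> [[y /IHf[t Ht]]|[t /hasP[y _ Hy]]].
    exists (maxn t y.+1); apply/hasP; exists y; first by rewrite mem_iota; lia.
    by apply: bsat_mono Ht; lia.
  by exists y; apply/IHf; exists t.
- move=> x f IHf e; split=> [H|[t /allP H] y Hy]; last first.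
    by apply/IHf; exists t; apply: H; rewrite mem_iota.
  elim: (e x) H => [|n IHn] H; first by exists 0.
  have [y Hy|t Ht] := IHn; first by apply: H; lia.
  have /IHf[s Hs] := H n (ltnSn n).
  exists (maxn t s); rewrite -addn1 iotaD all_cat /= andbT; apply/andP; split.
    by apply/allP => y /(allP Ht); apply: bsat_mono; lia.
  by apply: bsat_mono Hs; lia.
Qed.

(** Strictly above all free variables. *)
Fixpoint scope (f : form) : nat :=
  match f with
  | FCmp b x y u z => \max_(i <- [:: x; y; u; z]) i.+1
  | FBit b x => x.+1
  | FAnd f g | FOr f g => maxn (scope f) (scope g)
  | FEx f => (scope f).-1
  | FAll x f => maxn x.+1 (scope f).-1
  end.

(** Register 0 holds the bound for the witnesses, registers 1 to 4 are scratch, and under [d]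
    quantifiers the variable of de Bruijn index [i] lives in register [4 + d - i]. The register of a
    variable thus stays the same when more quantifiers are entered. *)
Fixpoint compile (f : form) (d : nat) : machine :=
  match f with
  | FCmp b x y u z => cmp_prog b (4 + d - x) (4 + d - y) (4 + d - u) (4 + d - z)
  | FBit b x => basic (4 + d - x) Keep (fun l _ => l == Some b)
  | FAnd f g => ifm (compile f d) (compile g d) (ret false)
  | FOr f g => ifm (compile f d) (ret true) (compile g d)
  | FEx f => negm (seqm (copy_reg 0 (5 + d) 3) (scan (5 + d) (negm (compile f d.+1))))
  | FAll x f => seqm (copy_reg (4 + d - x) (5 + d) 3) (scan (5 + d) (compile f d.+1))
  end.

Definition keeps (d : nat) (r r' : regs) : Prop :=
  forall j, j = 0%N \/ (4 < j <= 4 + d)%N -> r' j = r j.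

Definition holds (d : nat) (r : regs) (e : env) : Prop :=
  forall i, (i < d)%N -> r (4 + d - i) = e i.

Lemma keeps_trans d r1 r2 r3 : keeps d r1 r2 -> keeps d r2 r3 -> keeps d r1 r3.
Proof. by move=> H1 H2 j Hj; rewrite H2 // H1. Qed.

Lemma keeps_holds d r r' e : keeps d r r' -> holds d r e -> holds d r' e.
Proof. by move=> K H i Hi; rewrite K ?H //; right; lia. Qed.

Lemma scan_body w d e r (M : machine) (b : nat -> bool) n :
  holds d r e ->
  (forall k s, holds d.+1 s (scons k e) -> s 0%N = r 0%N ->
     exists s', runs M w s (b k) s' /\ keeps d.+1 s s') ->
  r (5 + d) = n ->
  exists r', runs (scan (5 + d) M) w r (all b (iota 0 n)) r' /\ keeps d r r'.
Proof.
move=> Hr HM rn.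
have [] := @runs_scan (5 + d) M w b (fun k s => s (5 + d) = k /\ keeps d r s) _ _ n r.
- by move=> k s [].
- move=> k s [sk Ks]; have Hs : holds d s e := keeps_holds Ks Hr.
  have [] := HM k (upd s (5 + d) k).
  + case=> [|i] Hi /=; first by rewrite (_ : 4 + d.+1 - 0 = 5 + d)%N ?upd_eq //; lia.
    by rewrite (_ : 4 + d.+1 - i.+1 = 4 + d - i)%N ?upd_neq ?Hs //; lia.
  + by rewrite upd_neq // Ks //; left.
  move=> s' [R Ks']; exists s'; split=> //; split.
    by rewrite Ks' ?upd_eq //; right; lia.
  by move=> j Hj; rewrite Ks' ?upd_neq ?Ks //; lia.
- by [].
by move=> k' [r' [H [_ K] _]]; exists r'.
Qed.

Lemma compile_correct w f d e r : (scope f <= d)%N -> holds d r e ->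
  exists r', runs (compile f d) w r (bsat w (r 0%N) f e) r' /\ keeps d r r'.
Proof.
elim: f d e r => /=.
- move=> b x y u z d e r; rewrite !big_cons big_nil => Hsc Hr.
  have [] := @runs_cmp w b (4 + d - x) (4 + d - y) (4 + d - u) (4 + d - z) r.
    by split; lia.
  move=> r' [H K]; exists r'; split; last by move=> j Hj; apply: K; lia.
  by rewrite !Hr in H => //; lia.
- move=> b x d e r Hsc Hr; exists r; split=> //.
  by rewrite -Hr //; apply: runs_basic.
- move=> f IHf g IHg d e r Hsc Hr.
  have [r1 [H1 K1]] := IHf d e r ltac:(lia) Hr.
  case: (bsat _ _ f e) H1 => H1 /=; last first.
    by exists r1; split=> //; apply: runs_if H1 _; apply: runs_ret.
  have [r2 [H2 K2]] := IHg d e r1 ltac:(lia) (keeps_holds K1 Hr).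
  rewrite (K1 0%N (or_introl erefl)) in H2.
  by exists r2; split; [apply: runs_if H1 _|apply: keeps_trans K1 K2].
- move=> f IHf g IHg d e r Hsc Hr.
  have [r1 [H1 K1]] := IHf d e r ltac:(lia) Hr.
  case: (bsat _ _ f e) H1 => H1 /=.
    by exists r1; split=> //; apply: runs_if H1 _; apply: runs_ret.
  have [r2 [H2 K2]] := IHg d e r1 ltac:(lia) (keeps_holds K1 Hr).
  rewrite (K1 0%N (or_introl erefl)) in H2.
  by exists r2; split; [apply: runs_if H1 _|apply: keeps_trans K1 K2].
- move=> f IHf d e r Hsc Hr.
  have [r1 [H1 r1d k1]] := @runs_copy w 0 (5 + d) 3 r ltac:(lia) ltac:(lia) ltac:(lia).
  have K1 : keeps d r r1 by move=> j Hj; apply: k1; lia.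
  have E0 : r1 0%N = r 0%N by apply: K1; left.
  have [] := @scan_body w d e r1 (negm (compile f d.+1))
    (fun y => ~~ bsat w (r 0%N) f (scons y e)) (r 0%N) (keeps_holds K1 Hr).
  + move=> k s Hs s0; have [s' [R Ks]] := IHf d.+1 (scons k e) s ltac:(lia) Hs.
    by exists s'; split=> //; rewrite s0 E0 in R; apply: runs_neg.
  + by rewrite r1d.
  move=> r2 [H2 K2]; exists r2; split; last exact: keeps_trans K1 K2.
  rewrite -[has _ _]negbK -all_predC; apply: runs_neg.
  exact: runs_seq H1 H2.
- move=> x f IHf d e r Hsc Hr.
  have [r1 [H1 r1d k1]] := @runs_copy w (4 + d - x) (5 + d) 3 r ltac:(lia) ltac:(lia) ltac:(lia).
  have K1 : keeps d r r1 by move=> j Hj; apply: k1; lia.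
  have E0 : r1 0%N = r 0%N by apply: K1; left.
  have [] := @scan_body w d e r1 (compile f d.+1)
    (fun y => bsat w (r 0%N) f (scons y e)) (e x) (keeps_holds K1 Hr).
  + move=> k s Hs s0; have [s' [R Ks]] := IHf d.+1 (scons k e) s ltac:(lia) Hs.
    by exists s'; split=> //; rewrite s0 E0 in R.
  + by rewrite r1d Hr //; lia.
  move=> r2 [H2 K2]; exists r2; split; last exact: keeps_trans K1 K2.
  exact: runs_seq H1 H2.
Qed.

Definition search (f : form) : machine :=
  forever (ifm (compile f (scope f)) (ret true) (seqm (inc 0) (ret false))).

(** The closed formulas are tested with growing bounds for their witnesses. *)
Theorem form_semidecidable (f : form) :
  exists T : turing_machine, forall w, tm_halts T w <-> sat w f (fun _ => 0).
Proof.
exists (sim_tm (search f)) => w; rewrite sim_halts sat_bsat.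
apply: (forever_halts (I := fun t r => r 0%N = t /\
  forall j, (4 < j <= 4 + scope f)%N -> r j = 0%N)) => // t r [r0 rj].
have [] := @compile_correct w f (scope f) (fun _ => 0%N) r (leqnn _).
  by move=> i Hi; apply: rj; lia.
rewrite r0 => r1 [H1 K1].
case E : (bsat _ _ _ _) H1 => H1 /=.
  by exists r1; split=> //; apply: runs_if H1 _; apply: runs_ret.
exists (upd r1 0 (r1 0%N).+1); split.
  by apply: runs_if H1 _; apply: runs_seq (runs_inc _ _ _) (runs_ret _ _ _).
move=> _; split; first by rewrite upd_eq (K1 0%N) ?r0 //; left.
by move=> j Hj; rewrite upd_neq ?K1 ?rj //; lia.
Qed.

(** * Relations defined by formulas *)
Fixpoint ren (m : nat -> nat) (f : form) : form :=
  match f with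
  | FCmp b x y u z => FCmp b (m x) (m y) (m u) (m z)
  | FBit b x => FBit b (m x)
  | FAnd f g => FAnd (ren m f) (ren m g)
  | FOr f g => FOr (ren m f) (ren m g)
  | FEx f => FEx (ren (fun i => if i is j.+1 then (m j).+1 else 0) f)
  | FAll x f => FAll (m x) (ren (fun i => if i is j.+1 then (m j).+1 else 0) f)
  end.

Lemma sat_ren w f m e : sat w (ren m f) e <-> sat w f (fun i => e (m i)).
Proof.
have E y e' m' : (fun i => scons y e' (if i is j.+1 then (m' j).+1 else 0)) =
    scons y (fun i => e' (m' i)) by apply/funext => -[|i].
elim: f m e => //=.
- by move=> f IHf g IHg m e; rewrite IHf IHg.
- by move=> f IHf g IHg m e; rewrite IHf IHg.
- by move=> f IHf m e; split=> -[y]; rewrite ?IHf ?E => H; exists y; rewrite ?IHf ?E.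
- by move=> x f IHf m e; split=> H y /H; rewrite ?IHf ?E.
Qed.

Section RE.
Variables (W : Type) (word : W -> seq bool).

(** The formula must be correct only on the points of [W]: an element of [W] may carry, besides the
    word, the object that the word describes and a proof that it does, so that [Q] can speak of
    real numbers. *)
Definition re (Q : W -> env -> Prop) : Prop :=
  exists f, forall a e, sat (word a) f e <-> Q a e.

Definition rfun (F : W -> env -> nat) : Prop :=
  re (fun a e => e 0 = F a (lift e)).

Lemma re_ext Q Q' : (forall a e, Q a e <-> Q' a e) -> re Q -> re Q'.
Proof. by move=> E [f Hf]; exists f => a e; rewrite Hf E. Qed.

Lemma re_and P Q : re P -> re Q -> re (fun a e => P a e /\ Q a e).
Proof. by move=> [f Hf] [g Hg]; exists (FAnd f g) => a e /=; rewrite Hf Hg. Qed.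

Lemma re_or P Q : re P -> re Q -> re (fun a e => P a e \/ Q a e).
Proof. by move=> [f Hf] [g Hg]; exists (FOr f g) => a e /=; rewrite Hf Hg. Qed.

Lemma re_ex (Q : W -> nat -> env -> Prop) :
  re (fun a e => Q a (e 0) (lift e)) -> re (fun a e => exists y, Q a y e).
Proof.
move=> [f Hf]; exists (FEx f) => a e /=.
by split=> -[y H]; exists y; [move/Hf: H|apply/Hf].
Qed.

Lemma re_ball_var x (Q : W -> nat -> env -> Prop) :
  re (fun a e => Q a (e 0) (lift e)) ->
  re (fun a e => forall y, y < e x -> Q a y e).
Proof.
move=> [f Hf]; exists (FAll x f) => a e /=.
by split=> H y Hy; [have /Hf := H y Hy|apply/Hf; apply: H].
Qed.

Lemma re_ren m Q : re Q -> re (fun a e => Q a (fun i => e (m i))).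
Proof. by move=> [f Hf]; exists (ren m f) => a e; rewrite sat_ren Hf. Qed.

(** The formula need not be found effectively: facts that depend on no input are decided
    classically. *)
Lemma re_const (P : Prop) : re (fun _ _ => P).
Proof.
have [p|np] := pselect P.
  exists (FOr (FCmp true 0 0 0 0) (FCmp false 0 0 0 0)) => a e /=.
  by split=> // _; case: leqP; [left|right].
exists (FAnd (FCmp true 0 0 0 0) (FCmp false 0 0 0 0)) => a e /=.
by split=> // -[->].
Qed.

Lemma re_bit b x : re (fun a e => letter (word a) (e x) = Some b).
Proof. by exists (FBit b x). Qed.

Lemma re_is0 i : re (fun a e => e i = 0).
Proof.
apply: re_ext (re_ball_var i (Q := fun _ _ _ => False) (re_const False)) => a e.
by split=> [H|-> //]; case E : (e i) => [//|n]; case: (H n); rewrite E.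
Qed.

(** The constants are pinned down by their order, since the atoms have no constants. *)
Lemma re_is1 i : re (fun a e => e i = 1).
Proof.
apply: (@re_ext (fun a e => (exists z, z = 0 /\ (e i <= z * z + z) = false) /\
   forall y, y < e i -> y = 0)); last first.
  apply: re_and; last by apply: re_ball_var; apply: re_is0.
  apply: re_ex; apply: re_and; first exact: re_is0.
  by exists (FCmp false 0 0 0 i.+1).
move=> a e; split=> [[[z [-> H]] H1]|->]; last by split; [exists 0|case].
case: (e i) H H1 => [ // |[ // |n]] _ H; by have := H 1%N isT.
Qed.

Lemma re_muladd x y u z : re (fun a e => e z = e x * e y + e u).
Proof.
apply: (@re_ext (fun a e => (e z <= e x * e y + e u) = true /\
  exists o, o = 1 /\ exists s, (s <= e x * e y + e u) = false /\ (s <= o * e z + o) = true));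
  last first.
  apply: re_and; first by exists (FCmp true x y u z).
  apply: re_ex; apply: re_and; first exact: re_is1.
  apply: re_ex; apply: re_and; first by exists (FCmp false x.+2 y.+2 u.+2 0).
  by exists (FCmp true 1 z.+2 1 0).
move=> a e; split=> [[H1 [z1 [-> [s [H2 H3]]]]]|E]; first by lia.
by split; [lia|exists 1; split=> //; exists (e z).+1; split; lia].
Qed.

Lemma rfun_ext F G : (forall a e, F a e = G a e) -> rfun F -> rfun G.
Proof. by move=> E; apply: re_ext => a e; rewrite E. Qed.

Lemma rfun_ren m F : rfun F -> rfun (fun a e => F a (fun i => e (m i))).
Proof. exact: (@re_ren (fun i => if i is j.+1 then (m j).+1 else 0)). Qed.

(** Replaces a term by a new variable, and so reduces relations between terms to relations between
    variables. *)
Lemma re_let F (Q : W -> nat -> env -> Prop) : rfun F ->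
  re (fun a e => Q a (e 0) (lift e)) -> re (fun a e => Q a (F a e) e).
Proof.
move=> HF HQ; apply: (@re_ext (fun a e => exists y, y = F a e /\ Q a y e)).
  by move=> a e; split=> [[y [->]] //|H]; exists (F a e).
by apply: re_ex; apply: re_and.
Qed.

Lemma rfun_muladd F G H : rfun F -> rfun G -> rfun H ->
  rfun (fun a e => F a e * G a e + H a e).
Proof.
move=> HF HG HH; rewrite /rfun.
apply: (@re_let (fun a e => F a (lift e)) (fun a y e => e 0 = y * G a (lift e) + H a (lift e))).
  exact: (@rfun_ren S).
apply: (@re_let (fun a e => G a (lift (lift e))) (fun a y e => e 1 = e 0 * y + H a (lift (lift e)))).
  exact: (@rfun_ren (fun i => i.+2)).
apply: (@re_let (fun a e => H a (lift (lift (lift e)))) (fun a y e => e 2 = e 1 * e 0 + y)).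
  exact: (@rfun_ren (fun i => i.+3)).
exact: (@re_muladd 2 1 0 3).
Qed.

Lemma rfun_var i : rfun (fun a e => e i).
Proof.
rewrite /rfun /lift; apply: (@re_ext (fun a e => exists z, z = 0 /\ e 0 = z * z + e i.+1)).
  by move=> a e; split=> [[z [-> ->]] //|->]; exists 0.
by apply: re_ex; apply: re_and; [apply: re_is0|apply: (@re_muladd 0 0 i.+2 1)].
Qed.

Lemma rfun0 : rfun (fun _ _ => 0).
Proof. exact: re_is0. Qed.

Lemma rfun1 : rfun (fun _ _ => 1).
Proof. exact: re_is1. Qed.

Lemma rfun_add F G : rfun F -> rfun G -> rfun (fun a e => F a e + G a e).
Proof.
move=> HF HG; apply: rfun_ext (rfun_muladd rfun1 HF HG) => a e; by rewrite mul1n.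
Qed.

Lemma rfun_mul F G : rfun F -> rfun G -> rfun (fun a e => F a e * G a e).
Proof.
move=> HF HG; apply: rfun_ext (rfun_muladd HF HG rfun0) => a e; by rewrite addn0.
Qed.

Lemma rfun_succ F : rfun F -> rfun (fun a e => (F a e).+1).
Proof. by move=> HF; apply: rfun_ext (rfun_add HF rfun1) => a e; rewrite addn1. Qed.

Lemma rfun_const c : rfun (fun _ _ => c).
Proof. by elim: c => [|c IH]; [apply: rfun0|apply: rfun_succ]. Qed.

Lemma re_eq F G : rfun F -> rfun G -> re (fun a e => F a e = G a e).
Proof. by move=> HF HG; apply: (re_let (Q := fun a y e => y = G a e) HF). Qed.

Lemma re_le F G : rfun F -> rfun G -> re (fun a e => F a e <= G a e).
Proof.
move=> HF HG; apply: (@re_ext (fun a e => exists d, G a e = F a e + d)).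
  by move=> a e; split=> [[d ->]|le]; [lia|exists (G a e - F a e); lia].
apply: re_ex; apply: re_eq; first exact: (@rfun_ren S).
by apply: rfun_add; [exact: (@rfun_ren S)|exact: rfun_var].
Qed.

Lemma re_lt F G : rfun F -> rfun G -> re (fun a e => F a e < G a e).
Proof. by move=> HF HG; apply: re_le => //; apply: rfun_succ. Qed.

Lemma re_ball F (Q : W -> nat -> env -> Prop) : rfun F ->
  re (fun a e => Q a (e 0) (lift e)) ->
  re (fun a e => forall y, y < F a e -> Q a y e).
Proof.
move=> HF HQ; apply: (re_let (Q := fun a x e => forall y, y < x -> Q a y e) HF).
apply: (@re_ball_var 0 (fun a y e => Q a y (lift e))).
exact: (@re_ren (fun i => if i is j.+1 then j.+2 else 0) _ HQ).
Qed.

(** The pairing function doubled is a polynomial. *)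
Lemma rfun_cpair F G : rfun F -> rfun G -> rfun (fun a e => cpair (F a e) (G a e)).
Proof.
move=> HF HG; rewrite /rfun.
have HF' := @rfun_ren S _ HF; have HG' := @rfun_ren S _ HG.
apply: (@re_ext (fun a e => 2 * e 0 = (F a (lift e) + G a (lift e)) *
   (F a (lift e) + G a (lift e)).+1 + 2 * G a (lift e))).
  move=> a e; rewrite /cpair; move: (F _ _) (G _ _) => f g.
  have := bin_ffact (f + g).+1 2; rewrite /falling_factorial /= -/(_ * _) => Hb.
  have {}Hb : 'C((f + g).+1, 2) * 2 = (f + g).+1 * (f + g).
    by rewrite -[2]/(2`!) bin_ffact ffactnS ffactn1.
  by split; lia.
apply: re_eq; first by apply: rfun_mul; [apply: rfun_const|apply: rfun_var].
by do ?[apply: rfun_add|apply: rfun_mul|apply: rfun_succ|apply: rfun_const|exact: HF'|exact: HG'].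
Qed.

Lemma re_ex_fin (T : finType) (Q : T -> W -> env -> Prop) :
  (forall t, re (Q t)) -> re (fun a e => exists t, Q t a e).
Proof.
move=> HQ; suff [] : re (fun a e => exists2 t, t \in enum T & Q t a e).
  move=> f Hf; exists f => a e; rewrite Hf.
  by split=> [[t _ H]|[t H]]; exists t => //; rewrite mem_enum.
elim: (enum T) => [|t s IH].
  by apply: re_ext (re_const False) => a e; split=> // -[].
apply: re_ext (re_or (HQ t) IH) => a e; split=> [[H|[u us H]]|[u]].
- by exists t => //; rewrite mem_head.
- by exists u => //; rewrite in_cons us orbT.
- by rewrite in_cons => /predU1P[-> H|us H]; [left|right; exists u].
Qed.

Lemma re_all_fin (T : finType) (Q : T -> W -> env -> Prop) :
  (forall t, re (Q t)) -> re (fun a e => forall t, Q t a e).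
Proof.
move=> HQ; suff [] : re (fun a e => forall t, t \in enum T -> Q t a e).
  move=> f Hf; exists f => a e; rewrite Hf.
  by split=> H t => [|_]; apply: H; rewrite mem_enum.
elim: (enum T) => [|t s IH].
  by apply: re_ext (re_const True) => a e; split.
apply: re_ext (re_and (HQ t) IH) => a e; split=> [[H1 H2] u|H].
  by rewrite in_cons => /predU1P[->|/H2].
by split=> [|u us]; apply: H; rewrite in_cons ?us ?eqxx ?orbT.
Qed.

End RE.

Ltac re_fun := repeat first
  [ assumption
  | lazymatch goal with
    | |- rfun _ (fun a e => cpair (@?f a e) (@?g a e)) => apply: (@rfun_cpair _ _ f g)
    | |- rfun _ (fun a e => addn (@?f a e) (@?g a e)) => apply: (@rfun_add _ _ f g)
    | |- rfun _ (fun a e => muln (@?f a e) (@?g a e)) => apply: (@rfun_mul _ _ f g)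
    | |- rfun _ (fun a e => S (@?f a e)) => apply: (@rfun_succ _ _ f)
    | |- rfun _ (fun a e => e _) => apply: rfun_var
    | |- rfun _ (fun a e => ?c) => apply: rfun_const
    end
  | apply: rfun_ren; assumption ].

Ltac re_auto := cbv beta delta [lift]; repeat first
  [ assumption | apply: re_and | apply: re_or
  | apply: re_ex; cbv beta delta [lift]
  | apply: re_ball; [solve [re_fun] | cbv beta delta [lift]]
  | apply: re_eq; [solve [re_fun]|solve [re_fun]] | apply: re_le; [solve [re_fun]|solve [re_fun]]
  | apply: re_lt; [solve [re_fun]|solve [re_fun]] | apply: re_const
  | apply: re_ren; assumption ].

(** The diagonals of the pairing function are disjoint intervals. *)
Lemma cpair_inj a b c d : cpair a b = cpair c d -> a = c /\ b = d.
Proof.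
have step x y : 'C((x + y).+2, 2) = 'C((x + y).+1, 2) + (x + y).+1.
  by rewrite binS bin1.
have mono m n : m <= n -> 'C(m, 2) <= 'C(n, 2) by move=> le; apply: leq_bin2l.
rewrite /cpair => E; suff Es : a + b = c + d by move: E; rewrite Es; lia.
case: (ltngtP (a + b) (c + d)) => // H.
  by have := mono (a + b).+2 (c + d).+1 H; rewrite step; lia.
by have := mono (c + d).+2 (a + b).+1 H; rewrite step; lia.
Qed.

(** * Inductive definitions *)
(** Goedel's moduli. They are pairwise coprime for [y] below [N] if [d] is the factorial of [N]. *)
Definition fmod (d y : nat) : nat := (d * y.+1).+1.

Lemma coprime_fmod N y z : y < N -> z < N -> y != z -> coprime (fmod N`! y) (fmod N`! z).
Proof.
move=> yN zN ne.
wlog lt : y z yN zN {ne} / y < z => [H|].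
  by move: ne; rewrite neq_ltn => /orP[lt|lt]; [|rewrite coprime_sym]; apply: H.
rewrite /coprime; case: (posnP (gcdn (fmod N`! y) (fmod N`! z)).-1) => [|gt1].
  by have : 0 < gcdn (fmod N`! y) (fmod N`! z) by [rewrite gcdn_gt0]; lia.
have [p pp pg] : exists2 p, prime p & p %| gcdn (fmod N`! y) (fmod N`! z).
  by exists (pdiv (gcdn (fmod N`! y) (fmod N`! z))); rewrite ?pdiv_dvd // pdiv_prime //; lia.
move: pg; rewrite dvdn_gcd => /andP[py pz].
have pd : p %| N`! * (z - y).
  have -> : N`! * (z - y) = fmod N`! z - fmod N`! y.
    by rewrite /fmod subSS -mulnBr subSS.
  exact: dvdn_sub.
suff pN : p %| N`!.
  move: py; rewrite /fmod -addn1 dvdn_addr; last exact: dvdn_mulr.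
  by rewrite dvdn1 => /eqP p1; rewrite p1 in pp.
move: pd; rewrite Euclid_dvdM // => /orP[//|/dvdn_leq ple].
by rewrite dvdn_fact // prime_gt0 //= (leq_trans (ple _)) //; lia.
Qed.

(** The set is coded by the product [c] of the moduli of its elements. *)
Lemma set_code (s : seq nat) : exists c d N,
  (forall y, y \in s -> y < N) /\ (forall y, y < N -> (fmod d y %| c) = (y \in s)).
Proof.
pose N := (\max_(y <- s) y).+1.
have sN y : y \in s -> y < N by move=> ys; rewrite ltnS leq_bigmax_seq.
exists (\prod_(y <- s) fmod N`! y), N`!, N; split=> // y yN.
apply/idP/idP => [|ys]; last by rewrite (big_rem y) //= dvdn_mulr.
apply: contraLR => ys; have cop : coprime (fmod N`! y) (\prod_(y <- s) fmod N`! y).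
  rewrite big_seq; elim/big_ind: _ => //; first exact: coprimen1.
    by move=> a b Ha Hb; rewrite coprimeMr Ha.
  by move=> z zs; apply: coprime_fmod => //; [apply: sN|apply: contraNneq ys => ->].
apply/negP => dv; move: cop; rewrite /coprime (gcdn_idPl dv) /fmod.
by have := fact_gt0 N; lia.
Qed.

(** Two premises suffice below; a rule with one premise repeats it. *)
Inductive derives (ax : nat -> Prop) (rule : nat -> nat -> nat -> Prop) : nat -> Prop :=
| derives_ax t : ax t -> derives ax rule t
| derives_rule t p q : rule t p q -> derives ax rule p -> derives ax rule q ->
    derives ax rule t.

Section Certificates.
Variables (ax : nat -> Prop) (rule : nat -> nat -> nat -> Prop).

(** Elements of a certificate are pairs of a fact and a rank. The ranks decrease towards the
    premises and exclude circular justifications. *)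
Definition justified (s : nat -> Prop) (y : nat) : Prop :=
  exists t k, y = cpair t k /\ (ax t \/ exists p i q j,
    rule t p q /\ (s (cpair p i) /\ i < k) /\ (s (cpair q j) /\ j < k)).

Lemma certificate_complete t : derives ax rule t ->
  exists s : seq nat, (exists k, cpair t k \in s) /\
    forall y, y \in s -> justified (fun z => z \in s) y.
Proof.
have mono (s s' : seq nat) y : {subset s <= s'} ->
    justified (fun z => z \in s) y -> justified (fun z => z \in s') y.
  move=> sub [u [k [-> [H|[p [i [q [j [H [[pi lei] [qj lej]]]]]]]]]]].
    by exists u, k; split=> //; left.
  exists u, k; split=> //; right; exists p, i, q, j.
  by split=> //; split; (split; first exact: sub).
elim=> [{}t Ht|{}t p q H _ [s1 [[i Hi] J1]] _ [s2 [[j Hj] J2]]].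
  exists [:: cpair t 0]; split; first by exists 0; rewrite mem_head.
  by move=> y; rewrite inE => /eqP ->; exists t, 0; split=> //; left.
exists (cpair t (maxn i j).+1 :: s1 ++ s2); split.
  by exists (maxn i j).+1; rewrite mem_head.
move=> y; rewrite inE mem_cat => /orP[/eqP ->|/orP[y1|y2]].
- exists t, (maxn i j).+1; split=> //; right; exists p, i, q, j.
  by rewrite !inE !mem_cat Hi Hj !orbT; do !split=> //; lia.
- by apply: mono (J1 _ y1) => z zs; rewrite inE mem_cat zs orbT.
- by apply: mono (J2 _ y2) => z zs; rewrite inE mem_cat zs !orbT.
Qed.

Lemma certificate_sound (s : nat -> Prop) : (forall y, s y -> justified s y) ->
  forall k t, s (cpair t k) -> derives ax rule t.
Proof.
move=> J; elim/ltn_ind => k IH t /J [u [l [/cpair_inj [<- <-] [H|]]]].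
  exact: derives_ax.
move=> [p [i [q [j [H [[pi lei] [qj lej]]]]]]].
by apply: derives_rule H _ _; [apply: IH pi|apply: IH qj].
Qed.

End Certificates.

(** A fact is derivable if and only if it occurs in a finite set all of whose elements are
    justified. In the formula, each number below the bound is in the set and justified, or it is
    not in the set; the latter is again an existential statement, by division with nonzero
    remainder. *)
Lemma re_derives (W : Type) (word : W -> seq bool) (ax : W -> nat -> Prop)
    (rule : W -> nat -> nat -> nat -> Prop) (F : W -> env -> nat) :
  re word (fun a e => ax a (e 0)) -> re word (fun a e => rule a (e 0) (e 1) (e 2)) ->
  rfun word F -> re word (fun a e => derives (ax a) (rule a) (F a e)).
Proof.
move=> Hax Hrule HF.
pose mem c d N y := y < N /\ exists q, c = q * fmod d y.
have memP c d N y : mem c d N y <-> (y < N /\ fmod d y %| c).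
  split=> -[yN]; first by move=> [q ->]; rewrite dvdn_mull.
  by move/dvdnP => [q ->]; split=> //; exists q.
apply: (@re_ext _ _ (fun a e => exists c d N, (exists k, mem c d N (cpair (F a e) k)) /\
   forall y, y < N -> (exists q r, c = q * fmod d y + r.+1 /\ r.+1 < fmod d y) \/
      justified (ax a) (rule a) (mem c d N) y)).
  move=> a e; split=> [[c [d [N [[k Hk] J]]]]|H].
    apply: (@certificate_sound _ _ (mem c d N) _ k) => // y my.
    case: (J y my.1) => // -[q [r [Ec ltr]]]; case/memP: my => _.
    by rewrite Ec dvdn_addr ?dvdn_mull // => /dvdn_leq; lia.
  have [s [[k Hk] J]] := certificate_complete H.
  have [c [d [N [sN Hs]]]] := set_code s.
  have smem y : y \in s -> mem c d N y by move=> ys; apply/memP; rewrite Hs ?sN.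
  exists c, d, N; split; first by exists k; apply: smem.
  move=> y yN; have [ys|ys] := boolP (y \in s).
    right; have [t [l [-> [Ht|[p [i [q [j [Hr [[pi lei] [qj lej]]]]]]]]]]] := J y ys.
      by exists t, l; split=> //; left.
    by exists t, l; split=> //; right; exists p, i, q, j; split=> //; split; split=> //; exact: smem.
  left; exists (c %/ fmod d y), (c %% fmod d y).-1.
  have : 0 < c %% fmod d y by rewrite lt0n -/(dvdn _ _) Hs.
  have : c %% fmod d y < fmod d y by rewrite ltn_mod.
  by have := divn_eq c (fmod d y); lia.
rewrite /justified /mem /fmod.
have Hax1 := @re_ren _ _ (fun _ => 1) _ Hax.
have Hrule1 := @re_ren _ _ (fun i => nth 0 [:: 5; 3; 1] i) _ Hrule.
do 3 apply: re_ex; apply: re_and; first by re_auto.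
cbv beta delta [lift]; apply: re_ball; first by re_fun.
apply: re_or; first by re_auto.
cbv beta delta [lift]; do 2 apply: re_ex; apply: re_and; first by re_auto.
apply: re_or; first exact: Hax1.
do 4 apply: re_ex; apply: re_and; first exact: Hrule1.
by re_auto.
Qed.

(** * The numbers written in the input word *)
Section Input.
Variables (W : Type) (word : W -> seq bool) (codes : W -> seq nat).
Hypothesis word_codes : forall a, word a = unary_word (codes a).

Definition block_start (s : seq nat) (j : nat) : nat := size (unary_word (take j s)).

Lemma unary_word_cat s t : unary_word (s ++ t) = unary_word s ++ unary_word t.
Proof. by rewrite /unary_word map_cat flatten_cat. Qed.

Lemma block_startS s j : j < size s ->
  block_start s j.+1 = block_start s j + (nth 0 s j).+1.
Proof.
move=> Hj; rewrite /block_start (take_nth 0 Hj) -cats1 unary_word_cat size_cat.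
by rewrite /unary_word /= cats0 size_rcons size_nseq.
Qed.

Lemma letter_block s j i : j < size s -> i <= nth 0 s j ->
  letter (unary_word s) (block_start s j + i) = Some (i < nth 0 s j).
Proof.
move=> Hj Hi.
have Es : s = take j s ++ nth 0 s j :: drop j.+1 s.
  by rewrite -drop_nth // cat_take_drop.
rewrite /letter {1}Es unary_word_cat map_cat nth_cat size_map.
rewrite ltnNge leq_addr /= addKn /unary_word /= map_cat nth_cat size_map size_rcons size_nseq.
rewrite ltnS Hi map_rcons nth_rcons size_map size_nseq map_nseq nth_nseq.
by case: ltngtP Hi.
Qed.

Lemma re_letter b F : rfun word F -> re word (fun a e => letter (word a) (F a e) = Some b).
Proof.
move=> HF; apply: (re_let (Q := fun a y e => letter (word a) y = Some b) HF).
exact: re_bit.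
Qed.

Lemma rfun_block j : (forall a, j < size (codes a)) ->
  rfun word (fun a _ => block_start (codes a) j) ->
  rfun word (fun a _ => nth 0 (codes a) j).
Proof.
move=> Hj Hs; rewrite /rfun.
apply: (@re_ext _ _ (fun a e =>
  (forall i, i < e 0 -> letter (word a) (block_start (codes a) j + i) = Some true) /\
  letter (word a) (block_start (codes a) j + e 0) = Some false)); last first.
  apply: re_and; last by apply: re_letter; re_fun.
  apply: re_ball; first by re_fun.
  by apply: re_letter; re_fun.
move=> a e; rewrite !word_codes; split=> [[Ht Hf]|->]; last first.
  by split=> [i Hi|]; rewrite letter_block ?Hi ?ltnn // ltnW.
case: (ltngtP (e 0) (nth 0 (codes a) j)) => // H.
  by move: Hf; rewrite letter_block ?H // ltnW.
by have := Ht _ H; rewrite letter_block ?ltnn.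
Qed.

(** Each block ends at the first letter false after its start. *)
Lemma rfun_code j : (forall a, j < size (codes a)) ->
  rfun word (fun a _ => nth 0 (codes a) j).
Proof.
move=> Hj; apply: rfun_block => //.
elim: j Hj => [|j IH] Hj.
  by apply: rfun_ext (rfun_const word 0) => a e; rewrite /block_start take0.
have Hj' a : j < size (codes a) by apply: ltnW.
have Hs := IH Hj'; have Hb := rfun_block Hj' Hs.
apply: (@rfun_ext _ _ (fun a _ => block_start (codes a) j + (nth 0 (codes a) j).+1)).
  by move=> a e; rewrite block_startS.
by re_fun.
Qed.

End Input.

(** * Evaluation of programs *)
Section RecfInd.
Variable P : recf -> Prop.
Hypothesis Hzero : P RZero.
Hypothesis Hsucc : P RSucc.
Hypothesis Hproj : forall i, P (RProj i).
Hypothesis Hcomp : forall g hs, P g -> (forall h, List.In h hs -> P h) -> P (RComp g hs).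
Hypothesis Hprec : forall g h, P g -> P h -> P (RPrec g h).
Hypothesis Hmu : forall g, P g -> P (RMu g).

Fixpoint recf_nested_ind (f : recf) : P f :=
  match f with
  | RZero => Hzero
  | RSucc => Hsucc
  | RProj i => Hproj i
  | RComp g hs => Hcomp (recf_nested_ind g)
      ((fix all_in (hs : seq recf) : forall h, List.In h hs -> P h :=
         match hs with
         | [::] => fun h (H : False) => match H with end
         | h0 :: hs' => fun h H => match H with
            | or_introl E => eq_ind h0 P (recf_nested_ind h0) h E
            | or_intror H' => all_in hs' h H'
            end
         end) hs)
  | RPrec g h => Hprec (recf_nested_ind g) (recf_nested_ind h)
  | RMu g => Hmu (recf_nested_ind g)
  end.
End RecfInd.

(** The local recursion in [reval], named so that it can be unfolded. *)
Definition revals (v : seq nat) : seq recf -> seq nat -> Prop :=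
  fix revals (hs : seq recf) (ws : seq nat) {struct hs} : Prop :=
    match hs, ws with
    | [::], [::] => True
    | h :: hs', w :: ws' => reval h v w /\ revals hs' ws'
    | _, _ => False
    end.

Fixpoint rcodes (hs : seq recf) : nat :=
  if hs is h :: hs' then (cpair (rcode h) (rcodes hs')).+1 else 0.

Fixpoint lcode (s : seq nat) : nat :=
  if s is a :: s' then (cpair a (lcode s')).+1 else 0.

Lemma reval_comp g hs v y :
  reval (RComp g hs) v y = (exists2 ws, revals v hs ws & reval g ws y).
Proof. by []. Qed.

Lemma rcode_comp g hs : rcode (RComp g hs) = cpair 3 (cpair (rcode g) (rcodes hs)).
Proof. by []. Qed.

Lemma reval_fun f v y z : reval f v y -> reval f v z -> y = z.
Proof.
elim/recf_nested_ind: f v y z.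
- by move=> v y z /= -> ->.
- by move=> v y z /= -> ->.
- by move=> i v y z /= -> ->.
- move=> g hs IHg IHhs v y z; rewrite !reval_comp => -[ws Hws Hy] [ws' Hws' Hz].
  suff E : ws = ws' by apply: IHg Hy _; rewrite E.
  elim: hs IHhs ws ws' Hws Hws' {Hy Hz} => [|h hs IH] IHhs [|w ws] [|w' ws'] //= [Hw Hws] [Hw' Hws'].
  congr (_ :: _); first exact: (IHhs h (or_introl erefl) v).
  by apply: IH => // h' Hh'; apply: IHhs; right.
- move=> g h IHg IHh v y z /= [s [s0 sS ->]] [s' [s0' sS' ->]].
  suff E : forall i, i <= head 0 v -> nth 0 s i = nth 0 s' i by apply: E.
  elim=> [|i IH] Hi; first exact: IHg s0 s0'.
  by apply: IHh (sS _ Hi) _; rewrite IH 1?ltnW //; apply: sS'.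
- move=> g IHg v y z /= [Hy ly] [Hz lz].
  case: (ltngtP y z) => // [/lz|/ly] [k Hk].
    by have := IHg _ _ _ Hy Hk.
  by have := IHg _ _ _ Hz Hk.
Qed.

(** Five kinds of facts, distinguished by [tag]; [u] codes the list [v] of the arguments:
    - 0: the program [a] has the value [c] at [v];
    - 1: the programs in the list [a] have the values in the list [c] at [v];
    - 2: the entry [b] of the list [a] is [c];
    - 3: the recursion with the pair of programs [a] and parameters [v] has the value [y] at the
      stage [i], where [c] is the pair of [i] and [y];
    - 4: the program [a] has nonzero values at all first arguments below [c].
    In kinds 0, 1, 3 and 4, [u] is the component [b]. The last two kinds replace the sequences and
    bounded quantifiers of [reval] by one step of a rule. *)
Definition fact (tag a b c : nat) : nat := cpair tag (cpair a (cpair b c)).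

Definition eval_axiom (t : nat) : Prop :=
  (exists u, t = fact 0 (cpair 0 0) u 0) \/
  t = fact 0 (cpair 1 0) 0 1 \/
  (exists a u, t = fact 0 (cpair 1 0) (cpair a u).+1 a.+1) \/
  (exists u, t = fact 1 0 u 0) \/
  (exists i, t = fact 2 0 i 0) \/
  (exists y u, t = fact 2 (cpair y u).+1 0 y) \/
  (exists g u, t = fact 4 g u 0).

Definition eval_rule (t p q : nat) : Prop :=
  (exists i u y, t = fact 0 (cpair 2 i) u y /\ p = fact 2 u i y /\ q = p) \/
  (exists a u i y, t = fact 2 (cpair a u).+1 i.+1 y /\ p = fact 2 u i y /\ q = p) \/
  (exists g h u y, t = fact 3 (cpair g h) u (cpair 0 y) /\ p = fact 0 g u y /\ q = p) \/
  (exists e y, t = fact 0 (cpair 4 e) 0 y /\ p = fact 3 e 0 (cpair 0 y) /\ q = p) \/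
  (exists e i u y, t = fact 0 (cpair 4 e) (cpair i u).+1 y /\
     p = fact 3 e u (cpair i y) /\ q = p) \/
  (exists g u y, t = fact 0 (cpair 5 g) u y /\ p = fact 4 g u y /\
     q = fact 0 g (cpair y u).+1 0) \/
  (exists g hs u ws y, t = fact 0 (cpair 3 (cpair g hs)) u y /\ p = fact 1 hs u ws /\
     q = fact 0 g ws y) \/
  (exists h hs u w ws, t = fact 1 (cpair h hs).+1 u (cpair w ws).+1 /\ p = fact 0 h u w /\
     q = fact 1 hs u ws) \/
  (exists g h u i y z, t = fact 3 (cpair g h) u (cpair i.+1 y) /\
     p = fact 3 (cpair g h) u (cpair i z) /\ q = fact 0 h (cpair i (cpair z u).+1).+1 y) \/
  (exists g u i k, t = fact 4 g u i.+1 /\ p = fact 4 g u i /\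
     q = fact 0 g (cpair i u).+1 k.+1).

Notation evaluates := (derives eval_axiom eval_rule).

Definition fact_meaning (t : nat) : Prop :=
  [/\ forall f v y, t = fact 0 (rcode f) (lcode v) y -> reval f v y,
      forall hs v z, t = fact 1 (rcodes hs) (lcode v) z ->
        exists ws, z = lcode ws /\ revals v hs ws,
      forall v i y, t = fact 2 (lcode v) i y -> y = nth 0 v i,
      forall g h v i y, t = fact 3 (cpair (rcode g) (rcode h)) (lcode v) (cpair i y) ->
        exists s, [/\ reval g v (nth 0 s 0),
          forall j, j < i -> reval h [:: j, nth 0 s j & v] (nth 0 s j.+1) & y = nth 0 s i]
    & forall g v i, t = fact 4 (rcode g) (lcode v) i ->
        forall j, j < i -> exists k, reval g (j :: v) k.+1].

Lemma fact_inj k a b c k' a' b' c' :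
  fact k a b c = fact k' a' b' c' -> [/\ k = k', a = a', b = b' & c = c'].
Proof. by move=> /cpair_inj[-> /cpair_inj[-> /cpair_inj[-> ->]]]. Qed.

Lemma lcode_cons v a u : lcode v = (cpair a u).+1 -> exists2 v', v = a :: v' & u = lcode v'.
Proof. by case: v => // a' v' /= [/cpair_inj[-> <-]]; exists v'. Qed.

Lemma lcode_nil v : lcode v = 0 -> v = [::].
Proof. by case: v. Qed.

Arguments cpair : simpl never.

(** The code of a program determines its outermost constructor, so each rule can only be an instance
    of the matching clause of [reval]. *)
Lemma evaluates_sound t : evaluates t -> fact_meaning t.
Proof.
elim=> {t} [t|t p q H _ Hp _ Hq].
- case=> [[u ->]|[->|[[a [u ->]]|[[u ->]|[[i ->]|[[y [u ->]]|[g [u ->]]]]]]]];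
    split=> [f v z|hs v z|v j z|f h v j z|f v j]; case/fact_inj => // _ E1 E2 E3.
  + by case: f E1 => [||?|? ?|? ?|?]; rewrite ?rcode_comp => /cpair_inj[].
  + case: f E1 => [||?|? ?|? ?|?]; rewrite ?rcode_comp => /cpair_inj[] //.
    by rewrite -E3 (lcode_nil (esym E2)).
  + case: f E1 => [||?|? ?|? ?|?]; rewrite ?rcode_comp => /cpair_inj[] //.
    by case: (lcode_cons (esym E2)) => v' ->; rewrite -E3.
  + by case: hs E1 => // _; exists [::]; rewrite -E3.
  + by rewrite -E3 (lcode_nil (esym E1)) nth_nil.
  + by case: (lcode_cons (esym E1)) => v' -> _; rewrite -E3 -E2.
  + by rewrite -E3.
- case: Hp Hq => [p0 p1 p2 p3 p4] [q0 q1 q2 q3 q4].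
  case: H => [|[|[|[|[|[|[|[|[|]]]]]]]]].
  + move=> [i [u [y [Et [Ep _]]]]]; split=> [f v z|hs v z|v j z|f h v j z|f v j];
      rewrite Et; case/fact_inj => // _ E1 E2 E3.
    case: f E1 => [||?|? ?|? ?|?]; rewrite ?rcode_comp => /cpair_inj[] // _ Ei /=.
    by rewrite -E3 -Ei; apply: p2; rewrite Ep E2.
  + move=> [a [u [i [y [Et [Ep _]]]]]]; split=> [f v z|hs v z|v j z|f h v j z|f v j];
      rewrite Et; case/fact_inj => // _ E1 E2 E3.
    case: (lcode_cons (esym E1)) => v' -> Eu; rewrite -E3 -E2 /=.
    by apply: p2; rewrite Ep Eu.
  + move=> [g [h [u [y [Et [Ep _]]]]]]; split=> [f v z|hs v z|v j z|f h' v j z|f v j];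
      rewrite Et; case/fact_inj => // _ /cpair_inj[Eg Eh] Eu /cpair_inj[E0 Ey].
    exists [:: y]; split=> //=; last by rewrite -E0 -Ey.
      by apply: p0; rewrite Ep Eg Eu.
    by rewrite -E0.
  + move=> [e [y [Et [Ep _]]]]; split=> [f v z|hs v z|v j z|f h v j z|f v j];
      rewrite Et; case/fact_inj => // _ E1 E2 E3.
    case: f E1 => [||?|? ?|g h|?]; rewrite ?rcode_comp => /cpair_inj[] // _ Ee.
    have [|s [s0 sS Es]] := p3 g h [::] 0 z; first by rewrite Ep Ee -E3.
    by exists s; rewrite (lcode_nil (esym E2)).
  + move=> [e [i [u [y [Et [Ep _]]]]]]; split=> [f v z|hs v z|v j z|f h v j z|f v j];
      rewrite Et; case/fact_inj => // _ E1 E2 E3.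
    case: f E1 => [||?|? ?|g h|?]; rewrite ?rcode_comp => /cpair_inj[] // _ Ee.
    case: (lcode_cons (esym E2)) => v' -> Eu.
    have [|s [s0 sS Es]] := p3 g h v' i z; first by rewrite Ep Ee -E3 Eu.
    by exists s.
  + move=> [g [u [y [Et [Ep Eq]]]]]; split=> [f v z|hs v z|v j z|f h v j z|f v j];
      rewrite Et; case/fact_inj => // _ E1 E2 E3.
    case: f E1 => [||?|? ?|? ?|g']; rewrite ?rcode_comp => /cpair_inj[] // _ Eg /=.
    split; first by apply: q0; rewrite Eq Eg E2 E3.
    by apply: p4; rewrite Ep Eg E2 E3.
  + move=> [g [hs [u [ws [y [Et [Ep Eq]]]]]]]; split=> [f v z|hs' v z|v j z|f h v j z|f v j];
      rewrite Et; case/fact_inj => // _ E1 E2 E3.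
    case: f E1 => [||?|g' hs'|? ?|?]; rewrite ?rcode_comp => /cpair_inj[] // _ /cpair_inj[Eg Ehs].
    have [|ws' [Ews Hws]] := p1 hs' v ws; first by rewrite Ep Ehs E2.
    by rewrite reval_comp; exists ws' => //; apply: q0; rewrite Eq Eg Ews E3.
  + move=> [h [hs [u [w [ws [Et [Ep Eq]]]]]]]; split=> [f v z|hs' v z|v j z|f h' v j z|f v j];
      rewrite Et; case/fact_inj => // _ E1 E2 E3.
    case: hs' E1 => // h' hs' /= [/cpair_inj[Eh Ehs]].
    have [|ws' [Ews Hws]] := q1 hs' v ws; first by rewrite Eq Ehs E2.
    exists (w :: ws'); rewrite -E3 Ews; split=> //; split=> //.
    by apply: p0; rewrite Ep Eh E2.
  + move=> [g [h [u [i [y [z' [Et [Ep Eq]]]]]]]]; split=> [f v z|hs' v z|v j z|f h' v j z|f v j];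
      rewrite Et; case/fact_inj => // _ /cpair_inj[Eg Eh] Eu /cpair_inj[Ei Ey].
    have [|s [s0 sS Es]] := p3 f h' v i z'; first by rewrite Ep Eg Eh Eu.
    exists (rcons (mkseq (nth 0 s) i.+1) y).
    have E k : k <= i -> nth 0 (rcons (mkseq (nth 0 s) i.+1) y) k = nth 0 s k.
      by move=> Hk; rewrite nth_rcons size_mkseq ltnS Hk nth_mkseq.
    have Elast : nth 0 (rcons (mkseq (nth 0 s) i.+1) y) i.+1 = y.
      by rewrite nth_rcons size_mkseq ltnn eqxx.
    split; first by rewrite E.
      move=> k; rewrite -Ei ltnS leq_eqVlt => /orP[/eqP ->|Hk]; last first.
        by rewrite (E k (ltnW Hk)) (E k.+1 Hk); apply: sS.
      by rewrite Elast E // -Es; apply: q0; rewrite Eq Eh Eu.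
    by rewrite -Ei Elast.
  + move=> [g [u [i [k [Et [Ep Eq]]]]]]; split=> [f v z|hs' v z|v j z|f h' v j z|f v j];
      rewrite Et; case/fact_inj => // _ Eg Eu Ei.
    move=> l; rewrite -Ei ltnS leq_eqVlt => /orP[/eqP ->|Hk].
      by exists k; apply: q0; rewrite Eq Eg Eu.
    by apply: (p4 f v i) => //; rewrite Ep Eg Eu.
Qed.

Lemma evaluates_complete f v y : reval f v y -> evaluates (fact 0 (rcode f) (lcode v) y).
Proof.
have R t p q : eval_rule t p q -> evaluates p -> evaluates q -> evaluates t.
  by move=> H Hp Hq; apply: derives_rule H Hp Hq.
have A t : eval_axiom t -> evaluates t by move=> H; apply: derives_ax.
elim/recf_nested_ind: f v y.
- by move=> v y /= ->; apply: (A); left; eexists.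
- move=> [|a v] y /= ->; apply: (A); right; [by left|right; left].
  by exists a, (lcode v).
- move=> i v y /= ->.
  have Hn : evaluates (fact 2 (lcode v) i (nth 0 v i)).
    elim: v i => [|a v IH] i; first by rewrite nth_nil; apply: (A); do 4 right; left; exists i.
    case: i => [|i] /=; first by apply: (A); do 5 right; left; exists a, (lcode v).
    apply: (R _ _ _ _ (IH i) (IH i)); right; left; exists a, (lcode v), i, (nth 0 v i).
    by [].
  by apply: (R _ _ _ _ Hn Hn); left; exists i, (lcode v), (nth 0 v i).
- move=> g hs IHg IHhs v y; rewrite reval_comp rcode_comp => -[ws Hws /IHg Hg].
  apply: (R _ _ _ _ _ Hg); first
    by do 6 right; left; exists (rcode g), (rcodes hs), (lcode v), (lcode ws), y.
  elim: hs IHhs ws Hws {Hg} => [|h hs IH] IHhs [|w ws] //=.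
    by move=> _; apply: (A); do 3 right; left; eexists.
  move=> [/(IHhs h (or_introl erefl)) Hh Hhs].
  apply: (R _ _ _ _ Hh (IH _ ws Hhs)); last by move=> h' Hh'; apply: IHhs; right.
  by do 7 right; left; do 5 eexists.
- move=> g h IHg IHh v y /= [s [s0 sS ->]].
  have Hp i : i <= head 0 v -> evaluates
      (fact 3 (cpair (rcode g) (rcode h)) (lcode (behead v)) (cpair i (nth 0 s i))).
    elim: i => [|i IH] Hi.
      apply: (R _ _ _ _ (IHg _ _ s0) (IHg _ _ s0)); do 2 right; left; do 4 eexists.
      by split; first by [].
    apply: (R _ _ _ _ (IH (ltnW Hi)) (IHh _ _ (sS i Hi))); do 8 right; left; do 6 eexists.
    by split; first by [].
  have {}Hp := Hp _ (leqnn _); apply: (R _ _ _ _ Hp Hp).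
  case: v {IHg IHh s0 sS Hp} => [|a v] /=.
    by do 3 right; left; do 2 eexists; split.
  by do 4 right; left; do 4 eexists; split.
- move=> g IHg v y /= [/IHg Hy Hlt].
  apply: (R _ _ _ _ _ Hy); first by do 5 right; left; do 3 eexists; split.
  elim: y Hlt {Hy} => [|y IH] Hlt; first by apply: (A); do 6 right; do 2 eexists.
  have [k /IHg Hk] := Hlt y (ltnSn y).
  apply: (R _ _ _ _ (IH _) Hk); last by move=> i Hi; apply: Hlt; lia.
  by do 9 right; do 4 eexists; split.
Qed.

Lemma evaluatesP f v y : evaluates (fact 0 (rcode f) (lcode v) y) <-> reval f v y.
Proof.
split; last exact: evaluates_complete.
by move=> /evaluates_sound[H _ _ _ _]; apply: H.
Qed.

Lemma re_evaluates (W : Type) (word : W -> seq bool) (F : W -> env -> nat) :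
  rfun word F -> re word (fun a e => evaluates (F a e)).
Proof.
move=> HF; apply: re_derives => //.
  by rewrite /eval_axiom /fact; re_auto.
by rewrite /eval_rule /fact; re_auto.
Qed.

(** * Real functions given by rational intervals *)
Section RealFunctions.
Variable R : realType.
Local Open Scope ring_scope.

(** The open interval from [l / m.+1] to [u / m.+1], except that a lower bound 0 is always allowed.
    For nonnegative numbers this makes the end points of a product the products of the end
    points. *)
Definition within (l u m : nat) (x : R) : Prop :=
  (l = 0%N \/ l%:R < m.+1%:R * x) /\ m.+1%:R * x < u%:R.

Lemma within_approx x m : 0 <= x ->
  exists u, within (u - 2) u m x /\ u%:R <= m.+1%:R * x + 1.
Proof.
move=> x0; have y0 : 0 <= m.+1%:R * x by rewrite mulr_ge0.
have /andP[lo up] := truncn_itv y0; exists (Num.truncn (m.+1%:R * x)).+1.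
split; last by rewrite -natr1 lerD2r.
split=> //; case: (Num.truncn _) lo => [|k] lo; [by left|right].
by apply: lt_le_trans lo; rewrite ltr_nat; lia.
Qed.

(** The intervals for x, y and b at scale [M] yield, after interval arithmetic for x + y * b, an
    interval inside the one from [l] to [u] at scale [m]. *)
Definition muladd_bounds (l u m M lx ux ly uy lb ub : nat) : Prop :=
  (l * (M.+1 * M.+1) <= m.+1 * (lx * M.+1 + ly * lb))%N /\
  (m.+1 * (ux * M.+1 + uy * ub) <= u * (M.+1 * M.+1))%N.

Lemma within_muladd_sound x y b l u m M lx ux ly uy lb ub :
  0 <= x -> 0 <= y -> 0 <= b -> muladd_bounds l u m M lx ux ly uy lb ub ->
  within lx ux M x -> within ly uy M y -> within lb ub M b -> within l u m (x + y * b).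
Proof.
move=> x0 y0 b0 [lo up] [lx1 ux1] [ly1 uy1] [lb1 ub1].
have := lo; have := up; rewrite -!(ler_nat R) !(natrM, natrD) => {}up lo'.
set k := m.+1%:R in lo' up *; set K := M.+1%:R in lo' up lx1 ux1 ly1 uy1 lb1 ub1.
have k0 : 0 < k by rewrite ltr0n. have K0 : 0 < K by rewrite ltr0n.
have KK0 : 0 < K * K by apply: mulr_gt0.
have wl (a : nat) z : 0 <= z -> (a = 0%N \/ a%:R < K * z) -> a%:R <= K * z.
  by move=> z0 [->|/ltW //]; apply: mulr_ge0 => //; apply: ltW.
split; last first.
  rewrite -(ltr_pM2r KK0); apply: lt_le_trans up.
  rewrite -mulrA ltr_pM2l // mulrDl.
  have -> : x * (K * K) = K * x * K by ring.
  have -> : y * b * (K * K) = (K * y) * (K * b) by ring.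
  apply: ltr_leD; first by rewrite ltr_pM2r.
  by apply: ler_pM; rewrite ?mulr_ge0 // ltW.
case: (posnP l) => [|l0]; [by left|right].
rewrite -(ltr_pM2r KK0); apply: (le_lt_trans lo').
rewrite -mulrA ltr_pM2l // mulrDl.
have -> : x * (K * K) = K * x * K by ring.
have -> : y * b * (K * K) = (K * y) * (K * b) by ring.
have [lxp|ylp] : (0 < lx)%N \/ (0 < ly * lb)%N.
  case: (posnP lx) => [lx0|]; [right|by left]; rewrite lt0n; apply/eqP => E0.
  by move: lo; rewrite lx0 E0 mul0n addn0 muln0 leqn0 !muln_eq0 (gtn_eqF l0).
- apply: ltr_leD.
    by rewrite ltr_pM2r //; case: lx1 lxp => // ->.
  by apply: ler_pM => //; apply: wl.
- apply: ler_ltD; first by rewrite ler_pM2r //; apply: wl.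
  move: ylp; rewrite muln_gt0 => /andP[lyp lbp].
  apply: ltr_pM => //; first by case: ly1 lyp => // ->.
  by case: lb1 lbp => // ->.
Qed.

(** At scale [M] the intervals have width about 1 / M, so the interval computed for x + y * b shrinks
    to this number. *)
Lemma within_muladd_complete x y b l u m : 0 <= x -> 0 <= y -> 0 <= b ->
  within l u m (x + y * b) -> exists M lx ux ly uy lb ub,
   [/\ muladd_bounds l u m M lx ux ly uy lb ub, within lx ux M x, within ly uy M y
     & within lb ub M b].
Proof.
move=> x0 y0 b0 [lo up].
set k := m.+1%:R in lo up; have k0 : 0 < k by rewrite ltr0n.
have yb0 : 0 <= y * b by rewrite mulr_ge0.
(* [c / M.+1] bounds the error of the computed interval. *)
pose c := k * (2 + 2 * y + 2 * b).
have c0 : 0 < c by rewrite mulr_gt0 //; lra.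
have big (d : R) : 0 < d -> exists M : nat, forall M', (M <= M')%N -> c < M'.+1%:R * d.
  move=> d0; have cd0 : 0 <= c / d by rewrite divr_ge0 // ltW.
  exists (Num.truncn (c / d)).+1 => M' HM'.
  have /andP[_ H] := truncn_itv cd0.
  by rewrite -ltr_pdivrMr //; apply: (lt_trans H); rewrite ltr_nat ltnS.
have [M1 HM1] := big (u%:R - k * (x + y * b)) ltac:(by rewrite subr_gt0).
have [M2 HM2] : exists M, l = 0%N \/ 
    forall M', (M <= M')%N -> c < M'.+1%:R * (k * (x + y * b) - l%:R).
  case: lo => [->|lo]; first by exists 0%N; left.
  by have [M HM] := big (k * (x + y * b) - l%:R) ltac:(by rewrite subr_gt0); exists M; right.
pose M := maxn M1 M2; have {}HM1 := HM1 M (leq_maxl _ _).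
have {}HM2 : l = 0%N \/ c < M.+1%:R * (k * (x + y * b) - l%:R).
  by case: HM2 => [|H]; [left|right; apply: H; apply: leq_maxr].
have [ux [wx uxz]] := within_approx M x0; have [uy [wy uyz]] := within_approx M y0.
have [ub [wb ubz]] := within_approx M b0.
exists M, (ux - 2)%N, ux, (uy - 2)%N, uy, (ub - 2)%N, ub; split=> //.
set K := M.+1%:R in HM1 HM2 uxz uyz ubz; have K0 : 1 <= K by rewrite ler1n.
have K0' : 0 <= K by rewrite ler0n.
have lower z v : within (v - 2) v M z -> K * z - 2 <= (v - 2)%:R.
  move=> [_ H]; have : (v <= v - 2 + 2)%N by rewrite addnC -leq_subLR.
  by rewrite -(ler_nat R) natrD; move: H; rewrite -/K; lra.
have {lower} [lxz lyz lbz] := And3 (lower _ _ wx) (lower _ _ wy) (lower _ _ wb).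
split; rewrite -(ler_nat R) !(natrM, natrD) -/k -/K.
  case: HM2 => [->|HM2].
    by rewrite mul0r mulr_ge0 ?addr_ge0 ?mulr_ge0 // ltW.
  have prod : K * K * (y * b) - 2 * K * (y + b) <= (uy - 2)%:R * (ub - 2)%:R.
    have Ky : 0 <= K * y by apply: mulr_ge0.
    have Kb : 0 <= K * b by apply: mulr_ge0.
    have a0 := ler0n R (uy - 2); have d0 := ler0n R (ub - 2).
    have -> : K * K * (y * b) - 2 * K * (y + b) =
        (K * y) * (K * b) - 2 * (K * y) - 2 * (K * b) by ring.
    case: (lerP 2 (K * y)) => Hy; last by have := mulr_ge0 a0 d0; nra.
    case: (lerP 2 (K * b)) => Hb; last by have := mulr_ge0 a0 d0; nra.
    apply: (@le_trans _ _ ((K * y - 2) * (K * b - 2))); first by lra.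
    by apply: ler_pM => //; lra.
  have sum : K * (K * (x + y * b) - 2 - 2 * (y + b)) <= (ux - 2)%:R * K + (uy - 2)%:R * (ub - 2)%:R.
    have : K * (K * x - 2) <= K * (ux - 2)%:R by apply: ler_wpM2l => //; lra.
    lra.
  have : k * (K * (K * (x + y * b) - 2 - 2 * (y + b))) <=
      k * ((ux - 2)%:R * K + (uy - 2)%:R * (ub - 2)%:R).
    by rewrite ler_pM2l.
  move=> H; apply: le_trans H.
  have : K * c <= K * (K * (k * (x + y * b) - l%:R)) by apply: ler_wpM2l => //; apply: ltW.
  rewrite /c; lra.
have prod : uy%:R * ub%:R <= (K * y + 1) * (K * b + 1) by apply: ler_pM.
have sum : ux%:R * K + uy%:R * ub%:R <= K * (K * (x + y * b) + 2 + y + b).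
  have : K * ux%:R <= K * (K * x + 1) by apply: ler_wpM2l => //; lra.
  lra.
have : k * (ux%:R * K + uy%:R * ub%:R) <=
    k * (K * (K * (x + y * b) + 2 + y + b)) by rewrite ler_pM2l.
move=> H; apply: (le_trans H).
have : K * c <= K * (K * (u%:R - k * (x + y * b))) by apply: ler_wpM2l => //; apply: ltW.
have : 0 <= k * K * (y + b) by rewrite !mulr_ge0 ?addr_ge0 // ltW.
rewrite /c; lra.
Qed.
End RealFunctions.

Local Open Scope ring_scope.

Section NonnegRE.
Variables (R : realType) (W : Type) (word : W -> seq bool).

(** The intervals around [F] at the point with variables [e 3], [e 4] and so on, their end points
    and scale being the variables 0, 1 and 2. *)
Definition nnre (F : W -> env -> R) : Prop :=
  (forall a e, 0 <= F a e) /\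
  re word (fun a e => within (e 0%N) (e 1%N) (e 2%N) (F a (fun i => e i.+3))).

Lemma nnre_ext F G : (forall a e, F a e = G a e) -> nnre F -> nnre G.
Proof.
move=> E [F0 HF]; split=> [a e|]; first by rewrite -E.
by apply: re_ext HF => a e; rewrite E.
Qed.

Lemma nnre_ren m F : nnre F -> nnre (fun a e => F a (fun i => e (m i))).
Proof.
move=> [F0 HF]; split=> // .
exact: (@re_ren _ _ (fun i => if i is j.+3 then (m j).+3 else i) _ HF).
Qed.

Lemma re_within F l u m : nnre F -> rfun word l -> rfun word u -> rfun word m ->
  re word (fun a e => within (l a e) (u a e) (m a e) (F a e)).
Proof.
move=> [_ HF] Hl Hu Hm.
apply: (re_let (Q := fun a y e => within (l a e) (u a e) y (F a e)) Hm).
apply: (re_let (Q := fun a y e => within (l a (lift e)) y (e 0%N) (F a (lift e)))).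
  exact: (@rfun_ren _ _ S _ Hu).
apply: (re_let (Q := fun a y e => within y (e 0%N) (e 1%N) (F a (lift (lift e))))).
  exact: (@rfun_ren _ _ (fun i => i.+2) _ Hl).
exact: HF.
Qed.

(** The intervals for x + y * b are those obtained by interval arithmetic from some intervals of the
    arguments. *)
Lemma nnre_muladd F G H : nnre F -> nnre G -> nnre H ->
  nnre (fun a e => F a e + G a e * H a e).
Proof.
move=> HF HG HH; have [F0 _] := HF; have [G0 _] := HG; have [H0 _] := HH.
split=> [a e|]; first by rewrite addr_ge0 ?mulr_ge0.
apply: (@re_ext _ _ (fun a e => exists M lx ux ly uy lb ub,
   muladd_bounds (e 0%N) (e 1%N) (e 2%N) M lx ux ly uy lb ub /\
   within lx ux M (F a (fun i => e i.+3)) /\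
   within ly uy M (G a (fun i => e i.+3)) /\
   within lb ub M (H a (fun i => e i.+3)))).
  move=> a e; split=> [[M [lx [ux [ly [uy [lb [ub [Hb [w1 [w2 w3]]]]]]]]]]|w].
    exact: within_muladd_sound Hb w1 w2 w3.
  have [M [lx [ux [ly [uy [lb [ub [Hb w1 w2 w3]]]]]]]] :=
    within_muladd_complete (F0 _ _) (G0 _ _) (H0 _ _) w.
  by exists M, lx, ux, ly, uy, lb, ub.
have HF' := @nnre_ren (fun i => i.+4.+4.+2) _ HF.
have HG' := @nnre_ren (fun i => i.+4.+4.+2) _ HG.
have HH' := @nnre_ren (fun i => i.+4.+4.+2) _ HH.
rewrite /muladd_bounds; do 7 (apply: re_ex; cbv beta delta [lift]).
apply: re_and; first by re_auto.
by apply: re_and; [|apply: re_and]; apply: re_within => //; re_fun.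
Qed.

Lemma nnre_rat n d : nnre (fun _ _ => n%:R / d.+1%:R).
Proof.
split=> [a e|]; first by rewrite divr_ge0.
apply: (@re_ext _ _ (fun a e => (e 0%N = 0%N \/ (e 0%N * d.+1 < (e 2%N).+1 * n)%N) /\
   ((e 2%N).+1 * n < e 1%N * d.+1)%N)); last by re_auto.
move=> a e; have d0 : 0 < d.+1%:R :> R by rewrite ltr0n.
by rewrite /within mulrA ltr_pdivlMr // ltr_pdivrMr // -!natrM !ltr_nat.
Qed.

Lemma nnre_nat n : nnre (fun _ _ => n%:R).
Proof. by apply: nnre_ext (nnre_rat n 0) => a e; rewrite divr1. Qed.

Lemma nnre_add F G : nnre F -> nnre G -> nnre (fun a e => F a e + G a e).
Proof.
move=> HF HG; apply: nnre_ext (nnre_muladd HF HG (nnre_nat 1)) => a e.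
by rewrite mulr1.
Qed.

Lemma nnre_mul F G : nnre F -> nnre G -> nnre (fun a e => F a e * G a e).
Proof.
move=> HF HG; apply: nnre_ext (nnre_muladd (nnre_nat 0) HF HG) => a e.
by rewrite add0r.
Qed.

(** A strict inequality is witnessed by a rational number in between. *)
Lemma re_ltr F G : nnre F -> nnre G -> re word (fun a e => F a e < G a e).
Proof.
move=> HF HG.
apply: (@re_ext _ _ (fun a e => exists m q l u, within l q m (F a e) /\ within q u m (G a e))).
  have [F0 _] := HF; have [G0 _] := HG.
  move=> a e; split=> [[m [q [l [u [[_ H1] [[q0|H2] _]]]]]]|H].
  - by move: H1; rewrite q0 ltNge mulr_ge0.
  - by have := lt_trans H1 H2; rewrite ltr_pM2l // ltr0n.
  - have d0 : 0 < G a e - F a e by rewrite subr_gt0.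
    pose m := Num.truncn (3 / (G a e - F a e)).
    have /andP[_ Hm] := truncn_itv (divr_ge0 (ler0n R 3) (ltW d0)).
    have {}Hm : 3 < m.+1%:R * (G a e - F a e) by rewrite -ltr_pdivrMr.
    have [uF [[lF wF] uF1]] := within_approx m (F0 a e).
    have [uG [[lG wG] _]] := within_approx m (G0 a e).
    have wmono : within uF uG m (G a e).
      split=> //; right; apply: (le_lt_trans uF1); lra.
    by exists m, uF, (uF - 2)%N, uG.
have HF' := @nnre_ren (fun i => i.+4) _ HF; have HG' := @nnre_ren (fun i => i.+4) _ HG.
do 4 (apply: re_ex; cbv beta delta [lift]).
by apply: re_and; apply: re_within => //; re_fun.
Qed.

(** Intervals with products of end points need nonnegative numbers; a signed function is carried as
    a difference, and ring operations on differences use only sums and products of the parts. *)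
Definition dre (F : W -> env -> R) : Prop :=
  exists G H, [/\ nnre G, nnre H & forall a e, F a e = G a e - H a e].

Lemma dre_ext F G : (forall a e, F a e = G a e) -> dre F -> dre G.
Proof. by move=> E [P [N [HP HN H]]]; exists P, N; split=> // a e; rewrite -E. Qed.

Lemma dre_nnre F : nnre F -> dre F.
Proof.
by move=> HF; exists F, (fun _ _ => 0%:R); split=> // [|a e]; [apply: nnre_nat|rewrite subr0].
Qed.

Lemma dre_nat n : dre (fun _ _ => n%:R).
Proof. exact: dre_nnre (nnre_nat n). Qed.

Lemma dre_opp F : dre F -> dre (fun a e => - F a e).
Proof. by move=> [P [N [HP HN H]]]; exists N, P; split=> // a e; rewrite H opprB. Qed.

Lemma dre_add F G : dre F -> dre G -> dre (fun a e => F a e + G a e).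
Proof.
move=> [P [N [HP HN H]]] [P' [N' [HP' HN' H']]].
exists (fun a e => P a e + P' a e), (fun a e => N a e + N' a e).
by split; [exact: nnre_add|exact: nnre_add|move=> a e; rewrite H H'; ring].
Qed.

Lemma dre_mul F G : dre F -> dre G -> dre (fun a e => F a e * G a e).
Proof.
move=> [P [N [HP HN H]]] [P' [N' [HP' HN' H']]].
exists (fun a e => P a e * P' a e + N a e * N' a e),
  (fun a e => P a e * N' a e + N a e * P' a e).
split; [by apply: nnre_add; apply: nnre_mul|by apply: nnre_add; apply: nnre_mul|].
by move=> a e; rewrite H H'; ring.
Qed.

Lemma dre_sum (I : Type) (r : seq I) (P : pred I) (F : I -> W -> env -> R) :
  (forall i, P i -> dre (F i)) -> dre (fun a e => \sum_(i <- r | P i) F i a e).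
Proof.
move=> HF; elim: r => [|i r IH].
  by apply: dre_ext (dre_nat 0) => a e; rewrite big_nil.
have [Pi|nPi] := boolP (P i).
  by apply: dre_ext (dre_add (HF i Pi) IH) => a e; rewrite big_cons Pi.
by apply: dre_ext IH => a e; rewrite big_cons (negbTE nPi).
Qed.

Lemma re_dre_ltr F G : dre F -> dre G -> re word (fun a e => F a e < G a e).
Proof.
move=> [P [N [HP HN H]]] [P' [N' [HP' HN' H']]].
apply: re_ext (re_ltr (nnre_add HP HN') (nnre_add HP' HN)) => a e.
by rewrite H H' ltrBlDr addrAC ltrBrDr.
Qed.

Definition dpoly (F : W -> env -> {poly R}) : Prop := forall r, dre (fun a e => (F a e)`_r).

Lemma dpoly_ext F G : (forall a e, F a e = G a e) -> dpoly F -> dpoly G.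
Proof. by move=> E HF r; apply: dre_ext (HF r) => a e; rewrite E. Qed.

Lemma dpolyC F : dre F -> dpoly (fun a e => (F a e)%:P).
Proof.
move=> HF [|r]; first by apply: dre_ext HF => a e; rewrite coefC.
by apply: dre_ext (dre_nat 0) => a e; rewrite coefC.
Qed.

Lemma dpolyX : dpoly (fun _ _ => 'X).
Proof. by move=> r; apply: dre_ext (dre_nat (r == 1%N)) => a e; rewrite coefX. Qed.

Lemma dpoly_opp F : dpoly F -> dpoly (fun a e => - F a e).
Proof. by move=> HF r; apply: dre_ext (dre_opp (HF r)) => a e; rewrite coefN. Qed.

Lemma dpoly_add F G : dpoly F -> dpoly G -> dpoly (fun a e => F a e + G a e).
Proof. by move=> HF HG r; apply: dre_ext (dre_add (HF r) (HG r)) => a e; rewrite coefD. Qed.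

Lemma dpoly_mul F G : dpoly F -> dpoly G -> dpoly (fun a e => F a e * G a e).
Proof.
move=> HF HG r; apply: dre_ext; first by move=> a e; rewrite coefM; reflexivity.
by apply: dre_sum => i _; apply: dre_mul.
Qed.

Lemma dpoly_sum (I : Type) (r : seq I) (P : pred I) (F : I -> W -> env -> {poly R}) :
  (forall i, P i -> dpoly (F i)) -> dpoly (fun a e => \sum_(i <- r | P i) F i a e).
Proof.
move=> HF k; apply: dre_ext; first by move=> a e; rewrite coef_sum; reflexivity.
by apply: dre_sum => i Pi; apply: HF.
Qed.

Lemma dpoly_prod (I : Type) (r : seq I) (F : I -> W -> env -> {poly R}) :
  (forall i, dpoly (F i)) -> dpoly (fun a e => \prod_(i <- r) F i a e).
Proof.
move=> HF; elim: r => [|i r IH].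
  by apply: dpoly_ext (dpolyC (dre_nat 1)) => a e; rewrite big_nil.
by apply: dpoly_ext (dpoly_mul (HF i) IH) => a e; rewrite big_cons.
Qed.

(** The coefficients are polynomials in the entries, by the Leibniz formula. *)
Lemma dpoly_char n (B : W -> env -> 'M[R]_n) :
  (forall i j, dre (fun a e => B a e i j)) -> dpoly (fun a e => char_poly (B a e)).
Proof.
move=> HB; rewrite /char_poly /determinant; apply: dpoly_sum => s _.
apply: dpoly_mul.
  case: (odd_perm s); last by apply: dpoly_ext (dpolyC (dre_nat 1)) => a e; rewrite expr0.
  by apply: dpoly_ext (dpoly_opp (dpolyC (dre_nat 1))) => a e; rewrite expr1.
apply: dpoly_prod => i.
apply: dpoly_ext; first by move=> a e; rewrite !mxE; reflexivity.
apply: dpoly_add; last by apply: dpoly_opp; apply: dpolyC.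
case: (i == s i); first exact: dpolyX.
by apply: dpoly_ext (dpolyC (dre_nat 0)) => a e; rewrite mulr0n.
Qed.

End NonnegRE.

(** * Computable reals from their descriptions *)
Section Described.
Variables (R : realType) (W : Type) (word : W -> seq bool).

(** An approximation of error less than [1 / k.+1] confirms the end points that it clears by this
    margin. *)
Lemma within_approxP (y : R) (r : nat -> R) l u m :
  (forall k, `|y - r k| < k.+1%:R^-1) ->
  within l u m (Num.max 0 y) <->
  exists k, [/\ l = 0%N \/ l%:R + m.+1%:R / k.+1%:R <= m.+1%:R * r k,
     m.+1%:R * r k + m.+1%:R / k.+1%:R <= u%:R & (0 < u)%N].
Proof.
move=> Hr; set c : R := m.+1%:R; have c0 : 0 < c by rewrite ltr0n.
have max0 : 0 <= Num.max 0 y by rewrite le_max lexx.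
have near k : c * r k - c / k.+1%:R < c * y /\ c * y < c * r k + c / k.+1%:R.
  have := Hr k; rewrite -mulrBr -mulrDr !ltr_pM2l // ltr_norml.
  by move: (k.+1%:R^-1) => v /andP[H1 H2]; split; lra.
split=> [[Hl Hu]|[k [Hl Hu u0]]]; last first.
  have [n1 n2] := near k; split; last first.
    by rewrite -/c maxr_pMr ?ltW // mulr0 gt_max ltr0n u0 (lt_le_trans n2 Hu).
  case: Hl => [|Hl]; [by left|right].
  apply: (@lt_le_trans _ _ (c * y)).
    by move: Hl n1; move: (c / _) => v; lra.
  by rewrite ler_pM2l // le_max lexx orbT.
rewrite -/c maxr_pMr ?ltW // mulr0 in Hl Hu.
move: Hu; rewrite gt_max => /andP[u0 Hu].
have big (d : R) : 0 < d -> exists k : nat, forall k', (k <= k')%N -> 2 * (c / k'.+1%:R) <= d.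
  move=> d0; have cd0 : 0 <= 2 * c / d by rewrite divr_ge0 ?mulr_ge0 // ltW.
  exists (Num.truncn (2 * c / d)) => k Hk; have /andP[_ H] := truncn_itv cd0.
  rewrite mulrA ler_pdivrMr ?ltr0n // [leRHS]mulrC -ler_pdivrMr //.
  by apply: ltW; apply: (lt_le_trans H); rewrite ler_nat.
have [k1 Hk1] := big (u%:R - c * y) ltac:(by rewrite subr_gt0).
have [k2 Hk2] : exists k, l = 0%N \/ forall k', (k <= k')%N -> 2 * (c / k'.+1%:R) <= c * y - l%:R.
  case: (posnP l) => [|l0]; first by exists 0%N; left.
  have {}Hl : l%:R < c * y.
    by case: Hl l0 => [->//|]; rewrite lt_max ltNge ler0n.
  by have [k Hk] := big (c * y - l%:R) ltac:(by rewrite subr_gt0); exists k; right.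
exists (maxn k1 k2); have [n1 n2] := near (maxn k1 k2).
have {}Hk1 := Hk1 _ (leq_maxl k1 k2); split; last by rewrite ltr0n in u0.
- case: Hk2 => [|Hk2]; [by left|right].
  by move: (Hk2 _ (leq_maxr k1 k2)) n2; move: (c / _) => v; lra.
- by move: Hk1 n1; move: (c / _) => v; lra.
Qed.

(** The two margin conditions for the approximation [p / q] or [- p / q], cleared of
    denominators. *)
Definition half_bounds (l u m k p q : nat) (neg : bool) : Prop :=
  if neg then
    l = 0%N /\ (q * m.+1 <= u * (q * k.+1) + p * (m.+1 * k.+1))%N
  else
    (l = 0%N \/ (l * (q * k.+1) + q * m.+1 <= p * (m.+1 * k.+1))%N) /\
    (p * (m.+1 * k.+1) + q * m.+1 <= u * (q * k.+1))%N.

Lemma half_boundsP l u m k p q (neg : bool) : (0 < q)%N ->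
  half_bounds l u m k p q neg <->
  (l = 0%N \/ l%:R + m.+1%:R / k.+1%:R <= m.+1%:R * ((-1) ^+ neg * (p%:R / q%:R)) :> R) /\
  m.+1%:R * ((-1) ^+ neg * (p%:R / q%:R)) + m.+1%:R / k.+1%:R <= u%:R :> R.
Proof.
move=> q0; have Q0 : 0 < q%:R :> R by rewrite ltr0n.
have K0 : 0 < k.+1%:R :> R by rewrite ltr0n.
have QK0 : 0 < q%:R * k.+1%:R :> R by rewrite mulr_gt0.
have M0 : 0 < m.+1%:R :> R by rewrite ltr0n.
rewrite /half_bounds; case: neg; rewrite ?expr1 ?expr0 ?mulN1r ?mul1r; last first.
  rewrite -!(ler_nat R) !(natrD, natrM).
  rewrite -(ler_pM2r QK0 (_ + _) (m.+1%:R * _)) -(ler_pM2r QK0 _ u%:R) !mulrDl.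
  have -> : m.+1%:R / k.+1%:R * (q%:R * k.+1%:R) = q%:R * m.+1%:R :> R.
    by field; rewrite !lt0r_neq0.
  have -> // : m.+1%:R * (p%:R / q%:R) * (q%:R * k.+1%:R) = p%:R * (m.+1%:R * k.+1%:R) :> R.
  by field; rewrite !lt0r_neq0.
rewrite -!(ler_nat R) !(natrD, natrM) -(ler_pM2r QK0 _ u%:R) !mulrDl.
have -> : m.+1%:R / k.+1%:R * (q%:R * k.+1%:R) = q%:R * m.+1%:R :> R.
  by field; rewrite !lt0r_neq0.
have -> : m.+1%:R * - (p%:R / q%:R) * (q%:R * k.+1%:R) = - (p%:R * (m.+1%:R * k.+1%:R)) :> R.
  by field; rewrite !lt0r_neq0.
rewrite (addrC (- _)) lerBlDr; split=> [[-> H]|[Hl H]]; first by split; [left|].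
split=> //; case: Hl => // H1; exfalso; move: H1; apply/negP; rewrite -ltNge.
apply: (@le_lt_trans _ _ 0); first by rewrite mulrN oppr_le0 mulr_ge0 // divr_ge0.
by apply: ltr_wpDl => //; rewrite divr_gt0.
Qed.

(** With both signs this covers the positive and the negative part of a described real. The weaker
    error bound 1 / k.+1 in place of 2 ^- k avoids powers of 2 in the formula. *)
Lemma describes_nnre (x : W -> R) (d : W -> real_desc) (neg : bool) :
  (forall a, describes (d a) (x a)) ->
  rfun word (fun a _ => rcode (rd_num (d a))) ->
  rfun word (fun a _ => rcode (rd_den (d a))) ->
  rfun word (fun a _ => rcode (rd_sgn (d a))) ->
  nnre word (fun a _ => Num.max 0 ((-1) ^+ neg * x a)).
Proof.
move=> Hd Hn Hq Hs; split=> [a e|]; first by rewrite le_max lexx.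
apply: (@re_ext _ _ (fun a e => exists k p q s,
   evaluates (fact 0 (rcode (rd_num (d a))) (cpair k 0).+1 p) /\
   evaluates (fact 0 (rcode (rd_den (d a))) (cpair k 0).+1 q) /\
   evaluates (fact 0 (rcode (rd_sgn (d a))) (cpair k 0).+1 s) /\
   (0 < e 1%N)%N /\
   ((exists h, (s + neg = h + h)%N /\ half_bounds (e 0%N) (e 1%N) (e 2%N) k p q false) \/
    (exists h, (s + neg = (h + h).+1)%N /\ half_bounds (e 0%N) (e 1%N) (e 2%N) k p q true))));
  last first.
  rewrite /half_bounds.
  have ev c : rfun word (fun a _ => c a) -> forall k p,
      re word (fun a e => evaluates (fact 0 (c a) (cpair (e k) 0).+1 (e p))).
    by move=> Hc k p; apply: re_evaluates; rewrite /fact; re_fun.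
  do 4 (apply: re_ex; cbv beta delta [lift]).
  do 3 (apply: re_and; first exact: ev).
  by re_auto.
move=> a e; have [num [den [sgn [Hnum Hden Hsgn den0 Happ]]]] := Hd a.
have valE p f k v : computes p f ->
    evaluates (fact 0 (rcode p) (cpair k 0).+1 v) <-> v = f k.
  move=> Hp; rewrite (evaluatesP p [:: k] v); split=> [H|->]; last exact: Hp.
  exact: reval_fun H (Hp k).
pose r k : R := (-1) ^+ neg * ((-1) ^+ sgn k * ((num k)%:R / (den k)%:R)).
rewrite (@within_approxP _ r); last first.
  move=> k; rewrite /r -mulrBr normrM normrX normrN1 expr1n mul1r.
  apply: lt_le_trans (Happ k) _; rewrite lef_pV2 ?posrE ?ltr0n ?exprn_gt0 //.
  by rewrite -natrX ler_nat ltn_expl.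
have rE k : r k = (-1) ^+ odd (sgn k + neg) * ((num k)%:R / (den k)%:R).
  by rewrite /r mulrA -exprD addnC signr_odd.
split=> [[k [p [q [s [Hp [Hq' [Hs' [u0 H]]]]]]]]|[k [H1 H2 u0]]].
  move/(valE _ _ _ _ Hnum): Hp => Ep; move/(valE _ _ _ _ Hden): Hq' => Eq.
  move/(valE _ _ _ _ Hsgn): Hs' => Es; exists k.
  have q0 : (0 < q)%N by rewrite Eq lt0n.
  have [neg' Ho Hb] : exists2 neg' : bool, odd (s + neg) = neg' &
      half_bounds (e 0%N) (e 1%N) (e 2%N) k p q neg'.
    case: H => -[h [E Hb]]; rewrite E; [exists false|exists true] => //=;
      by rewrite addnn odd_double.
  by move/(half_boundsP _ _ _ _ _ _ q0): Hb => [Hl Hu]; rewrite rE -Es Ho -Ep -Eq.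
exists k, (num k), (den k), (sgn k).
split; first by apply/(valE _ _ _ _ Hnum).
split; first by apply/(valE _ _ _ _ Hden).
split; first by apply/(valE _ _ _ _ Hsgn).
split=> //.
have q0 : (0 < den k)%N by rewrite lt0n.
have Hb : half_bounds (e 0%N) (e 1%N) (e 2%N) k (num k) (den k) (odd (sgn k + neg)).
  by apply/(half_boundsP _ _ _ _ _ _ q0); rewrite -rE.
have := odd_double_half (sgn k + neg); case: (odd _) Hb => Hb Eh; [right|left];
  by exists (half (sgn k + neg)); split=> //; rewrite addnn -[LHS]Eh.
Qed.

End Described.

(** * Powers of matrices *)
Section MatrixPower.
Variables (R : realType) (W : Type) (word : W -> seq bool) (n : nat).
Variable B : W -> 'M[R]_n.
Hypothesis HB : forall i j, nnre word (fun a _ => B a i j).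
Variable i : 'I_n.

(** The entry in row [i] and column [j] of the power [k.+1], with the summation stopped before [l]:
    a single step of the recursion on [l] involves two earlier values, which fits rules with two
    premises. *)
Definition partial_sum (a : W) (k : nat) (j : 'I_n) (l : nat) : R :=
  \sum_(c < n | (c < l)%N) (B a ^+ k) i c * B a c j.

Lemma partial_sum_full a k j : partial_sum a k j n = (B a ^+ k.+1) i j.
Proof.
rewrite exprSr !mxE; apply: eq_bigl => c; exact: ltn_ord.
Qed.

Lemma partial_sum0 a k j : partial_sum a k j 0 = 0.
Proof. by rewrite /partial_sum big_pred0. Qed.

Lemma partial_sumS a k j (c : 'I_n) :
  partial_sum a k j c.+1 = partial_sum a k j c + (B a ^+ k) i c * B a c j.
Proof.
rewrite /partial_sum (bigD1 c) ?ltnSn //= addrC; congr (_ + _); apply: eq_bigl => d.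
by rewrite ltnS ltn_neqAle andbC.
Qed.

Lemma partial_sum_base a j l :
  partial_sum a 0 j l = if (i < l)%N then B a i j else 0.
Proof.
rewrite /partial_sum expr0; case: ifP => Hil.
  rewrite (bigD1 i) //= big1 ?addr0 => [|c /andP[_ ci]]; rewrite mxE ?eqxx ?mul1r //.
  by rewrite eq_sym (negbTE ci) mul0r.
rewrite big1 // => c cl; rewrite mxE; case: eqP => [ic|]; last by rewrite mul0r.
by rewrite -ic Hil in cl.
Qed.

Lemma B_ge0 a c j : 0 <= B a c j.
Proof. by have [H _] := HB c j; apply: (H a (fun _ => 0%N)). Qed.

Lemma powB_ge0 a k c j : 0 <= (B a ^+ k) c j.
Proof.
elim: k c j => [|k IH] c j; first by rewrite expr0 mxE ler0n.
by rewrite exprSr mxE sumr_ge0 // => d _; rewrite mulr_ge0 ?B_ge0.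
Qed.

Lemma partial_sum_ge0 a k j l : 0 <= partial_sum a k j l.
Proof.
by rewrite sumr_ge0 // => c _; rewrite mulr_ge0 ?powB_ge0 ?B_ge0.
Qed.

Definition sum_fact (k j c l u m : nat) : nat :=
  cpair k (cpair j (cpair c (cpair l (cpair u m)))).

Lemma sum_fact_inj k j c l u m k' j' c' l' u' m' :
  sum_fact k j c l u m = sum_fact k' j' c' l' u' m' ->
  [/\ k = k', j = j', c = c' & [/\ l = l', u = u' & m = m']].
Proof.
by move=> /cpair_inj[-> /cpair_inj[-> /cpair_inj[-> /cpair_inj[-> /cpair_inj[-> ->]]]]].
Qed.

(** The axioms are the empty sums and the index [k = 0], where the sum has at most one nonzero
    term. *)
Definition sum_axiom (a : W) (t : nat) : Prop :=
  (exists k j l u m, t = sum_fact k j 0 l u m /\ within l u m (0%:R : R)) \/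
  (exists j c l u m, (c <= i)%N /\ t = sum_fact 0 j c l u m /\ within l u m (0%:R : R)) \/
  (exists (j : 'I_n) c l u m, (i < c)%N /\ t = sum_fact 0 j c l u m /\ within l u m (B a i j)).

Definition sum_rule (a : W) (t p q : nat) : Prop :=
  exists (c j : 'I_n) k l u m M lx ux ly uy lb ub,
    t = sum_fact k.+1 j c.+1 l u m /\ p = sum_fact k.+1 j c lx ux M /\
    q = sum_fact k c n ly uy M /\ within lb ub M (B a c j) /\
    muladd_bounds l u m M lx ux ly uy lb ub.

Lemma sum_derives_sound a t : derives (sum_axiom a) (sum_rule a) t ->
  forall k (j : 'I_n) c l u m, t = sum_fact k j c l u m -> within l u m (partial_sum a k j c).
Proof.
elim=> {t} [t H|t p q H _ IHp _ IHq] k j c l u m Et.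
  move: H; rewrite {}Et.
  case=> [[k' [j' [l' [u' [m' [/sum_fact_inj[Ek Ej Ec [-> -> ->]]]]]]]]|
    [[j' [c' [l' [u' [m' [lec [/sum_fact_inj[Ek Ej Ec [-> -> ->]]]]]]]]]|
     [j' [c' [l' [u' [m' [ltc [/sum_fact_inj[Ek Ej Ec [-> -> ->]]]]]]]]]]].
  - by rewrite Ec partial_sum0.
  - by rewrite Ek partial_sum_base Ec ltnNge lec.
  - by rewrite Ek partial_sum_base Ec ltc; have -> : j = j' by apply: val_inj.
move: H; rewrite {}Et => -[d [j' [k' [l' [u' [m' [M [lx [ux [ly [uy [lb [ub]]]]]]]]]]]]].
move=> [/sum_fact_inj[-> Ej -> [-> -> ->]] [Ep [Eq [wb bd]]]].
have -> : j = j' by apply: val_inj.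
rewrite partial_sumS; apply: within_muladd_sound bd _ _ wb.
- exact: partial_sum_ge0.
- exact: powB_ge0.
- exact: B_ge0.
- exact: IHp Ep.
- by rewrite -partial_sum_full; apply: IHq Eq.
Qed.

Lemma sum_derives_complete a k (j : 'I_n) c l u m : (c <= n)%N ->
  within l u m (partial_sum a k j c) ->
  derives (sum_axiom a) (sum_rule a) (sum_fact k j c l u m).
Proof.
elim: k j c l u m => [|k IHk] j c l u m.
  move=> _; rewrite partial_sum_base; case: ltnP => Hic Hw; apply: derives_ax; right.
    by right; exists j, c, l, u, m.
  by left; exists j, c, l, u, m.
elim: c l u m => [|c IHc] l u m Hc.
  by rewrite partial_sum0 => Hw; apply: derives_ax; left; exists k.+1, j, l, u, m.
rewrite (partial_sumS a k.+1 j (Ordinal Hc)) => Hw.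
have [M [lx [ux [ly [uy [lb [ub [bd w1 w2 w3]]]]]]]] :=
  within_muladd_complete (partial_sum_ge0 _ _ _ _) (powB_ge0 _ _ _ _) (B_ge0 _ _ _) Hw.
rewrite -partial_sum_full in w2.
apply: derives_rule (IHc _ _ _ (ltnW Hc) w1) (IHk _ _ _ _ _ (leqnn n) w2).
by exists (Ordinal Hc), j, k, l, u, m, M, lx, ux, ly, uy, lb, ub.
Qed.

(** The exponent is a variable of the formula, hence the need for an inductive definition. *)
Lemma nnre_pow j v : nnre word (fun a e => (B a ^+ (e v).+1) i j).
Proof.
split=> [a e|]; first exact: powB_ge0.
apply: (@re_ext _ _ (fun a e => derives (sum_axiom a) (sum_rule a)
  (sum_fact (e v.+3) j n (e 0%N) (e 1%N) (e 2%N)))).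
  move=> a e; rewrite -partial_sum_full; split=> H.
    exact: sum_derives_sound H _ _ _ _ _ _ erefl.
  exact: sum_derives_complete.
have H0 := nnre_nat R word 0.
apply: re_derives; rewrite /sum_axiom /sum_rule /sum_fact; last by re_fun.
  apply: re_or.
    do 5 (apply: re_ex; cbv beta delta [lift]); apply: re_and; first by re_auto.
    by apply: re_within => //; re_fun.
  apply: re_or.
    do 5 (apply: re_ex; cbv beta delta [lift]); apply: re_and; first by re_auto.
    by apply: re_and; [re_auto|apply: re_within => //; re_fun].
  apply: re_ex_fin => j'.
  do 4 (apply: re_ex; cbv beta delta [lift]); apply: re_and; first by re_auto.
  by apply: re_and; [re_auto|apply: re_within => //; re_fun].
apply: re_ex_fin => c; apply: re_ex_fin => j'.
do 11 (apply: re_ex; cbv beta delta [lift]).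
do 3 (apply: re_and; first by re_auto).
apply: re_and; first by apply: re_within => //; re_fun.
by rewrite /muladd_bounds; re_auto.
Qed.

End MatrixPower.

(** The block matrix B of rows (P, N) and (N, P) satisfies B C = C (P - N) for the column C of blocks
    1 and -1, hence B^k C = C (P - N)^k. *)
Lemma block_power (R : comRingType) n (P N : 'M[R]_n) k i j :
  ((P - N) ^+ k) i j = (block_mx P N N P ^+ k) (lshift n i) (lshift n j)
    - (block_mx P N N P ^+ k) (lshift n i) (rshift n j).
Proof.
set B := block_mx P N N P; pose C : 'M[R]_(n + n, n) := col_mx 1%:M (- 1%:M).
have BC : B *m C = C *m (P - N).
  rewrite /B /C mul_block_col mul_col_mx !mulmx1 !mulmxN !mulmx1 mul1mx mulNmx mul1mx.
  by rewrite opprB.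
have BkC : (B ^+ k) *m C = C *m (P - N) ^+ k.
  elim: k => [|k IH]; first by rewrite !expr0 mul1mx mulmx1.
  by rewrite exprS -mulmxA IH mulmxA BC -mulmxA [in RHS]exprS.
have := congr1 (fun M : 'M[R]_(n + n, n) => M (lshift n i) j) BkC.
rewrite /C mul_col_mx mul1mx col_mxEu => <-.
rewrite -[B ^+ k in LHS]submxK mul_block_col !mulmx1 !mulmxN !mulmx1 col_mxEu !mxE.
by [].
Qed.

(** A matrix A of signed entries is the difference of its positive and negative parts, and the powers
    of A are read off those of a nonnegative block matrix. *)
Lemma dpoly_char_pow (R : realType) (W : Type) (word : W -> seq bool) n (A : W -> 'M[R]_n) v :
  (forall i j, nnre word (fun a _ => Num.max 0 (A a i j))) ->
  (forall i j, nnre word (fun a _ => Num.max 0 (- A a i j))) ->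
  dpoly word (fun a e => char_poly (A a ^+ (e v).+1)).
Proof.
move=> HP HN; apply: dpoly_char => i j.
pose P a : 'M[R]_n := \matrix_(i, j) Num.max 0 (A a i j).
pose N a : 'M[R]_n := \matrix_(i, j) Num.max 0 (- A a i j).
have AE a : A a = P a - N a.
  apply/matrixP => k l; rewrite !mxE.
  case: (lerP 0 (A a k l)) => H.
    by rewrite max_l ?oppr_le0 // subr0.
  by rewrite max_r ?oppr_ge0 ?ltW // sub0r opprK.
pose B a := block_mx (P a) (N a) (N a) (P a).
have HB k l : nnre word (fun a _ => B a k l).
  have HPx x y : nnre word (fun a _ => P a x y).
    by apply: nnre_ext (HP x y) => a e; rewrite mxE.
  have HNx x y : nnre word (fun a _ => N a x y).
    by apply: nnre_ext (HN x y) => a e; rewrite mxE.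
  case: (split_ordP k) => k' ->; case: (split_ordP l) => l' ->.
  - by apply: nnre_ext (HPx k' l') => a e; rewrite block_mxEul.
  - by apply: nnre_ext (HNx k' l') => a e; rewrite block_mxEur.
  - by apply: nnre_ext (HNx k' l') => a e; rewrite block_mxEdl.
  - by apply: nnre_ext (HPx k' l') => a e; rewrite block_mxEdr.
exists (fun a e => (B a ^+ (e v).+1) (lshift n i) (lshift n j)),
  (fun a e => (B a ^+ (e v).+1) (lshift n i) (rshift n j)).
by split=> [||a e]; [exact: nnre_pow|exact: nnre_pow|rewrite AE block_power].
Qed.

(** * The product of the large roots of a polynomial *)
Section Mahler.
Variable R : realType.
Implicit Types (z : R[i]) (s : seq R[i]).

Lemma modulusE z : `|z| = (modulus z)%:C%C.
Proof. by rewrite /modulus normc_def. Qed.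

Lemma modulus_ge0 z : 0 <= modulus z.
Proof. by rewrite -lecR -modulusE normr_ge0. Qed.

Lemma modulusM z1 z2 : modulus (z1 * z2) = modulus z1 * modulus z2.
Proof. by apply: complexI; rewrite rmorphM /= -!modulusE normrM. Qed.

Lemma modulusX z k : modulus (z ^+ k) = modulus z ^+ k.
Proof. by apply: complexI; rewrite rmorphXn /= -!modulusE normrX. Qed.

Lemma modulus1 : modulus (1 : R[i]) = 1.
Proof. by apply: complexI; rewrite -modulusE normr1. Qed.

Lemma modulus0 : modulus (0 : R[i]) = 0.
Proof. by apply: complexI; rewrite -modulusE normr0. Qed.

Lemma modulusB z1 z2 : modulus (z1 - z2) <= modulus z1 + modulus z2.
Proof. by rewrite -lecR rmorphD /= -!modulusE ler_normB. Qed.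

Lemma modulusB_ge z1 z2 : modulus z1 - modulus z2 <= modulus (z1 - z2).
Proof. by rewrite -lecR rmorphB /= -!modulusE lerB_dist. Qed.

Lemma modulusR (x : R) : modulus x%:C%C = `|x|.
Proof.
by apply: complexI; rewrite -modulusE normc_def /= expr0n /= addr0 sqrtr_sqr.
Qed.

(** The Mahler measure of the monic polynomial with roots [s]. *)
Definition mahler s : R := \prod_(z <- s | 1 <= modulus z) modulus z.

Definition power_poly s k : {poly R[i]} := \prod_(z <- s) ('X - (z ^+ k)%:P).

Lemma mahler_ge1 s : 1 <= mahler s.
Proof.
rewrite /mahler; elim/big_ind: _ => // x y Hx Hy.
by rewrite -[1]mulr1 ler_pM.
Qed.

Lemma mahler_cons z s :
  mahler (z :: s) = (if 1 <= modulus z then modulus z else 1) * mahler s.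
Proof. by rewrite /mahler big_cons; case: ifP; rewrite ?mul1r. Qed.

Lemma power_poly_coef z s k i :
  (power_poly (z :: s) k)`_i =
  (if i is j.+1 then (power_poly s k)`_j else 0) - z ^+ k * (power_poly s k)`_i.
Proof.
by rewrite /power_poly big_cons mulrBl coefB coefXM coefCM; case: i.
Qed.

(** Up to sign, a coefficient is a sum of at most [2 ^ size s] products of distinct roots. *)
Lemma power_poly_upper s k i :
  modulus (power_poly s k)`_i <= 2 ^+ size s * mahler s ^+ k.
Proof.
elim: s i => [|z s IH] i.
  rewrite /power_poly big_nil coef1 /mahler big_nil expr1n expr0 mulr1.
  by case: (i == 0%N); rewrite ?modulus1 ?modulus0.
rewrite power_poly_coef mahler_cons exprMn; set B := 2 ^+ size s * mahler s ^+ k.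
have B0 : 0 <= B by rewrite mulr_ge0 ?exprn_ge0 // (le_trans ler01) // mahler_ge1.
set q := if _ then _ else _.
have q1 : 1 <= q by rewrite /q; case: ifP.
have zq : modulus z <= q by rewrite /q; case: ifP => // /negbT; rewrite -ltNge => /ltW.
have qk1 : 1 <= q ^+ k by apply: exprn_ege1.
have -> : 2 ^+ size (z :: s) * (q ^+ k * mahler s ^+ k) = q ^+ k * B + q ^+ k * B.
  by rewrite /B /= exprS; ring.
apply: (le_trans (modulusB _ _)); apply: lerD.
  apply: (@le_trans _ _ B); last by apply: ler_peMl.
  by case: i => [|j]; [rewrite modulus0|apply: IH].
rewrite modulusM modulusX; apply: ler_pM; rewrite ?exprn_ge0 ?modulus_ge0 //.
by apply: lerXn2r; rewrite ?nnegrE ?modulus_ge0 // (le_trans ler01).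
Qed.

Definition small_count s : nat := count (fun z => modulus z < 1) s.

(** The coefficient of index [small_count s] is, up to sign, the sum of the products of as many roots
    as there are large ones. One term is the product of all the large roots; every other contains a
    small root. Below this index every term contains a small root, which the induction needs. *)
Lemma power_poly_dominant s (rho : R) k : 0 <= rho ->
  (forall z, z \in s -> modulus z < 1 -> modulus z <= rho) ->
  (forall i, (i < small_count s)%N ->
     modulus (power_poly s k)`_i <= 2 ^+ size s * (rho ^+ k * mahler s ^+ k)) /\
  mahler s ^+ k - 2 ^+ size s * (rho ^+ k * mahler s ^+ k) <=
     modulus (power_poly s k)`_(small_count s).
Proof.
move=> rho0; elim: s => [|z s IH] Hs.
  split=> //; rewrite /small_count /= /power_poly big_nil coef1 eqxx modulus1.
  rewrite /mahler big_nil expr1n mulr1 expr0 mul1r.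
  by rewrite lerBlDr lerDl exprn_ge0.
have Hs' y : y \in s -> modulus y < 1 -> modulus y <= rho.
  by move=> ys; apply: Hs; rewrite inE ys orbT.
have {Hs'} [{}IH IH1] := IH Hs'.
have M1 : 1 <= mahler s ^+ k by apply: exprn_ege1; apply: mahler_ge1.
set B := 2 ^+ size s * (rho ^+ k * mahler s ^+ k) in IH IH1.
have B0 : 0 <= B by rewrite !mulr_ge0 ?exprn_ge0 // (le_trans ler01) // mahler_ge1.
have sizeS : 2 ^+ size (z :: s) = 2 * 2 ^+ size s :> R by rewrite /= exprS.
rewrite mahler_cons sizeS /small_count /= -/(small_count s).
case: (lerP 1 (modulus z)) => Hz /=.
  rewrite add0n exprMn; set q := modulus z ^+ k.
  have q1 : 1 <= q by apply: exprn_ege1.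
  have E : 2 * 2 ^+ size s * (rho ^+ k * (q * mahler s ^+ k)) = q * B + q * B by rewrite /B; ring.
  have Bq : B <= q * B by apply: ler_peMl.
  have below i : (i < small_count s)%N ->
      modulus (if i is j.+1 then (power_poly s k)`_j else 0) <= B.
    by case: i => [|j] Hi; [rewrite modulus0|apply: IH; apply: ltnW].
  rewrite E; split=> [i Hi|].
    rewrite power_poly_coef; apply: (le_trans (modulusB _ _)); apply: lerD.
      exact: le_trans (below i Hi) Bq.
    by rewrite modulusM modulusX ler_wpM2l ?IH // (le_trans ler01).
  rewrite power_poly_coef -(opprB (z ^+ k * _)).
  have -> (x : R[i]) : modulus (- x) = modulus x by apply: complexI; rewrite -!modulusE normrN.
  apply: le_trans (modulusB_ge _ _); rewrite modulusM modulusX -/q.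
  have H1 : q * (mahler s ^+ k - B) <= q * modulus (power_poly s k)`_(small_count s).
    by rewrite ler_wpM2l // (le_trans ler01).
  have H2 : modulus (if small_count s is j.+1 then (power_poly s k)`_j else 0) <= B.
    case E' : (small_count s) => [|j]; first by rewrite modulus0.
    by apply: IH; rewrite E'.
  by move: H1 H2 Bq; rewrite mulrBr; lra.
rewrite mul1r add1n; have zr : modulus z ^+ k <= rho ^+ k.
  by apply: lerXn2r; rewrite ?nnegrE ?modulus_ge0 //; apply: Hs => //; rewrite mem_head.
have zB i : modulus (z ^+ k * (power_poly s k)`_i) <= B.
  rewrite modulusM modulusX /B mulrCA; apply: ler_pM; rewrite ?exprn_ge0 ?modulus_ge0 //.
  exact: power_poly_upper.
have -> : 2 * 2 ^+ size s * (rho ^+ k * mahler s ^+ k) = B + B by rewrite /B; ring.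
split=> [i Hi|].
  rewrite power_poly_coef; apply: (le_trans (modulusB _ _)); apply: lerD => //.
  by case: i Hi => [|j] Hj; [rewrite modulus0|apply: IH].
rewrite power_poly_coef; apply: le_trans (modulusB_ge _ _).
by move: IH1 (zB (small_count s).+1); lra.
Qed.

Lemma pow_unbounded (q b : R) : 1 < q -> exists N, forall k, (N <= k)%N -> b < q ^+ k.
Proof.
move=> q1; have d0 : 0 < q - 1 by rewrite subr_gt0.
have bern k : 1 + k%:R * (q - 1) <= q ^+ k.
  elim: k => [|k IH]; first by rewrite mul0r addr0 expr0.
  rewrite exprS; apply: (@le_trans _ _ (q * (1 + k%:R * (q - 1)))).
    have : 0 <= k%:R * (q - 1) * (q - 1) by rewrite !mulr_ge0 ?ler0n ?ltW.
    by rewrite -natr1; nra.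
  by rewrite ler_wpM2l // (le_trans ler01) // ltW.
pose N := (Num.truncn (`|b| / (q - 1))).+1; exists N => k Hk.
apply: lt_le_trans (bern k).
have /andP[_ H] := truncn_itv (divr_ge0 (normr_ge0 b) (ltW d0)).
have : `|b| < k%:R * (q - 1).
  by rewrite -ltr_pdivrMr //; apply: (lt_le_trans H); rewrite ler_nat.
by have := ler_norm b; lra.
Qed.

(** The constant [2 ^ size s] disappears in the k-th root as k grows. *)
Lemma mahler_gtP s (c : R) : 0 < c ->
  c < mahler s <-> exists k i, 2 ^+ size s * c ^+ k.+1 < modulus (power_poly s k.+1)`_i.
Proof.
move=> c0; have M1 := mahler_ge1 s; split=> [cM|[k [i H]]]; last first.
  have := lt_le_trans H (power_poly_upper s k.+1 i).
  by rewrite ltr_pM2l ?exprn_gt0 // ltr_pXn2r ?nnegrE ?ltW // (lt_le_trans _ M1).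
have [rho [rho0 rho1 Hrho]] : exists rho : R, [/\ 0 < rho, rho < 1 &
    forall z, z \in s -> modulus z < 1 -> modulus z <= rho].
  elim: s {cM M1} => [|z s [rho [rho0 rho1 Hrho]]]; first by exists (1 / 2); split=> //; lra.
  case: (lerP 1 (modulus z)) => Hz.
    exists rho; split=> // y; rewrite inE => /predU1P[->|]; last exact: Hrho.
    by rewrite ltNge Hz.
  exists (Num.max rho (modulus z)); split; rewrite ?lt_max ?rho0 ?gt_max ?rho1 //.
  move=> y; rewrite inE => /predU1P[-> _|ys y1]; first by rewrite le_max lexx orbT.
  by rewrite le_max Hrho.
have q1 : 1 < rho^-1 by rewrite invf_gt1.
have q2 : 1 < mahler s / c by rewrite ltr_pdivlMr ?mul1r.
have [N1 H1] := pow_unbounded (2 * 2 ^+ size s) q1.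
have [N2 H2] := pow_unbounded (2 * 2 ^+ size s) q2.
pose k := maxn N1 N2; exists k, (small_count s).
have {}H1 := H1 k.+1 (leqW (leq_maxl _ _)); have {}H2 := H2 k.+1 (leqW (leq_maxr _ _)).
have [_ H] := power_poly_dominant k.+1 (ltW rho0) Hrho; apply: lt_le_trans H.
have rk0 : 0 < rho ^+ k.+1 by rewrite exprn_gt0.
have ck0 : 0 < c ^+ k.+1 by rewrite exprn_gt0.
rewrite exprVn -[_^-1]mul1r ltr_pdivlMr // in H1.
rewrite expr_div_n ltr_pdivlMr // in H2.
have : 1 <= mahler s ^+ k.+1 by apply: exprn_ege1.
move: H1 H2; set r := rho ^+ _; set M := mahler s ^+ _; set C := c ^+ _; set K := 2 ^+ _.
move=> H1 H2 M0; have : 2 * K * r * M <= M by rewrite ler_piMl ?ltW // (lt_le_trans ltr01).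
lra.
Qed.

End Mahler.

Lemma char_poly_conj (F : fieldType) n (P A : 'M[F]_n) : P \in unitmx ->
  char_poly (P *m A *m invmx P) = char_poly A.
Proof.
move=> uP; rewrite /char_poly.
have PP : map_mx polyC P *m map_mx polyC (invmx P) = 1%:M.
  by rewrite -map_mxM mulmxV // map_mx1.
have -> : char_poly_mx (P *m A *m invmx P) =
    map_mx polyC P *m char_poly_mx A *m map_mx polyC (invmx P).
  rewrite /char_poly_mx !map_mxM mulmxBr mulmxBl scalar_mxC -(mulmxA 'X%:M) PP.
  by rewrite mulmx1.
by rewrite !det_mulmx mulrAC -det_mulmx PP det1 mul1r.
Qed.

Section CharPolyPower.
Variables (C : numClosedFieldType).

Lemma trig_mul n (T U : 'M[C]_n) : is_trig_mx T -> is_trig_mx U ->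
  is_trig_mx (T *m U) /\ forall i, (T *m U) i i = T i i * U i i.
Proof.
move=> /is_trig_mxP HT /is_trig_mxP HU; split=> [|i].
  apply/is_trig_mxP => i j ij; rewrite mxE big1 // => l _.
  have [il|li] := ltnP i l; first by rewrite HT ?mul0r.
  by rewrite HU ?mulr0 //; apply: leq_ltn_trans li ij.
rewrite mxE (bigD1 i) //= big1 ?addr0 // => l li.
have [il|il|il] := ltngtP i l; first by rewrite HT ?mul0r.
  by rewrite HU ?mulr0.
by rewrite -(val_inj il) eqxx in li.
Qed.

(** In triangular form, taking powers acts on the diagonal. *)
Lemma char_poly_powE n (A : 'M[C]_n) s k : (0 < n)%N ->
  char_poly A = \prod_(z <- s) ('X - z%:P) ->
  char_poly (A ^+ k) = \prod_(z <- s) ('X - (z ^+ k)%:P).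
Proof.
move=> n0 EA; have [P uP trP] := Schur A n0; have Pu := unitarymx_unit uP.
set T := P *m A *m invmx P; have trT : is_trig_mx T by rewrite /T -conjumx.
have pow : P *m A ^+ k *m invmx P = T ^+ k /\
    is_trig_mx (T ^+ k) /\ forall i, (T ^+ k) i i = T i i ^+ k.
  elim: k => [|k [E [trk diagk]]].
    rewrite !expr0 mulmx1 mulmxV //; split=> //; split=> [|i]; last by rewrite mxE eqxx.
    exact: scalar_mx_is_trig.
  split.
    by rewrite !exprS -E -[A * _]/(A *m _) -[T * _]/(T *m _) /T !mulmxA mulmxKV.
  have [tr dg] := trig_mul trT trk.
  by rewrite exprS; split=> // i; rewrite [LHS]dg diagk -exprS.
have [E [trk dg]] := pow.
have ET : perm_eq s [seq T i i | i : 'I_n].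
  apply: prod_XsubC_eq; rewrite -EA -(char_poly_conj _ Pu) char_poly_trig // big_image /=.
  by [].
rewrite -(char_poly_conj _ Pu) E char_poly_trig // (perm_big _ ET) big_image /=.
by apply: eq_bigr => i _; rewrite dg.
Qed.

End CharPolyPower.

Section Eta.
Variables (R : realType) (n : nat) (A : 'M[R]_n).
Hypothesis n0 : (0 < n)%N.

Lemma eigenvaluesE : char_poly (cplx_mx A) = \prod_(z <- eigenvalues A) ('X - z%:P).
Proof.
rewrite /eigenvalues; case: closed_field_poly_normal => s /= ->.
by rewrite (monicP (char_poly_monic _)) scale1r.
Qed.

Lemma size_eigenvalues : size (eigenvalues A) = n.
Proof.
have := size_char_poly (cplx_mx A); rewrite eigenvaluesE size_prod_XsubC.
by move=> [].
Qed.

Lemma char_poly_power_coef k i :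
  modulus (power_poly (eigenvalues A) k)`_i = `|(char_poly (A ^+ k))`_i|.
Proof.
have E : cplx_mx (A ^+ k) = cplx_mx A ^+ k.
  elim: k => [|k IH]; first by rewrite !expr0 /cplx_mx map_mx1.
  by rewrite !exprS -IH /cplx_mx map_mxM.
rewrite /power_poly -(char_poly_powE k n0 eigenvaluesE) -E /cplx_mx.
rewrite -(map_char_poly (real_complex R)) coef_map /=.
exact: modulusR.
Qed.

Lemma eta_mahler : eta A = log2 (mahler (eigenvalues A)).
Proof.
rewrite /eta /mahler /log2; elim: (eigenvalues A) => [|z s IH].
  by rewrite !big_nil ln1 mul0r.
rewrite !big_cons; case: ifP => // Hz; rewrite {}IH -mulrDl -lnM ?posrE //.
  exact: lt_le_trans Hz.
exact: lt_le_trans (mahler_ge1 s).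
Qed.

(** The right-hand side speaks of finitely many polynomials in the entries of [A] for each [k]. *)
Lemma mahler_gt_char_poly (c : R) : 0 < c -> c < mahler (eigenvalues A) <->
  exists k i, 2 ^+ n * c ^+ k.+1 < `|(char_poly (A ^+ k.+1))`_i|.
Proof.
move=> c0; rewrite mahler_gtP // size_eigenvalues.
by split=> -[k [i H]]; exists k, i; rewrite ?char_poly_power_coef // -char_poly_power_coef.
Qed.

End Eta.

(** * Rational linear inequalities and games *)
Section FourierMotzkin.
Variable R : realType.

Definition lin (m : nat) (c : seq rat) (x : nat -> R) : R :=
  \sum_(i < m) ratr c`_i * x i.

Lemma between (lo up : seq R) : (forall a b, a \in lo -> b \in up -> a <= b) ->
  exists v, (forall a, a \in lo -> a <= v) /\ (forall b, b \in up -> v <= b).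
Proof.
elim: lo => [|a lo IH] H.
  elim: up {H} => [|b up [v [_ IH]]]; first by exists 0.
  exists (Num.min b v); split=> // b'; rewrite inE => /predU1P[->|/IH le].
    by rewrite ge_min lexx.
  by rewrite ge_min le orbT.
have [|v [Hlo Hup]] := IH; first by move=> a' b a'lo; apply: H; rewrite inE a'lo orbT.
exists (Num.max a v); split=> [a'|b bup].
  by rewrite inE le_max => /predU1P[->|/Hlo ->]; rewrite ?lexx ?orbT.
by rewrite ge_max Hup // H // mem_head.
Qed.

(** Constraints with a positive coefficient of the variable bound it from below, those with a
    negative one from above; a value in between exists if and only if every lower bound is at most
    every upper bound. *)
Lemma eliminate m (cs : seq (seq rat)) : exists cs' : seq (seq rat), forall x : nat -> R,
  (exists v, forall c, c \in cs -> 0 <= lin m c x + ratr c`_m * v) <->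
  (forall c, c \in cs' -> 0 <= lin m c x).
Proof.
pose pos := [seq c <- cs | 0 < c`_m]; pose neg := [seq c <- cs | c`_m < 0].
pose comb (p q : seq rat) := mkseq (fun i => p`_i * - q`_m + q`_i * p`_m) m.
have lin_comb p q x : lin m (comb p q) x = lin m p x * - ratr q`_m + lin m q x * ratr p`_m.
  rewrite /lin !mulr_suml -big_split; apply: eq_bigr => i _.
  by rewrite nth_mkseq // rmorphD !rmorphM rmorphN /=; ring.
exists ([seq c <- cs | c`_m == 0] ++ [seq comb p q | p <- pos, q <- neg]) => x.
have posP c : c \in pos -> c \in cs /\ 0 < ratr c`_m :> R.
  by rewrite mem_filter ltr0q => /andP[].
have negP c : c \in neg -> c \in cs /\ ratr c`_m < 0 :> R.
  by rewrite mem_filter ltrq0 => /andP[].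
split=> [[v Hv] c|H].
  rewrite mem_cat mem_filter => /orP[/andP[/eqP c0 ccs]|
    /allpairsP[[p q] /= [/posP[pcs p0] /negP[qcs q0] ->]]].
    by have := Hv c ccs; rewrite c0 rmorph0 mul0r addr0.
  rewrite lin_comb; have := Hv p pcs; have := Hv q qcs.
  move: (lin m p x) (lin m q x) p0 q0; move: (ratr p`_m) (ratr q`_m) => a b L L' a0 b0 H1 H2.
  have := mulr_ge0 (ltW a0) H1; have : 0 <= - b * (L + a * v) by rewrite mulr_ge0 // oppr_ge0 ltW.
  by nra.
have [|v [Hlo Hup]] := @between [seq - lin m p x / ratr p`_m | p <- pos]
    [seq lin m q x / - ratr q`_m | q <- neg].
  move=> _ _ /mapP[p pp ->] /mapP[q qn ->].
  have [pcs p0] := posP _ pp; have [qcs q0] := negP _ qn.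
  have nq0 : 0 < - ratr q`_m :> R by rewrite oppr_gt0.
  rewrite ler_pdivrMr // mulrAC ler_pdivlMr // mulNr.
  have := H (comb p q); rewrite mem_cat (allpairs_f comb pp qn) orbT lin_comb => /(_ isT).
  by lra.
exists v => c ccs; case: (ltrgt0P (ratr c`_m : R)) => c0.
- have cpos : c \in pos by rewrite mem_filter ccs -(ltr0q R) c0.
  have := Hlo _ (map_f (fun p => - lin m p x / ratr p`_m) cpos).
  by rewrite ler_pdivrMr // mulrC; lra.
- have cneg : c \in neg by rewrite mem_filter ccs -(ltrq0 R) c0.
  have := Hup _ (map_f (fun q => lin m q x / - ratr q`_m) cneg).
  by rewrite ler_pdivlMr ?oppr_gt0 // mulrC; lra.
- rewrite c0 mul0r addr0; apply: H; rewrite mem_cat mem_filter ccs andbT.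
  by move/eqP: c0; rewrite fmorph_eq0 => ->.
Qed.

Lemma lin_ext m c (x x' : nat -> R) : (forall i, (i < m)%N -> x i = x' i) ->
  lin m c x = lin m c x'.
Proof. by move=> H; apply: eq_bigr => i _; rewrite H. Qed.

Lemma fourier_motzkin k d (cs : seq (seq rat)) : exists cs' : seq (seq rat), forall x : nat -> R,
  (exists x', (forall i, (i < k)%N -> x' i = x i) /\
     forall c, c \in cs -> 0 <= lin (k + d) c x') <->
  (forall c, c \in cs' -> 0 <= lin k c x).
Proof.
elim: d cs => [|d IH] cs.
  exists cs => x; rewrite addn0; split=> [[x' [E H]] c /H|H]; last by exists x.
  by rewrite (lin_ext _ E).
have [cs1 H1] := eliminate (k + d) cs; have [cs2 H2] := IH cs1.
exists cs2 => x; rewrite -H2; have linS c x' : lin (k + d.+1) c x' =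
   lin (k + d) c x' + ratr c`_(k + d) * x' (k + d)%N.
  by rewrite addnS /lin big_ord_recr.
split=> -[x' [E H]].
  by exists x'; split=> //; apply/H1; exists (x' (k + d)%N) => c ccs; rewrite -linS H.
have /H1[v Hv] := H; exists (fun i => if i == (k + d)%N then v else x' i).
split=> [i ik|c ccs]; first by rewrite ifN ?E //; lia.
rewrite linS eqxx (@lin_ext _ _ _ x') ?Hv // => i Hi.
by rewrite ltn_eqF.
Qed.

End FourierMotzkin.

Section GameValue.
Variables (R : realType) (X Y : finType) (S : X -> Y -> bool).

(** The game in which one player picks [x], the other picks [y], and the first pays 1 if [S x y]. *)
Definition load (P : X -> R) (y : Y) : R := \sum_(x | S x y) P x.

Definition achievable (t : R) : Prop := exists2 P, is_pmf P & forall y, load P y <= t.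

(** The distribution is eliminated from the rational inequalities that define achievability. Variable
    0 stands for the constant 1 and variable 1 for [t], since the linear forms are homogeneous. *)
Lemma achievable_linear : exists cs : seq (seq rat), forall t,
  achievable t <-> forall c, c \in cs -> 0 <= ratr c`_0 + ratr c`_1 * t :> R.
Proof.
pose N := #|X|; pose form (c0 c1 : rat) (f : X -> rat) : seq rat :=
  [:: c0, c1 & [seq f x | x <- enum X]].
have lin_form c0 c1 f (x : nat -> R) : lin (2 + N) (form c0 c1 f) x =
    ratr c0 * x 0%N + (ratr c1 * x 1%N + \sum_(z : X) ratr (f z) * x (2 + enum_rank z)%N).
  rewrite /lin /N !big_ord_recl /=; congr (_ + (_ + _)).
  rewrite (reindex (@enum_rank X)) /=; last by apply: onW_bij; apply: enum_rank_bij.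
  by apply: eq_bigr => z _; rewrite (nth_map z) ?nth_enum_rank // -cardE ltn_ord.
pose cs0 := [seq form 0 0 (fun x => (x == z)%:R) | z <- enum X] ++
  [:: form (-1) 0 (fun _ => 1); form 1 0 (fun _ => -1)] ++
  [seq form 0 1 (fun x => - (S x y)%:R) | y <- enum Y].
pose tl (u : nat -> R) (z : X) := u (2 + enum_rank z)%N.
have cs0P u :
  (forall c, c \in cs0 -> 0 <= lin (2 + N) c u) <->
  [/\ forall z, 0 <= tl u z, u 0%N = \sum_z tl u z & forall y, load (tl u) y <= u 1%N].
  have lin_nonneg z : lin (2 + N) (form 0 0 (fun z' => (z' == z)%:R)) u = tl u z.
    rewrite lin_form rmorph0 !mul0r !add0r (bigD1 z) //= eqxx rmorph1 mul1r big1 ?addr0 //.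
    by move=> z' /negbTE ->; rewrite rmorph0 mul0r.
  have lin_ge : lin (2 + N) (form (-1) 0 (fun _ => 1)) u = - u 0%N + \sum_z tl u z.
    rewrite lin_form rmorph0 mul0r add0r rmorphN1 mulN1r; congr (_ + _).
    by apply: eq_bigr => z _; rewrite rmorph1 mul1r.
  have lin_le : lin (2 + N) (form 1 0 (fun _ => -1)) u = u 0%N - \sum_z tl u z.
    rewrite lin_form rmorph0 mul0r add0r rmorph1 mul1r -sumrN; congr (_ + _).
    by apply: eq_bigr => z _; rewrite rmorphN1 mulN1r.
  have lin_load y : lin (2 + N) (form 0 1 (fun z => - (S z y)%:R)) u = u 1%N - load (tl u) y.
    rewrite lin_form rmorph0 mul0r add0r rmorph1 mul1r; congr (_ + _).
    rewrite /load -sumrN [in RHS]big_mkcond; apply: eq_bigr => z _.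
    by case: (S z y); rewrite ?rmorphN1 ?mulN1r ?oppr0 ?rmorph0 ?mul0r.
  split=> [H|[H0 H1 H2] c].
    split=> [z||y].
    - rewrite -lin_nonneg H // mem_cat.
      by rewrite (map_f (fun z => form 0 0 (fun z' => (z' == z)%:R))) ?mem_enum.
    - apply/eqP; rewrite eq_le -subr_ge0 addrC -lin_ge -[X in _ && X]subr_ge0 -lin_le.
      by rewrite !H // !mem_cat !inE eqxx ?orbT.
    - rewrite -subr_ge0 -lin_load H // !mem_cat.
      by rewrite (map_f (fun y => form 0 1 (fun z => - (S z y)%:R))) ?mem_enum ?orbT.
  rewrite !mem_cat !inE => /orP[/mapP[z _ ->]|/orP[/orP[/eqP ->|/eqP ->]|/mapP[y _ ->]]].
  - by rewrite lin_nonneg.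
  - by rewrite lin_ge H1 addNr.
  - by rewrite lin_le H1 subrr.
  - by rewrite lin_load subr_ge0.
have [cs Hcs] := fourier_motzkin R 2 N cs0; exists cs => t.
pose x0 i : R := if i == 0%N then 1 else t.
have lin2 c : lin 2 c x0 = ratr c`_0 + ratr c`_1 * t.
  by rewrite /lin !big_ord_recl big_ord0 /= mulr1 addr0.
apply: (iff_trans (B := forall c, c \in cs -> 0 <= lin 2 c x0)); last first.
  by split=> H c /H; rewrite lin2.
rewrite -Hcs; split=> [[P [P0 P1] HP]|[x' [E /cs0P[H0 H1 H2]]]].
  pose x' i : R := if i is j.+2 then
    (if [pick z : X | val (enum_rank z) == j] is Some z then P z else 0) else x0 i.
  have x'P z : x' (2 + enum_rank z)%N = P z.
    rewrite /=; case: pickP => [z' /eqP/val_inj E|/(_ z)]; last by rewrite eqxx.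
    by rewrite (enum_rank_inj E).
  have x'E : tl x' = P by apply/funext.
  exists x'; split=> [[|[|]]//|]; apply/cs0P; rewrite x'E.
  by split=> //; rewrite P1.
exists (tl x') => [|y].
  by split=> //; rewrite -H1 E.
by rewrite (le_trans (H2 y)) // E.
Qed.

(** The achievable payoffs are upward closed and bounded below, so the rational inequalities that
    describe them reduce to finitely many lower bounds, the largest of which is the value. *)
Lemma game_value_rational (x0 : X) (y0 : Y) : exists v : rat,
  achievable (ratr v) /\ forall P, is_pmf P -> exists y, ratr v <= load P y.
Proof.
have [cs Hcs] := achievable_linear.
have up t t' : t <= t' -> achievable t -> achievable t'.
  by move=> tt' [P pP HP]; exists P => // y; apply: le_trans tt'.
have ge0 t : achievable t -> 0 <= t.
  by move=> [P [P0 _] HP]; apply: le_trans (HP y0); apply: sumr_ge0.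
have ach1 : achievable 1.
  exists (fun x => (x == x0)%:R) => [|y].
    split=> [x|]; first by rewrite ler0n.
    by rewrite (bigD1 x0) //= eqxx big1 ?addr0 // => x /negbTE ->.
  rewrite /load big_mkcond (bigD1 x0) //= eqxx big1 ?addr0; last first.
    by move=> x /negbTE ->; case: (S x y).
  by case: (S x0 y); rewrite ?ler01.
(* The lower bounds; there is one, as otherwise -1 would be achievable along with 1. *)
pose cand := [seq - c`_0 / c`_1 | c <- cs & 0 < c`_1].
have [v [vc vmax]] : exists v, v \in cand /\ forall v', v' \in cand -> v' <= v.
  have : cand != [::].
    apply/eqP => cand0; have : achievable (-1).
      apply/Hcs => c ccs; have := (Hcs 1).1 ach1 c ccs; rewrite mulr1 mulrN1.
      have : ratr c`_1 <= 0 :> R.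
        rewrite lerq0 leNgt; apply/negP => c1.
        have : - c`_0 / c`_1 \in cand.
          by apply: (map_f (fun c : seq rat => - c`_0 / c`_1)); rewrite mem_filter c1.
        by rewrite cand0.
      lra.
    by move=> /ge0; lra.
  elim: cand => // a l IH _; case: (eqVneq l [::]) => [->|/IH [v [vl vmax]]].
    by exists a; rewrite mem_head; split=> // v'; rewrite inE => /eqP ->.
  exists (Num.max a v); split=> [|v'].
    by rewrite /Num.max inE; case: ifP; rewrite ?vl ?eqxx ?orbT.
  by rewrite inE le_max => /predU1P[->|/vmax ->]; rewrite ?lexx ?orbT.
have vmin t : achievable t -> ratr v <= t.
  move: vc => /mapP[c]; rewrite mem_filter => /andP[c1 ccs] ->.
  move=> /Hcs /(_ c ccs); have c1' : 0 < ratr c`_1 :> R by rewrite ltr0q.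
  by rewrite rmorphM fmorphV rmorphN /= ler_pdivrMr // mulrC; lra.
exists v; split.
  apply/Hcs => c ccs; have [c1|c1] := ltP 0 c`_1.
    have c1' : 0 < ratr c`_1 :> R by rewrite ltr0q.
    have : - c`_0 / c`_1 \in cand.
      by apply: (map_f (fun c : seq rat => - c`_0 / c`_1)); rewrite mem_filter c1.
    by move=> /vmax; rewrite -(ler_rat R) rmorphM fmorphV rmorphN /= ler_pdivrMr // mulrC; lra.
  have := (Hcs (Num.max 1 (ratr v))).1 (up _ _ _ ach1) c ccs.
  rewrite le_max lexx => /(_ isT) H; apply: (le_trans H); rewrite lerD2l.
  by rewrite ler_wnM2l ?lerq0 // le_max lexx orbT.
move=> P pP; have [y _ Hy] := @arg_maxP _ _ _ y0 xpredT (load P) isT.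
by exists y; apply: vmin; exists P => // z; apply: Hy.
Qed.

End GameValue.

(** * The zero-error capacity with feedback *)
Section Capacity.
Variables (R : realType) (X Y : finType) (W : X -> Y -> R).
Hypothesis Wch : channels W.

Lemma chan_ge0 x y : 0 <= W x y.
Proof. by have [[H _] _] := Wch x. Qed.

Lemma chan_ext_ge0 m (x : m.-tuple X) (y : m.-tuple Y) : 0 <= chan_ext W x y.
Proof. by apply: prodr_ge0 => j _; apply: chan_ge0. Qed.

Definition distinguishable (x x' : X) : Prop := forall y, ~~ ((0 < W x y) && (0 < W x' y)).

Lemma distinguishable_neq x x' : distinguishable x x' -> x != x'.
Proof.
move=> H; apply/eqP => xx'; have [[W0 W1] _] := Wch x.
suff : \sum_y W x y = 0 by rewrite W1 => /eqP; rewrite oner_eq0.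
apply: big1 => y _; apply/eqP; rewrite eq_le W0 andbT leNgt.
by have := H y; rewrite -xx' andbb.
Qed.

(** If no pair of letters is distinguishable, the output letters common to the pairs form an output
    word of positive probability under both words. *)
Lemma orthogonal_pairE m (x x' : m.-tuple X) :
  (\sum_(y : m.-tuple Y) chan_ext W x y * chan_ext W x' y == 0) <->
  exists j, distinguishable (tnth x j) (tnth x' j).
Proof.
have pos y z : (0 < W z y) = (W z y != 0) by rewrite lt0r chan_ge0 andbT.
rewrite psumr_eq0 => [|y _]; last by rewrite mulr_ge0 ?chan_ext_ge0.
split=> [/allP H|[j Hj]].
  apply: contrapT => /forallNP H0.
  have /choice[f Hf] : forall j, exists y, (0 < W (tnth x j) y) && (0 < W (tnth x' j) y).
    by move=> j; have /existsNP[y /negP] := H0 j; rewrite negbK; exists y.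
  have := H [tuple f j | j < m] (mem_index_enum _).
  rewrite /= mulf_eq0 => /orP[]; rewrite /chan_ext => /prodf_eq0[j _];
    by have := Hf j; rewrite !pos tnth_mktuple => /andP[/negbTE H1 /negbTE H2]; rewrite ?H1 ?H2.
apply/allP => y _ /=; rewrite /chan_ext (bigD1 j) //= [X in _ * X](bigD1 j) //=.
have := Hj (tnth y j); rewrite !pos negb_and !negbK => /orP[] /eqP ->; apply/eqP; ring.
Qed.

Lemma max_code_le1 m : (forall x x', ~ distinguishable x x') -> (max_code W m <= 1)%N.
Proof.
move=> H; apply/bigmax_leqP => C /forallP HC; apply/card_le1_eqP => x x' xC x'C.
apply: contrapT => /eqP nexx'.
have /implyP/(_ xC)/forallP/(_ x')/implyP/(_ x'C)/implyP := HC x.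
by rewrite eq_sym => /(_ nexx') /orthogonal_pairE[j]; apply: H.
Qed.

(** The words over the two letters form a code. *)
Lemma max_code_ge m x x' : distinguishable x x' -> (2 ^ m <= max_code W m)%N.
Proof.
move=> Hd; pose f (b : m.-tuple bool) : m.-tuple X := [tuple if tnth b j then x else x' | j < m].
have xx' := distinguishable_neq Hd.
have f_inj : injective f.
  move=> b b' /(congr1 (fun t => tnth t)) E; apply: eq_from_tnth => j.
  have := congr1 (fun t => t j) E; rewrite !tnth_mktuple.
  by case: (tnth b j); case: (tnth b' j) => // /eqP; rewrite ?(negbTE xx') // eq_sym (negbTE xx').
have -> : (2 ^ m)%N = #|f @: [set: m.-tuple bool]%SET|.
  by rewrite card_imset // cardsT card_tuple card_bool.
apply: (@leq_bigmax_cond _ (fun C => orthogonal_words W C) (fun C : {set m.-tuple X} => #|C|)).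
apply/forallP => u; apply/implyP => /imsetP[b _ ->]; apply/forallP => u'.
apply/implyP => /imsetP[b' _ ->]; apply/implyP => ne; apply/orthogonal_pairE.
have /existsP[j Hj] : [exists j, tnth b j != tnth b' j].
  apply: contraNT ne; rewrite negb_exists => /forallP E.
  by apply/eqP; congr f; apply: eq_from_tnth => j; apply/eqP; rewrite -[_ == _]negbK.
exists j; rewrite !tnth_mktuple => y; move: Hj (Hd y).
by case: (tnth b j); case: (tnth b' j) => // _; rewrite andbC.
Qed.

(** Without distinguishable letters all codes have at most one word; with them the rate is at
    least 1. *)
Lemma C0_eq0P : C0 W = 0%E <-> forall x x', ~ distinguishable x x'.
Proof.
split=> [C00 x x' Hd|H].
  suff : (1%:E <= C0 W)%E by rewrite C00 lee_fin ler10.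
  rewrite /C0 limn_einf_lim; apply: lime_ge; first exact: is_cvg_einfs.
  exists 1%N => // m /= m1; apply: le_ereal_inf_tmp => _ [k /= mk <-]; rewrite lee_fin.
  have k0 : (0 < k)%N by apply: leq_trans mk.
  rewrite ler_pdivlMr ?ltr0n // mul1r /log2 ler_pdivlMr ?ln_gt0 ?ltr1n //.
  rewrite mulr_natl -lnXn ?posrE ?ltr0n // -natrX ler_ln ?posrE ?ltr0n ?expn_gt0 //.
    by rewrite ler_nat (max_code_ge k Hd).
  by apply: leq_trans (max_code_ge k Hd); rewrite expn_gt0.
rewrite /C0 (_ : (fun m => _) = cst 0%E).
  by apply: (cvg_limn_einf_sup _).1; apply: cvg_cst.
apply/funext => m /=; congr (_%:E); rewrite /log2.
have : (max_code W m <= 1)%N by apply: max_code_le1.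
by case: (max_code W m) => [|[|]] // _; rewrite ?ln1 ?(ln0 (lexx 0)) ?mul0r.
Qed.

Definition supp_rel (S : {set X * Y}) (x : X) (y : Y) : bool := (x, y) \in S.

Definition supp : {set X * Y} := [set p | 0 < W p.1 p.2].

Lemma supp_relE x y : supp_rel supp x y = (0 < W x y).
Proof. by rewrite /supp_rel inE. Qed.

End Capacity.

Section Threshold.
Variables (R : realType) (X Y : finType).
Implicit Types (S : {set X * Y}) (W : X -> Y -> R).

Definition full_rows S : Prop := forall x, exists y, (x, y) \in S.

Definition disjoint_rows S : Prop :=
  exists x x', forall y, ~~ (((x, y) \in S) && ((x', y) \in S)).

(** The number whose logarithm is the feedback capacity of every channel with support [S]. *)
Definition capacity_base S (c : rat) : Prop :=
  (disjoint_rows S -> exists v : rat, [/\ c = v^-1, achievable (supp_rel S) (ratr v : R) &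
     forall P : X -> R, is_pmf P -> exists y, ratr v <= load (supp_rel S) P y]) /\
  (~ disjoint_rows S -> c = 1).

Lemma capacity_base_exists S : full_rows S -> exists c, capacity_base S c.
Proof.
move=> full; have [D|ND] := pselect (disjoint_rows S); last by exists 1; split.
have [x0 _] := D; have [y0 _] := full x0.
have [v [Hv Hv']] := @game_value_rational R X Y (supp_rel S) x0 y0.
by exists v^-1; split=> // _; exists v.
Qed.

(** The value is positive because every row of [S] is nonempty. *)
Lemma game_value_bounds S (v : rat) : full_rows S -> achievable (supp_rel S) (ratr v : R) ->
  (forall P : X -> R, is_pmf P -> exists y, ratr v <= load (supp_rel S) P y) ->
  0 < v /\ v <= 1.
Proof.
move=> full [P [P0 P1] HP] Hv; split; last first.
  have [y Hy] := Hv P (conj P0 P1).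
  rewrite -(ler_rat R) rmorph1 (le_trans Hy) // -P1 /load big_mkcond.
  by apply: ler_sum => x _; case: ifP.
rewrite -(ltr_rat R) rmorph0 ltNge; apply/negP => v0.
have Pz x : P x = 0.
  have [y xy] := full x; apply/eqP; rewrite eq_le P0 andbT.
  apply: le_trans v0; apply: le_trans (HP y); rewrite /load (bigD1 x) //= lerDl.
  by apply: sumr_ge0.
by move: P1; rewrite big1 // => /eqP; rewrite eq_sym oner_eq0.
Qed.

Lemma capacity_base_ge1 S c : full_rows S -> capacity_base S c -> 1 <= c.
Proof.
move=> full [H1 H2]; have [D|/H2 ->//] := pselect (disjoint_rows S).
have [v [-> Hv Hv']] := H1 D; have [v0 v1] := game_value_bounds full Hv Hv'.
by rewrite invf_ge1.
Qed.

(** A larger support increases the payoff for every distribution, and it can only destroy disjoint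
    rows. *)
Lemma capacity_base_mono S S' c c' : full_rows S -> S \subset S' ->
  capacity_base S c -> capacity_base S' c' -> c' <= c.
Proof.
move=> full SS' HS [H1' H2'].
have [D'|/H2' ->] := pselect (disjoint_rows S'); last exact: capacity_base_ge1 HS.
have full' : full_rows S' by move=> x; have [y /(fintype.subsetP SS') xy] := full x; exists y.
have D : disjoint_rows S.
  have [x [x' H]] := D'; exists x, x' => y; apply: contra (H y).
  by move=> /andP[/(fintype.subsetP SS') -> /(fintype.subsetP SS') ->].
have [v' [-> Hv' Hw']] := H1' D'; have [v'0 _] := game_value_bounds full' Hv' Hw'.
have [/(_ D)[v [-> Hv Hw]] _] := HS; have [v0 _] := game_value_bounds full Hv Hw.
rewrite lef_pV2 ?posrE // -(ler_rat R); have [P pP HP] := Hv'.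
have [y Hy] := Hw P pP; apply: (le_trans Hy); apply: le_trans (HP y).
rewrite /load [leLHS]big_mkcond [leRHS]big_mkcond; apply: ler_sum => x _; rewrite /supp_rel.
case: ifP => [/(fintype.subsetP SS') -> //|_]; case: ifP => // _; by have [] := pP.
Qed.

Lemma channel_full W : channels W -> full_rows (supp W).
Proof.
move=> Wch x; have [[W0 W1] _] := Wch x; apply: contrapT => /forallNP H.
suff : \sum_y W x y = 0 by rewrite W1 => /eqP; rewrite oner_eq0.
apply: big1 => y _; apply/eqP; rewrite eq_le W0 andbT leNgt.
by apply/negP => Wxy; apply: (H y); rewrite inE.
Qed.

Lemma log2_le (a b : R) : 0 < a -> a <= b -> log2 a <= log2 b.
Proof.
move=> a0 ab; rewrite /log2 ler_wpM2r ?invr_ge0 ?ln_ge0 ?ler1n // ler_ln ?posrE //.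
exact: lt_le_trans ab.
Qed.

Lemma log2_lt (a b : R) : 0 < a -> 0 < b -> (log2 a < log2 b) = (a < b).
Proof.
by move=> a0 b0; rewrite /log2 ltr_pM2r ?invr_gt0 ?ln_gt0 ?ltr1n // ltr_ln ?posrE.
Qed.

(** The maximum over the distributions is attained at an optimal strategy of the game. *)
Lemma C0FB_base W c : channels W -> capacity_base (supp W) c ->
  C0FB W = (log2 (ratr c))%:E.
Proof.
move=> Wch [H1 H2]; rewrite /C0FB; case: eqP => C00.
  rewrite H2 ?rmorph1 /log2 ?ln1 ?mul0r // => -[x [x' D]].
  have /(C0_eq0P Wch)/(_ x x') := C00; apply => y.
  by have := D y; rewrite !inE.
have D : disjoint_rows (supp W).
  apply: contrapT => ND; apply: C00; apply/(C0_eq0P Wch) => x x' H; apply: ND.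
  by exists x, x' => y; rewrite !inE; apply: H.
have full := channel_full Wch.
have [v [-> Hv Hw]] := H1 D; have [v0 v1] := game_value_bounds full Hv Hw.
have v0' : 0 < ratr v :> R by rewrite ltr0q.
have loadE P y : \sum_(x | 0 < W x y) P x = load (supp_rel (supp W)) P y.
  by apply: eq_bigl => x; rewrite supp_relE.
rewrite fmorphV; apply/eqP; rewrite eq_le; apply/andP; split.
  apply: ge_ereal_sup => _ [P pP <-]; have [y Hy] := Hw P pP.
  apply: (@le_trans _ _ (elog2_inv (\sum_(x | 0 < W x y) P x))); first exact: bigmin_le.
  have ly0 : 0 < load (supp_rel (supp W)) P y by apply: lt_le_trans Hy.
  rewrite loadE /elog2_inv gt_eqF // lee_fin log2_le ?invr_gt0 //.
  by rewrite lef_pV2 ?posrE.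
have [P pP HP] := Hv; apply: le_ereal_sup_tmp.
eexists; first by exists P; [exact: pP|reflexivity].
apply: le_bigmin => [|y _]; first by rewrite leey.
rewrite loadE /elog2_inv; case: eqP => [_|/eqP ly]; first by rewrite leey.
have ly0 : 0 < load (supp_rel (supp W)) P y.
  by rewrite lt_neqAle eq_sym ly sumr_ge0 // => x _; have [] := pP.
by rewrite lee_fin log2_le ?invr_gt0 // lef_pV2 ?posrE.
Qed.

End Threshold.

(** * The semi-decision procedure *)
Lemma nnre_ratr (R : realType) (W : Type) (word : W -> seq bool) (c : rat) : 0 <= c ->
  nnre word (fun _ _ => ratr c : R).
Proof.
move=> c0; have : 0 <= numq c by rewrite numq_ge0.
case En : (numq c) => [a|//] _; have := denq_gt0 c; case Ed : (denq c) => [[|b]|] // _.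
apply: nnre_ext (nnre_rat R word a b) => _ _.
by rewrite /ratr En Ed !pmulrn.
Qed.

(** The power of a constant with variable exponent is that of a matrix of size 1. *)
Lemma nnre_expr (R : realType) (W : Type) (word : W -> seq bool) (c : R) v :
  nnre word (fun _ _ => c) -> nnre word (fun _ e => c ^+ (e v).+1).
Proof.
move=> Hc; have HB i j : nnre word (fun _ _ => (c%:M : 'M[R]_1) i j).
  by apply: nnre_ext Hc => _ _; rewrite !ord1 mxE eqxx.
apply: nnre_ext (nnre_pow (B := fun _ => c%:M) HB 0 0 v) => _ e.
have -> : (c%:M : 'M[R]_1) ^+ (e v).+1 = (c ^+ (e v).+1)%:M.
  elim: ((e v).+1) => [|k IH]; first by rewrite !expr0.
  by rewrite !exprS IH [LHS]mul_scalar_mx scale_scalar_mx.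
by rewrite mxE eqxx.
Qed.

Lemma nth_flatten_codes (ds : seq real_desc) d0 k r : (k < size ds)%N -> (r < 3)%N ->
  nth 0%N (flatten [seq desc_codes d | d <- ds]) (3 * k + r) =
  nth 0%N (desc_codes (nth d0 ds k)) r.
Proof.
elim: ds k => // d ds IH [|k] kds r3.
  by rewrite muln0 add0n; case: r r3 {IH} => [|[|[|]]].
by rewrite mulnS -addnA add3n /= IH.
Qed.

Section Main.
Variables (R : realType) (n : nat) (X Y : finType).

(** Matrix and channel entries are treated alike. *)
Definition entry_index := (('I_n * 'I_n) + (X * Y))%type.

Definition entries : seq entry_index :=
  [seq inl (i, j) | i <- enum 'I_n, j <- enum 'I_n] ++ [seq inr (x, y) | x <- enum X, y <- enum Y].

Definition entry (AW : 'M[R]_n * (X -> Y -> R)) (t : entry_index) : R :=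
  match t with inl ij => AW.1 ij.1 ij.2 | inr xy => AW.2 xy.1 xy.2 end.

Lemma mem_entries t : t \in entries.
Proof.
rewrite mem_cat; case: t => -[a b]; apply/orP; [left|right];
  by apply/allpairsP; exists (a, b); rewrite !mem_enum.
Qed.

Lemma pair_repr_entries w AW : @pair_repr R n X Y w AW <->
  exists d : entry_index -> real_desc, (forall t, describes (d t) (entry AW t)) /\
    w = unary_word (flatten [seq desc_codes (d t) | t <- entries]).
Proof.
have E (d : entry_index -> real_desc) : [seq desc_codes (d t) | t <- entries] =
  [seq desc_codes (d (inl (i, j))) | i <- enum 'I_n, j <- enum 'I_n] ++
  [seq desc_codes (d (inr (x, y))) | x <- enum X, y <- enum Y].
  by rewrite /entries map_cat !map_allpairs.
split=> [[dA [dW [HA HW ->]]]|[d [Hd ->]]].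
  exists (fun t => match t with inl ij => dA ij.1 ij.2 | inr xy => dW xy.1 xy.2 end).
  by split=> [[]|]; [case=> i j; exact: HA|case=> x y; exact: HW|rewrite E].
exists (fun i j => d (inl (i, j))), (fun x y => d (inr (x, y))).
by split; [move=> i j; exact: (Hd (inl (i, j)))|move=> x y; exact: (Hd (inr (x, y)))|rewrite E].
Qed.

Local Open Scope classical_set_scope.

(** The points on which the formula must be correct: words together with the pair that they
    describe. *)
Record input := Input {
  in_obj : 'M[R]_n * (X -> Y -> R);
  in_word : seq bool;
  in_desc : entry_index -> real_desc;
  in_dom : (@plants R n `*` @channels R X Y) in_obj;
  in_describes : forall t, describes (in_desc t) (entry in_obj t);
  in_wordE : in_word = unary_word (flatten [seq desc_codes (in_desc t) | t <- entries]) }.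

Local Close Scope classical_set_scope.

Lemma rfun_desc_code t r : (r < 3)%N ->
  rfun in_word (fun a _ => nth 0%N (desc_codes (in_desc a t)) r).
Proof.
move=> r3.
have Ht : (index t entries < size entries)%N by rewrite index_mem mem_entries.
have sz a : size (flatten [seq desc_codes (in_desc a t) | t <- entries]) = (3 * size entries)%N.
  by elim: entries => //= u s IH; rewrite IH mulnS.
have Hlt a : (3 * index t entries + r <
    size (flatten [seq desc_codes (in_desc a t) | t <- entries]))%N.
  by rewrite sz; lia.
apply: rfun_ext (rfun_code in_wordE Hlt) => a e.
rewrite (map_comp desc_codes (in_desc a)) (nth_flatten_codes (in_desc a t)) ?size_map //.
by rewrite (nth_map t) ?nth_index ?mem_entries.
Qed.

Lemma nnre_entry t (neg : bool) :
  nnre in_word (fun a _ => Num.max 0 ((-1) ^+ neg * entry (in_obj a) t)).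
Proof.
apply: (describes_nnre (x := fun a => entry (in_obj a) t) (d := fun a => in_desc a t)) => [a|||].
- exact: in_describes.
- exact: (@rfun_desc_code t 0).
- exact: (@rfun_desc_code t 1).
- exact: (@rfun_desc_code t 2).
Qed.

(** The existential statement found by the machine; [c] gives the constants of the supports. *)
Definition certificate (c : {set X * Y} -> rat) (a : input) : Prop :=
  exists S : {set X * Y}, full_rows S /\
    (forall p, p \in S -> 0 < (in_obj a).2 p.1 p.2) /\
    exists (k : nat) (r : 'I_n.+1),
      2 ^+ n * ratr (c S) ^+ k.+1 < `|(char_poly ((in_obj a).1 ^+ k.+1))`_r|.

Lemma re_certificate c : (forall S, full_rows S -> 0 <= c S) ->
  re in_word (fun a _ => certificate c a).
Proof.
move=> c0; rewrite /certificate; apply: re_ex_fin => S.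
have [full|nfull] := pselect (full_rows S); last first.
  by apply: re_ext (re_const _ False) => a e; split=> // -[].
apply: re_and; first exact: re_const.
apply: re_and.
  apply: re_all_fin => p; have [pS|pS] := boolP (p \in S); last first.
    by apply: re_ext (re_const _ True) => a e; split.
  apply: re_ext (re_ltr (nnre_nat R _ 0) (nnre_entry (inr p) false)) => a e.
  by rewrite expr0 mul1r lt_max ltxx /=; split=> // H; apply: H.
apply: re_ex; apply: re_ex_fin => r.
have Hpow : dre in_word (fun (_ : input) e => 2 ^+ n * ratr (c S) ^+ (e 0%N).+1 : R).
  apply: dre_nnre; apply: nnre_ext (nnre_mul (nnre_nat R _ (2 ^ n))
    (nnre_expr 0 (nnre_ratr R in_word (c0 S full)))) => a e.
  by rewrite natrX.
have Hcoef : dre in_word (fun (a : input) e => (char_poly ((in_obj a).1 ^+ (e 0%N).+1))`_r).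
  apply: (@dpoly_char_pow R _ in_word n (fun a => (in_obj a).1)) => i j.
    by apply: nnre_ext (nnre_entry (inl (i, j)) false) => a e; rewrite expr0 mul1r.
  by apply: nnre_ext (nnre_entry (inl (i, j)) true) => a e; rewrite expr1 mulN1r.
apply: re_ext (re_or (re_dre_ltr Hpow Hcoef) (re_dre_ltr Hpow (dre_opp Hcoef))) => a e.
by rewrite ltr_normr; split=> [[->|->]|/orP[->|->]]; rewrite ?orbT; auto.
Qed.

(** A certificate with [S] proves the inequality because the capacity only decreases from [S] to the
    full support; conversely the full support serves as [S]. *)
Lemma certificateP c (a : input) : (0 < n)%N ->
  (forall S, full_rows S -> @capacity_base R X Y S (c S)) ->
  certificate c a <-> (C0FB (in_obj a).2 < (eta (in_obj a).1)%:E)%E.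
Proof.
move=> n0 Hc; have [_ Wch] := in_dom a.
set A := (in_obj a).1; set W := (in_obj a).2 in Wch *.
have full := channel_full Wch; have HW := Hc _ full.
have pos S : full_rows S -> 0 < ratr (c S) :> R.
  by move=> /[dup] f /Hc /(capacity_base_ge1 f) H; rewrite ltr0q (lt_le_trans ltr01).
rewrite (C0FB_base Wch HW) lte_fin (eta_mahler A).
rewrite log2_lt ?pos //; last exact: lt_le_trans (mahler_ge1 _).
split=> [[S [fS [SW [k [r H]]]]]|/(mahler_gt_char_poly A n0 (pos _ full))[k [i H]]].
  have SsubW : S \subset supp W.
    by apply/fintype.subsetP => p pS; rewrite inE; apply: SW.
  have := capacity_base_mono fS SsubW (Hc _ fS) HW; rewrite -(ler_rat R) => /le_lt_trans.
  apply; apply/(mahler_gt_char_poly A n0 (pos _ fS)).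
  by exists k, r.
exists (supp W); split=> //; split=> [p|]; first by rewrite inE.
have Hi : (i < n.+1)%N.
  rewrite -(size_char_poly (A ^+ k.+1)) ltnNge; apply/negP => le.
  move: H; rewrite nth_default // normr0 ltNge mulr_ge0 // exprn_ge0 //.
  exact: ltW (pos _ full).
by exists k, (Ordinal Hi).
Qed.

End Main.

Local Open Scope classical_set_scope.

Theorem theorem37 (R : realType) (n : nat) (X Y : finType) (hn : (1 <= n)%N) :
  semidecidable (@pair_repr R n X Y)
    (@plants R n `*` @channels R X Y)
    (@S_FB_impossible R n X Y).
Proof.
have /choice[c Hc] : forall S : {set X * Y}, exists c : rat,
    full_rows S -> @capacity_base R X Y S c.
  move=> S; have [full|nfull] := pselect (full_rows S); last by exists 0.
  by have [c Hc] := @capacity_base_exists R X Y S full; exists c.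
split; first by move=> AW [].
have [|f Hf] := @re_certificate R n X Y c.
  by move=> S full; apply: le_trans ler01 (capacity_base_ge1 full (Hc S full)).
have [T HT] := form_semidecidable f.
exists T => AW w dom /pair_repr_entries[d [Hd Hw]].
pose a := Input dom Hd Hw.
rewrite HT (Hf a) (certificateP a hn Hc).
by split=> [H|[]].
Qed.
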